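(* There exist universal constants $c_1,c_2,c_3,c_4>0$ such that the following holds. Let $n,m\ge 2$ be integers with $n\le m\le 2n$, and let $M\in\mathbb{R}^{n\times m}$ be a random matrix with i.i.d. $\mathcal{N}(0,1)$ entries. Then for all $t>0$, with probability at least $1-c_1\exp(-c_2t^2)-c_3\exp(-c_4n)$, $$\frac{1}{4}\,\frac{\sqrt{m}-\sqrt{n}}{n}-\frac{t}{n}\;\le\; v(M)\;\le\; 40\sqrt{2}\,\frac{\sqrt{m}-\sqrt{n}}{n}+\frac{t}{n}.$$
   Context: For $d\ge 1$, $\Delta_d=\{\boldsymbol{x}\in\mathbb{R}^d: x_i\ge 0\ \forall i,\ \sum_i x_i=1\}$ is the probability simplex. For a real matrix $M\in\mathbb{R}^{n\times m}$, the value of the two-player zero-sum game defined by $M$ is $$v(M)=\min_{\boldsymbol{x}\in\Delta_n}\max_{\boldsymbol{y}\in\Delta_m}\boldsymbol{x}^TM\boldsymbol{y}.$$ The constants $c_1,\dots,c_4$ do not depend on $n$, $m$ or $t$. *)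

(* Defs.v *)
From mathcomp Require Import all_boot all_order all_algebra.
From mathcomp Require Import all_classical all_reals all_analysis.

Set Implicit Arguments.
Unset Strict Implicit.
Unset Printing Implicit Defensive.

Import Order.TTheory GRing.Theory Num.Theory.
Import numFieldNormedType.Exports.

Local Open Scope classical_set_scope.
Local Open Scope ring_scope.

Definition simplex (R : realType) (d : nat) : set 'cV[R]_d :=
  [set x | (forall i, 0 <= x i 0) /\ \sum_i x i 0 = 1].
Arguments simplex R d : clear implicits.

(* For n, m >= 1 both simplices are nonempty and compact, so the infimum and
   the suprema below are finite and attained: they are the min and the max of
   the game value. *)
Definition game_value (R : realType) (n m : nat) (M : 'M[R]_(n, m)) : R :=
  inf [set sup [set (x^T *m M *m y) 0 0 | y in simplex R m]
      | x in simplex R n].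

(* Mutual independence: the product rule for every finite subfamily. *)
Definition mutually_independent (R : realType) (d : measure_display)
    (T : measurableType d) (P : probability T R) (I : finType)
    (X : I -> {RV P >-> R}) : Prop :=
  forall (J : {set I}) (A : I -> set R),
    (forall i, measurable (A i)) ->
    P [set w | forall i, i \in J -> A i (X i w)]
      = (\prod_(i in J) P (X i @^-1` A i))%E.

(* The two laws are only compared on measurable sets: a measure is a function
   on all sets, with unspecified values outside the sigma-algebra. *)
Definition standard_normal (R : realType) (d : measure_display)
    (T : measurableType d) (P : probability T R) (X : {RV P >-> R}) : Prop :=
  forall A : set R, measurable A -> distribution P X A = normal_prob 0 1 A.

Definition iid_gaussian_entries (R : realType) (d : measure_display)
    (T : measurableType d) (P : probability T R) (n m : nat)
    (M : 'I_n -> 'I_m -> {RV P >-> R}) : Prop :=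
  mutually_independent (fun ij : 'I_n * 'I_m => M ij.1 ij.2) /\
  forall i j, standard_normal (M i j).

Definition sample_matrix (R : realType) (d : measure_display)
    (T : measurableType d) (P : probability T R) (n m : nat)
    (M : 'I_n -> 'I_m -> {RV P >-> R}) (w : T) : 'M[R]_(n, m) :=
  \matrix_(i, j) M i j w.

(* Main.v *)
Require Import Defs.
From HB Require Import structures.
From mathcomp Require Import all_boot all_order all_algebra.
From mathcomp Require Import all_classical all_reals all_analysis.
From mathcomp Require Import measurable_realfun ring lra.

Import Order.TTheory GRing.Theory Num.Theory.
Import numFieldNormedType.Exports.

Set Implicit Arguments.
Unset Strict Implicit.
Unset Printing Implicit Defensive.

Local Open Scope classical_set_scope.
Local Open Scope ring_scope.

(** The value of the game is small when some strategy [x] of the row player keeps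
    the payoff against all [y] small, and by [minimax] it is large when some [y]
    keeps the payoff against all [x] large.  Up to transposing and changing signs,
    both tails are therefore events of one form: some [x] holds
    [\sum_ij M_ij x_i y_j] below a level [l] for all [y].

    Gordon's inequality compares this Gaussian process, indexed by pairs of
    probability vectors, with the auxiliary process [|x| h.y + |y| g.x], where [g]
    and [h] have independent Gaussian coordinates.  After adding an independent
    multiple of [|x| |y|] to the first process, the two processes have equal
    covariances for pairs that share [x], and otherwise their covariances differ by
    [(|x||x'| - x.x') (|y||y'| - y.y') >= 0].  For pairs with
    different [x], the mixed second derivatives of a smooth form of the indicator
    of [forall x, exists y, lam < z (x, y)] are nonnegative ([good_jet_saddle]), so
    its expectation is larger for the first process.  The extra multiple of
    [|x| |y|] is nonpositive half of the time, which costs a factor 2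
    ([gordon_game]).

    The comparison is carried out for sums of many small independent signs instead
    of Gaussians: exchanging the steps one at a time, only second-order Taylor
    terms matter ([coins_compare]), and the smooth indicator is a product of cubic
    splines whose Taylor expansions are explicit.  The Gaussian entries are first
    rounded to a grid and then replaced by sign walks; the one-dimensional central
    limit theorem behind this ([walk_clt]) is again a replacement argument, for
    which all one needs about the Gaussian law is that the sum of two independent
    copies is [sqrt 2] times a copy, that it is symmetric with variance 1, and that
    its third moment is finite.  Compactness of the simplices enters through finite nets.

    For the auxiliary process the column player answers [x] with
    [y = h_+ / \sum_j (h_j)_+], which depends on [h] only.  With [a = |h_+|] and
    [b = |g_-|] the payoff is a positive multiple of [|x| a + g.x >= |x| (a - b)].
    If [a >= b], this is least for uniform [x].  If [a < b], short [x] are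
    controlled by the same bound and long [x] by
    [g.x >= - 1 - |x| |(g_- - 1)_+|], which gives a loss proportional to [b - a].
    Since [a^2] and [b^2] concentrate around half of the dimensions with
    deviations [s sqrt n], the difference [a - b] is of the order of
    [+- (sqrt m - sqrt n)] up to [O(s)], and this yields both bounds
    ([payoff_ge_lower], [payoff_ge_upper]).  The required concentration is a
    Chernoff bound for functions of independent walks that lie between 0 and the
    square ([tests_bound]). *)

(** * Finitely supported measures as weighted lists *)

Section FiniteMeasures.
Variables (R : realType) (V : zmodType).
Implicit Types (mu nu : seq (R * V)) (f g : V -> R) (z v : V).

(** The average of [f] around [z].  Averages are used as operators on functions:
    they commute, and they compose along convolution. *)
Definition avg mu f z : R := \sum_(p <- mu) p.1 * f (z + p.2).

Definition conv mu nu : seq (R * V) :=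
  [seq (p.1 * q.1, p.2 + q.2) | p <- mu, q <- nu].

Definition dirac0 : seq (R * V) := [:: (1, 0)].

Definition cpow mu N : seq (R * V) := iter N (conv mu) dirac0.

Definition bigconv (mus : seq (seq (R * V))) : seq (R * V) :=
  foldr conv dirac0 mus.

(** The mass may be less than 1, because rounding drops the Gaussian mass outside a
    box. *)
Definition subprob mu : Prop :=
  (forall p, p \in mu -> 0 <= p.1) /\ \sum_(p <- mu) p.1 <= 1.

Definition coin v : seq (R * V) := [:: (2^-1, v); (2^-1, - v)].

(** One step of a walk: independent signs in all the directions of [vs]. *)
Definition coins (vs : seq V) : seq (R * V) := bigconv [seq coin v | v <- vs].

Lemma avg_dirac0 f : avg dirac0 f = f.
Proof. by apply/funext => z; rewrite /avg big_seq1 mul1r addr0. Qed.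

Lemma avg_conv mu nu f : avg (conv mu nu) f = avg mu (avg nu f).
Proof.
apply/funext => z; rewrite /avg /conv big_allpairs_dep; apply: eq_bigr => p _.
by rewrite mulr_sumr; apply: eq_bigr => q _ /=; rewrite mulrA addrA.
Qed.

Lemma avgC mu nu f : avg mu (avg nu f) = avg nu (avg mu f).
Proof.
apply/funext => z; rewrite /avg; under eq_bigr do rewrite mulr_sumr.
under [RHS]eq_bigr do rewrite mulr_sumr.
rewrite exchange_big; apply: eq_bigr => q _; apply: eq_bigr => p _.
by rewrite mulrCA addrAC.
Qed.

Lemma avg_cpowS mu N f : avg (cpow mu N.+1) f = avg mu (avg (cpow mu N) f).
Proof. exact: avg_conv. Qed.

Lemma avg_cpow_conv mu nu N f :
  avg (cpow (conv mu nu) N) f = avg (cpow mu N) (avg (cpow nu N) f).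
Proof.
elim: N f => [|N IH] f; first by rewrite /= !avg_dirac0.
by rewrite !avg_cpowS avg_conv IH (avgC nu).
Qed.

Lemma cpow_dirac0 N f : avg (cpow dirac0 N) f = f.
Proof. by elim: N f => [|N IH] f; rewrite ?avg_cpowS ?IH avg_dirac0. Qed.

Lemma avg_cpow_bigconv mus N f :
  avg (cpow (bigconv mus) N) f = avg (bigconv [seq cpow mu N | mu <- mus]) f.
Proof.
elim: mus f => [|mu mus IH] f; first by rewrite cpow_dirac0 avg_dirac0.
by rewrite /= avg_cpow_conv avg_conv IH.
Qed.

Lemma subprob_dirac0 : subprob dirac0.
Proof. by split=> [p|]; rewrite ?inE ?big_seq1// => /eqP->. Qed.

Lemma subprob_conv mu nu : subprob mu -> subprob nu -> subprob (conv mu nu).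
Proof.
move=> [p1 s1] [p2 s2]; split.
  by move=> _ /allpairsP[[p q] [/= pm qn ->]] /=; exact: mulr_ge0 (p1 _ pm) (p2 _ qn).
rewrite big_allpairs_dep /=; under eq_bigr do rewrite -mulr_sumr.
by rewrite -mulr_suml mulr_ile1// big_seq sumr_ge0.
Qed.

Lemma subprob_bigconv mus :
  (forall mu, mu \in mus -> subprob mu) -> subprob (bigconv mus).
Proof.
elim: mus => [|mu mus IH] H; first exact: subprob_dirac0.
apply: subprob_conv; first by apply: H; rewrite mem_head.
by apply: IH => nu Hn; apply: H; rewrite inE Hn orbT.
Qed.

Lemma subprob_cpow mu N : subprob mu -> subprob (cpow mu N).
Proof.
move=> H; elim: N => [|N IH]; first exact: subprob_dirac0.
exact: subprob_conv.
Qed.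

Lemma subprob_coin v : subprob (coin v).
Proof.
split=> [p|]; first by rewrite !inE => /orP[]/eqP-> /=; rewrite invr_ge0.
by rewrite big_cons big_seq1 /=; lra.
Qed.

Lemma subprob_coins vs : subprob (coins vs).
Proof. by apply: subprob_bigconv => mu /mapP[v _ ->]; exact: subprob_coin. Qed.

Lemma avg_coin v f z : avg (coin v) f z = 2^-1 * (f (z + v) + f (z - v)).
Proof. by rewrite /avg big_cons big_seq1 mulrDr. Qed.

Lemma cpow_cst mu N c z : (forall y, avg mu (fun=> c) y = c) -> avg (cpow mu N) (fun=> c) z = c.
Proof.
move=> /funext mc; elim: N z => [|N IH] z; first by rewrite avg_dirac0.
by rewrite avg_cpowS (funext IH) mc.
Qed.

Lemma coin_cst v c z : avg (coin v) (fun=> c) z = c.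
Proof. by rewrite avg_coin -mulr2n -[c *+ 2]mulr_natl mulrA mulVf ?mul1r. Qed.

Lemma coins_cst vs c z : avg (coins vs) (fun=> c) z = c.
Proof.
elim: vs z => [|v vs IH] z; first by rewrite /coins /= avg_dirac0.
by rewrite /coins /= avg_conv -/(coins vs) (funext IH) coin_cst.
Qed.

Lemma avg_le mu f g z : subprob mu -> (forall y, f y <= g y) ->
  avg mu f z <= avg mu g z.
Proof.
move=> [p0 _] fg; rewrite /avg big_seq [leRHS]big_seq.
by apply: ler_sum => p pm; rewrite ler_wpM2l// p0.
Qed.

Lemma avg_dist mu f g e z : subprob mu -> (forall y, `|f y - g y| <= e) ->
  `|avg mu f z - avg mu g z| <= e.
Proof.
move=> [p0 s1] fg; rewrite /avg -sumrB.
have e0 : 0 <= e by exact: le_trans (normr_ge0 _) (fg 0).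
apply: le_trans (ler_norm_sum _ _ _) _.
apply: (@le_trans _ _ (\sum_(p <- mu) p.1 * e)).
  rewrite big_seq [leRHS]big_seq; apply: ler_sum => p pm.
  by rewrite -mulrBr normrM ger0_norm ?p0// ler_wpM2l// p0.
by rewrite -mulr_suml ler_piMl.
Qed.

Lemma avg_bound mu f e z : subprob mu -> (forall y, `|f y| <= e) ->
  `|avg mu f z| <= e.
Proof.
move=> sm fe; have := @avg_dist mu f (fun=> 0) e z sm.
have -> : avg mu (fun=> 0) z = 0 by rewrite /avg big1// => p _; rewrite mulr0.
by rewrite subr0; apply => y; rewrite subr0.
Qed.

Lemma avg_ge0 mu f z : subprob mu -> (forall y, 0 <= f y) -> 0 <= avg mu f z.
Proof.
move=> [p0 _] f0; rewrite /avg big_seq sumr_ge0// => p pm.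
by rewrite mulr_ge0 ?p0.
Qed.

Lemma avgD mu f g z : avg mu (fun y => f y + g y) z = avg mu f z + avg mu g z.
Proof. by rewrite /avg -big_split; apply: eq_bigr => p _; rewrite mulrDr. Qed.

Lemma avgZ mu c f z : avg mu (fun y => c * f y) z = c * avg mu f z.
Proof. by rewrite /avg mulr_sumr; apply: eq_bigr => p _; rewrite mulrCA. Qed.

Lemma avg_sum mu (I : Type) (r : seq I) (F : I -> V -> R) z :
  avg mu (fun y => \sum_(i <- r) F i y) z = \sum_(i <- r) avg mu (F i) z.
Proof.
by rewrite /avg exchange_big; apply: eq_bigr => p _; rewrite mulr_sumr.
Qed.

Lemma avg_shift mu f z v : avg mu (fun y => f (y + v)) z = avg mu f (z + v).
Proof. by rewrite /avg; apply: eq_bigr => p _; rewrite addrAC. Qed.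

(** Replacing the factors of a convolution one at a time: each replacement can
    be moved innermost because averages commute. *)
Lemma bigconv_replace (I : eqType) (r : seq I) (mu nu : I -> seq (R * V)) f e z :
  (forall i, i \in r -> subprob (mu i)) ->
  (forall i, i \in r -> subprob (nu i)) ->
  (forall i y, i \in r -> `|avg (mu i) f y - avg (nu i) f y| <= e) ->
  `|avg (bigconv [seq mu i | i <- r]) f z -
    avg (bigconv [seq nu i | i <- r]) f z| <= (size r)%:R * e.
Proof.
elim: r z => [|i r IH] z Hm Hn He; first by rewrite subrr normr0 mul0r.
have Hm' j : j \in r -> subprob (mu j) by move=> jr; apply: Hm; rewrite inE jr orbT.
have Hn' j : j \in r -> subprob (nu j) by move=> jr; apply: Hn; rewrite inE jr orbT.
rewrite /= !avg_conv.
set A := bigconv _; set B := bigconv _.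
have sB : subprob B.
  by apply: subprob_bigconv => _ /mapP[j jr ->]; exact: Hn'.
apply: (@le_trans _ _ (`|avg (mu i) (avg A f) z - avg (mu i) (avg B f) z| +
   `|avg (mu i) (avg B f) z - avg (nu i) (avg B f) z|)).
  by rewrite -[X in `|X| <= _](subrKA (avg (mu i) (avg B f) z)) ler_normD.
rewrite -[(size r).+1]addn1 natrD mulrDl mul1r lerD//.
  apply: avg_dist; first by apply: Hm; rewrite mem_head.
  move=> y; apply: IH => // j y' jr; apply: He; by rewrite inE jr orbT.
rewrite (avgC (mu i)) (avgC (nu i)); apply: avg_dist => // y.
by apply: He; rewrite mem_head.
Qed.

End FiniteMeasures.

Arguments dirac0 {R V}.

Section Pushforward.
Variables (R : realType) (V W : zmodType) (L : {additive V -> W}).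
Implicit Types (mu nu : seq (R * V)) (f : W -> R).

Definition push mu : seq (R * W) := [seq (p.1, L p.2) | p <- mu].

Lemma avg_push mu f z : avg (push mu) f z = avg mu (fun y => f (z + L y)) 0.
Proof. by rewrite /avg big_map; apply: eq_bigr => p _; rewrite add0r. Qed.

Lemma subprob_push mu : subprob mu -> subprob (push mu).
Proof.
by move=> [p0 s1]; split; [move=> _ /mapP[p pm ->]; exact: p0|rewrite big_map].
Qed.

Lemma avg_pushL mu f z : avg (push mu) f (L z) = avg mu (f \o L) z.
Proof.
rewrite avg_push /avg; apply: eq_bigr => p _.
by rewrite add0r /= raddfD.
Qed.

Lemma push_conv mu nu : push (conv mu nu) = conv (push mu) (push nu).
Proof.
rewrite /push /conv map_allpairs allpairs_mapl allpairs_mapr.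
by apply: eq_allpairs => // p q /=; rewrite raddfD.
Qed.

Lemma push_dirac0 : push dirac0 = dirac0.
Proof. by rewrite /push /= raddf0. Qed.

Lemma push_cpow mu N : push (cpow mu N) = cpow (push mu) N.
Proof. by elim: N => [|N IH]; rewrite ?push_dirac0 //= push_conv IH. Qed.

Lemma push_coin v : push (coin R v) = coin R (L v).
Proof. by rewrite /push /= raddfN. Qed.

Lemma push_bigconv mus : push (bigconv mus) = bigconv [seq push mu | mu <- mus].
Proof. by elim: mus => [|mu mus IH]; rewrite ?push_dirac0 //= push_conv IH. Qed.

Lemma push_coins vs : push (coins R vs) = coins R [seq L v | v <- vs].
Proof.
rewrite push_bigconv /coins -!map_comp; congr bigconv; apply: eq_map => v /=.
exact: push_coin.
Qed.

End Pushforward.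

(** * A spline step function *)

Section Spline.
Variable R : realType.
Implicit Types r h : R.

Definition pos r : R := Num.max r 0.

Lemma posE r : pos r = if 0 <= r then r else 0.
Proof. by rewrite /pos; case: leP. Qed.

Lemma pos_cases r : (pos r = r /\ pos (- r) = 0) \/ (pos r = 0 /\ pos (- r) = - r).
Proof. by rewrite !posE; case: (leP 0 r) => r0; case: (leP 0 (- r)) => r1; [left|left|right|right]; split=> //; lra. Qed.

Lemma pos_sqrD r : pos r ^+ 2 + pos (- r) ^+ 2 = r ^+ 2.
Proof. by case: (pos_cases r) => -[-> ->]; ring. Qed.

Lemma pos_quarticD r : pos r ^+ 4 + pos (- r) ^+ 4 = r ^+ 4.
Proof. by case: (pos_cases r) => -[-> ->]; ring. Qed.

Lemma pos_lip r h : `|pos (r + h) - pos r| <= `|h|.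
Proof.
rewrite !posE; case: (leP 0 (r + h)) => ?; case: (leP 0 r) => ?;
  case: (ger0P h) => ?; rewrite ler_norml; apply/andP; split; lra.
Qed.

Lemma pos2_taylor r h : `|pos (r + h) ^+ 2 - pos r ^+ 2 - 2 * pos r * h| <= `|h| ^+ 2.
Proof.
rewrite !posE real_normK ?num_real// ler_norml.
by case: (leP 0 (r + h)) => ?; case: (leP 0 r) => ?; apply/andP; split; nra.
Qed.

Lemma pos3_taylor r h :
  `|pos (r + h) ^+ 3 - pos r ^+ 3 - 3 * pos r ^+ 2 * h - 3 * pos r * h ^+ 2|
  <= `|h| ^+ 3.
Proof.
rewrite !posE; case: (leP 0 (r + h)) => H1; case: (leP 0 r) => H2.
- have -> : (r + h) ^+ 3 - r ^+ 3 - 3 * r ^+ 2 * h - 3 * r * h ^+ 2 = h ^+ 3 by ring.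
  by rewrite normrX.
- rewrite !expr0n /= !mulr0 !mul0r !subr0 -normrX ger0_norm ?exprn_ge0//.
  have h0 : 0 <= h by lra.
  by rewrite normrX ger0_norm// lerXn2r ?nnegrE//; lra.
- have h0 : h < 0 by lra.
  have -> : 0 ^+ 3 - r ^+ 3 - 3 * r ^+ 2 * h - 3 * r * h ^+ 2 =
    (- (r + h)) ^+ 3 - (- h) ^+ 3 by ring.
  rewrite (ltr0_norm h0) ler_norml.
  have : 0 <= (- (r + h)) ^+ 3 by rewrite exprn_ge0//; lra.
  have : (- (r + h)) ^+ 3 <= (- h) ^+ 3 by rewrite lerXn2r ?nnegrE//; lra.
  have : 0 <= (- h) ^+ 3 by rewrite exprn_ge0//; lra.
  by move=> ? ? ?; apply/andP; split; lra.
- by rewrite !expr0n /= !mulr0 !mul0r !subr0 normr0 exprn_ge0.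
Qed.

(** A C^2 step from 0 (on r <= 0) to 1 (on r >= 3): the integral of the
    quadratic B-spline, i.e. a third difference of truncated cubes.  [step1] and
    [step2] are its two derivatives. *)
Definition step0 r := (pos r ^+ 3 - 3 * pos (r - 1) ^+ 3 + 3 * pos (r - 2) ^+ 3
  - pos (r - 3) ^+ 3) / 6.
Definition step1 r := (pos r ^+ 2 - 3 * pos (r - 1) ^+ 2 + 3 * pos (r - 2) ^+ 2
  - pos (r - 3) ^+ 2) / 2.
Definition step2 r := pos r - 3 * pos (r - 1) + 3 * pos (r - 2) - pos (r - 3).

(** The polynomial pieces, in a local coordinate; the last one is measured from
    the right end, where the spline is symmetric to the first one. *)
Lemma step_cases r :
  [\/ [/\ 0 <= step0 r <= 1, step1 r = 0 & step2 r = 0],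
      exists2 u, 0 <= u <= 1 & [/\ step0 r = u ^+ 3 / 6, step1 r = u ^+ 2 / 2 & step2 r = u],
      exists2 u, 0 <= u <= 1 & [/\ step0 r = (1 + 3 * u + 3 * u ^+ 2 - 2 * u ^+ 3) / 6,
         step1 r = (1 + 2 * u - 2 * u ^+ 2) / 2 & step2 r = 1 - 2 * u] |
      exists2 u, 0 <= u <= 1 & [/\ step0 r = 1 - u ^+ 3 / 6, step1 r = u ^+ 2 / 2 & step2 r = - u]].
Proof.
rewrite /step0 /step1 /step2 !posE.
case: (leP 0 r) => h0; last first.
  have [h1 h2 h3] : [/\ r - 1 < 0, r - 2 < 0 & r - 3 < 0] by split; lra.
  by constructor 1; rewrite !(leNgt 0) h1 h2 h3 /=; split; lra.
case: (leP 0 (r - 1)) => h1; last first.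
  have [h2 h3] : r - 2 < 0 /\ r - 3 < 0 by split; lra.
  constructor 2; exists r; first by apply/andP; split; lra.
  by rewrite !(leNgt 0) h2 h3 /=; split; field.
case: (leP 0 (r - 2)) => h2; last first.
  have h3 : r - 3 < 0 by lra.
  constructor 3; exists (r - 1); first by apply/andP; split; lra.
  by rewrite (leNgt 0) h3 /=; split; field.
case: (leP 0 (r - 3)) => h3; last first.
  constructor 4; exists (3 - r); first by apply/andP; split; lra.
  by split; field.
constructor 1; split; [|by field|by ring].
have -> : (r ^+ 3 - 3 * (r - 1) ^+ 3 + 3 * (r - 2) ^+ 3 - (r - 3) ^+ 3) / 6 = 1 by field.
by rewrite ler01 lexx.
Qed.

Lemma step0_le0 r : r <= 0 -> step0 r = 0.
Proof.
move=> r0; have [h0 h1 h2 h3] : [/\ pos r = 0, pos (r - 1) = 0, pos (r - 2) = 0 & pos (r - 3) = 0].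
  by split; apply: max_r; lra.
by rewrite /step0 h0 h1 h2 h3; field.
Qed.

Lemma step0_ge3 r : 3 <= r -> step0 r = 1.
Proof.
move=> r0; have [h0 h1 h2 h3] : [/\ pos r = r, pos (r - 1) = r - 1, pos (r - 2) = r - 2 & pos (r - 3) = r - 3].
  by split; apply: max_l; lra.
by rewrite /step0 h0 h1 h2 h3; field.
Qed.

Lemma step_bounds r : [/\ 0 <= step0 r <= 1, 0 <= step1 r <= 1 & `|step2 r| <= 1].
Proof.
case: (step_cases r) => [[h -> ->]|[u /andP[u0 u1] [-> -> ->]]|
  [u /andP[u0 u1] [-> -> ->]]|[u /andP[u0 u1] [-> -> ->]]].
- by rewrite normr0; split; lra.
- have : u ^+ 2 <= 1 by rewrite expr_le1.
  have : u ^+ 3 <= 1 by rewrite expr_le1.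
  have : 0 <= u ^+ 2 by rewrite exprn_ge0.
  have : 0 <= u ^+ 3 by rewrite exprn_ge0.
  by rewrite ger0_norm//; split; lra.
- have : u ^+ 2 <= u by rewrite expr2 ler_piMr.
  have : u ^+ 3 <= u ^+ 2 by rewrite (exprS u 2) ler_piMl// exprn_ge0.
  have : 0 <= u ^+ 2 by rewrite exprn_ge0.
  have : 0 <= u ^+ 3 by rewrite exprn_ge0.
  have ? : 0 <= (1 - u) ^+ 2 * (1 + 2 * u) by rewrite mulr_ge0 ?exprn_ge0//; lra.
  have ? : (1 - u) ^+ 2 * (1 + 2 * u) = 1 - 3 * u ^+ 2 + 2 * u ^+ 3 by ring.
  have ? : 0 <= (u - 2^-1) ^+ 2 by rewrite sqr_ge0.
  have ? : (u - 2^-1) ^+ 2 = u ^+ 2 - u + 4^-1 by field.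
  by rewrite ler_norml; split; lra.
- have : u ^+ 2 <= 1 by rewrite expr_le1.
  have : u ^+ 3 <= 1 by rewrite expr_le1.
  have : 0 <= u ^+ 2 by rewrite exprn_ge0.
  have : 0 <= u ^+ 3 by rewrite exprn_ge0.
  by rewrite normrN ger0_norm//; split; lra.
Qed.

Lemma third_difference_le (F : R -> R) r e : (forall x, `|F x| <= e) ->
  `|F r - 3 * F (r - 1) + 3 * F (r - 2) - F (r - 3)| <= 8 * e.
Proof.
move=> H; have := H r; have := H (r - 1); have := H (r - 2); have := H (r - 3).
rewrite !ler_norml => /andP[? ?] /andP[? ?] /andP[? ?] /andP[? ?].
by apply/andP; split; lra.
Qed.

Lemma step0_taylor r h :
  `|step0 (r + h) - step0 r - step1 r * h - 2^-1 * (step2 r * h * h)| <= 2 * `|h| ^+ 3.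
Proof.
have := third_difference_le r (pos3_taylor ^~ h).
rewrite -!(addrAC r h); set T := (X in `|X|); rewrite (_ : step0 _ - _ - _ - _ = 6^-1 * T) => [H|].
  rewrite normrM ger0_norm ?invr_ge0// ler_pdivrMl//; apply: le_trans H _.
  by rewrite [leRHS]mulrA ler_wpM2r ?exprn_ge0// -natrM ler_nat.
by rewrite /T /step0 /step1 /step2; field.
Qed.

Lemma step1_taylor r h : `|step1 (r + h) - step1 r - step2 r * h| <= 4 * `|h| ^+ 2.
Proof.
have := third_difference_le r (pos2_taylor ^~ h); rewrite -!(addrAC r h).
set T := (X in `|X|); rewrite (_ : step1 _ - _ - _ = 2^-1 * T) => [H|].
  by rewrite normrM ger0_norm ?invr_ge0// ler_pdivrMl// mulrA -natrM.
by rewrite /T /step1 /step2; field.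
Qed.

Lemma step2_lip r h : `|step2 (r + h) - step2 r| <= 8 * `|h|.
Proof.
have := third_difference_le r (pos_lip ^~ h); rewrite -!(addrAC r h).
by congr (`|_| <= _); rewrite /step2; ring.
Qed.

Lemma step1_lip r h : `|step1 (r + h) - step1 r| <= 5 * `|h|.
Proof.
have [_ /andP[a0 a1] b] := step_bounds r; have [_ /andP[c0 c1] _] := step_bounds (r + h).
have [h1|h1] := leP `|h| 1; last first.
  by rewrite ler_norml; apply/andP; split; lra.
have T := step1_taylor r h.
have -> : step1 (r + h) - step1 r =
  (step1 (r + h) - step1 r - step2 r * h) + step2 r * h by ring.
apply: le_trans (ler_normD _ _) _.
have : `|step2 r * h| <= `|h| by rewrite normrM ler_piMl.
have : `|h| ^+ 2 <= `|h| by rewrite expr2 ler_piMr.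
by lra.
Qed.

Lemma step0_lip r h : `|step0 (r + h) - step0 r| <= 4 * `|h|.
Proof.
have [/andP[a0 a1] /andP[d0 d1] b] := step_bounds r.
have [/andP[c0 c1] _ _] := step_bounds (r + h).
have [h1|h1] := leP `|h| 1; last first.
  by rewrite ler_norml; apply/andP; split; lra.
have T := step0_taylor r h.
have -> : step0 (r + h) - step0 r =
  (step0 (r + h) - step0 r - step1 r * h - 2^-1 * (step2 r * h * h))
  + (step1 r * h + 2^-1 * (step2 r * h * h)) by ring.
apply: le_trans (ler_normD _ _) _.
have : `|step1 r * h + 2^-1 * (step2 r * h * h)| <= `|h| + 2^-1 * `|h|.
  apply: le_trans (ler_normD _ _) _; apply: lerD.
    by rewrite normrM ler_piMl// ger0_norm.
  rewrite normrM ger0_norm ?invr_ge0// ler_wpM2l ?invr_ge0// normrM ler_piMl//.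
  by rewrite normrM mulr_ile1.
have : `|h| ^+ 3 <= `|h| by rewrite -[leRHS]expr1 ler_wiXn2l.
have := normr_ge0 h.
by lra.
Qed.

End Spline.

(** * Lindeberg replacement for sign walks *)

Section Jets.
Variables (R : realType) (A : finType).
Local Notation V := {ffun A -> R}.
Implicit Types (f g : V -> R) (D : A -> V -> R) (H : A -> A -> V -> R) (z v w : V).

Definition nrm v : R := \sum_a `|v a|.

Lemma nrm_ge0 v : 0 <= nrm v.
Proof. by apply: sumr_ge0. Qed.

Lemma nrm_coord v a : `|v a| <= nrm v.
Proof. by rewrite /nrm (bigD1 a)//= lerDl sumr_ge0. Qed.

Lemma nrmZ (s : R) v : nrm (s *: v) = `|s| * nrm v.
Proof.
by rewrite /nrm mulr_sumr; apply: eq_bigr => a _; rewrite ffunE normrM.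
Qed.

Lemma nrmN v : nrm (- v) = nrm v.
Proof. by rewrite /nrm; apply: eq_bigr => a _; rewrite ffunE normrN. Qed.

Definition blip (K : R) f := (forall z, `|f z| <= K) /\
  (forall z v, `|f (z + v) - f z| <= K * nrm v).

Lemma blipD K1 K2 f g : blip K1 f -> blip K2 g -> blip (K1 + K2) (fun z => f z + g z).
Proof.
move=> [f1 f2] [g1 g2]; split=> [z|z v].
  by rewrite (le_trans (ler_normD _ _))// lerD.
rewrite opprD addrACA mulrDl (le_trans (ler_normD _ _))//.
by rewrite lerD ?f2 ?g2.
Qed.

Lemma blipM K f g : 0 <= K -> blip K f -> blip K g ->
  blip (2 * K ^+ 2) (fun z => f z * g z).
Proof.
move=> K0 [f1 f2] [g1 g2]; split=> [z|z v].
  rewrite normrM; apply: (@le_trans _ _ (K * K)); first by rewrite ler_pM.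
  by have := sqr_ge0 K; rewrite expr2; lra.
have -> : f (z + v) * g (z + v) - f z * g z =
  (f (z + v) - f z) * g (z + v) + f z * (g (z + v) - g z) by ring.
apply: le_trans (ler_normD _ _) _; rewrite !normrM.
have -> : 2 * K ^+ 2 * nrm v = K * nrm v * K + K * (K * nrm v) by ring.
by rewrite lerD// ler_pM.
Qed.

Lemma blip_le K K' f : K <= K' -> blip K f -> blip K' f.
Proof.
move=> KK [f1 f2]; split=> [z|z v]; first exact: le_trans (f1 z) _.
by rewrite (le_trans (f2 z v))// ler_wpM2r// nrm_ge0.
Qed.

Lemma blip_cst K (c : R) : `|c| <= K -> blip K (fun=> c).
Proof.
move=> cK; split=> // z v; rewrite subrr normr0 mulr_ge0 ?nrm_ge0//.
exact: le_trans cK.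
Qed.

Definition lin D z v : R := \sum_a D a z * v a.
Definition quad H z v : R := \sum_a \sum_b H a b z * v a * v b.

(** [jet K f D H]: the gradient [D] and the Hessian [H] of [f] are bounded and
    Lipschitz, with a uniform third-order Taylor remainder.  This is all of the
    smoothness that the replacement argument uses, and it is stable under
    products, so that no derivative ever has to be computed. *)
Definition jet K f D H := [/\ 0 <= K, blip K f, (forall a, blip K (D a)),
  (forall a b, blip K (H a b)) &
  forall z v, `|f (z + v) - f z - lin D z v - 2^-1 * quad H z v| <= K * nrm v ^+ 3].

Lemma lin_le K D z v : (forall a, blip K (D a)) -> `|lin D z v| <= K * nrm v.
Proof.
move=> HD; rewrite /lin /nrm mulr_sumr (le_trans (ler_norm_sum _ _ _))//.
by apply: ler_sum => a _; rewrite normrM ler_wpM2r//; case: (HD a).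
Qed.

Lemma sum_pair_abs v : \sum_a \sum_b `|v a| * `|v b| = nrm v ^+ 2.
Proof.
rewrite expr2 /nrm mulr_suml; apply: eq_bigr => a _.
by rewrite mulr_sumr.
Qed.

Lemma quad_le K H z v : (forall a b, blip K (H a b)) -> `|quad H z v| <= K * nrm v ^+ 2.
Proof.
move=> HH; rewrite /quad -sum_pair_abs mulr_sumr (le_trans (ler_norm_sum _ _ _))//.
apply: ler_sum => a _; rewrite mulr_sumr (le_trans (ler_norm_sum _ _ _))//.
apply: ler_sum => b _; rewrite !normrM -mulrA ler_wpM2r ?mulr_ge0//.
by case: (HH a b).
Qed.

Lemma quad_lip K H z y v : (forall a b, blip K (H a b)) ->
  `|quad H (z + y) v - quad H z v| <= K * nrm y * nrm v ^+ 2.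
Proof.
move=> HH; rewrite /quad -sum_pair_abs mulr_sumr -sumrB (le_trans (ler_norm_sum _ _ _))//.
apply: ler_sum => a _; rewrite mulr_sumr -sumrB (le_trans (ler_norm_sum _ _ _))//.
apply: ler_sum => b _; rewrite -!mulrBl !normrM -mulrA ler_wpM2r ?mulr_ge0//.
by case: (HH a b).
Qed.

Lemma jet_le K K' f D H : K <= K' -> jet K f D H -> jet K' f D H.
Proof.
move=> KK [K0 f1 D1 H1 T]; split.
- exact: le_trans KK.
- exact: blip_le f1.
- by move=> a; apply: blip_le (D1 a).
- by move=> a b; apply: blip_le (H1 a b).
- by move=> z v; rewrite (le_trans (T z v))// ler_wpM2r// exprn_ge0// nrm_ge0.
Qed.

(** For [n <= 1] the remainder of a product is expanded in the remainders of its
    factors; for [n > 1] every single term is already at most [K^2 n^3]. *)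
Lemma product_remainder (K n a1 L1 q1 A1 a2 L2 q2 A2 : R) : 0 <= K -> 0 <= n ->
  `|a1| <= K -> `|L1| <= K * n -> `|q1| <= K * n ^+ 2 -> `|A1| <= K ->
  `|A1 - a1 - L1 - 2^-1 * q1| <= K * n ^+ 3 ->
  `|a2| <= K -> `|L2| <= K * n -> `|q2| <= K * n ^+ 2 -> `|A2| <= K ->
  `|A2 - a2 - L2 - 2^-1 * q2| <= K * n ^+ 3 ->
  `|A1 * A2 - a1 * a2 - (a1 * L2 + a2 * L1)
     - 2^-1 * (a1 * q2 + a2 * q1 + 2 * L1 * L2)| <= 8 * K ^+ 2 * n ^+ 3.
Proof.
move=> K0 n0 ha1 hL1 hq1 hA1 hr1 ha2 hL2 hq2 hA2 hr2.
have M (x y a b : R) : `|x| <= a -> `|y| <= b -> `|x * y| <= a * b.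
  by move=> xa yb; rewrite normrM ler_pM.
have [n1|n1] := leP n 1.
  set r1 := A1 - a1 - L1 - 2^-1 * q1 in hr1.
  set r2 := A2 - a2 - L2 - 2^-1 * q2 in hr2.
  have -> : A1 * A2 - a1 * a2 - (a1 * L2 + a2 * L1)
     - 2^-1 * (a1 * q2 + a2 * q1 + 2 * L1 * L2) =
    r1 * A2 + a1 * r2 + L1 * r2 + 2^-1 * (q1 * r2) + 2^-1 * (L1 * q2)
     + 2^-1 * (q1 * L2) + 4^-1 * (q1 * q2).
    by rewrite /r1 /r2; field.
  have := M _ _ _ _ hr1 hA2; have := M _ _ _ _ ha1 hr2; have := M _ _ _ _ hL1 hr2.
  have := M _ _ _ _ hq1 hr2; have := M _ _ _ _ hL1 hq2; have := M _ _ _ _ hq1 hL2.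
  have := M _ _ _ _ hq1 hq2.
  have K2 : 0 <= K ^+ 2 by rewrite exprn_ge0.
  have n3 : 0 <= n ^+ 3 by rewrite exprn_ge0.
  have n43 : n ^+ 4 <= n ^+ 3 by rewrite (exprS n 3) ler_piMl.
  have n53 : n ^+ 5 <= n ^+ 3 by rewrite ler_wiXn2l.
  have := ler_wpM2l K2 n43; have := ler_wpM2l K2 n53.
  have -> : K * n ^+ 3 * K = K ^+ 2 * n ^+ 3 by ring.
  have -> : K * (K * n ^+ 3) = K ^+ 2 * n ^+ 3 by ring.
  have -> : K * n * (K * n ^+ 3) = K ^+ 2 * n ^+ 4 by ring.
  have -> : K * n ^+ 2 * (K * n ^+ 3) = K ^+ 2 * n ^+ 5 by ring.
  have -> : K * n * (K * n ^+ 2) = K ^+ 2 * n ^+ 3 by ring.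
  have -> : K * n ^+ 2 * (K * n) = K ^+ 2 * n ^+ 3 by ring.
  have -> : K * n ^+ 2 * (K * n ^+ 2) = K ^+ 2 * n ^+ 4 by ring.
  have : 0 <= K ^+ 2 * n ^+ 3 by rewrite mulr_ge0.
  rewrite !ler_norml => ? ? ? /andP[? ?] /andP[? ?] /andP[? ?] /andP[? ?] /andP[? ?] /andP[? ?] /andP[? ?].
  by apply/andP; split; lra.
have := M _ _ _ _ hA1 hA2; have := M _ _ _ _ ha1 ha2; have := M _ _ _ _ ha1 hL2.
have := M _ _ _ _ ha2 hL1; have := M _ _ _ _ ha1 hq2; have := M _ _ _ _ ha2 hq1.
have := M _ _ _ _ hL1 hL2.
have K2 : 0 <= K ^+ 2 by rewrite exprn_ge0.
have n3 : 0 <= n ^+ 3 by rewrite exprn_ge0.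
have n23 : n ^+ 2 <= n ^+ 3 by rewrite (exprS n 2) ler_peMl ?exprn_ge0// ltW.
have n13 : n <= n ^+ 3 by rewrite (exprS n 2) ler_peMr// exprn_ege1// ltW.
have n03 : 1 <= n ^+ 3 by rewrite exprn_ege1// ltW.
have := ler_wpM2l K2 n23; have := ler_wpM2l K2 n13; have := ler_wpM2l K2 n03.
have -> : K * n * (K * n) = K ^+ 2 * n ^+ 2 by ring.
have -> : K * (K * n ^+ 2) = K ^+ 2 * n ^+ 2 by ring.
have -> : K * (K * n) = K ^+ 2 * n by ring.
have -> : K * K = K ^+ 2 by ring.
rewrite mulr1 !ler_norml => ? ? ? /andP[? ?] /andP[? ?] /andP[? ?] /andP[? ?] /andP[? ?] /andP[? ?] /andP[? ?].
by apply/andP; split; lra.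
Qed.

Definition gradM f D g E : A -> V -> R := fun a z => f z * E a z + g z * D a z.
Definition hessM f D H g E I : A -> A -> V -> R := fun a b z =>
  (f z * I a b z + g z * H a b z) + (D a z * E b z + D b z * E a z).

Lemma jetM K f D H g E I : jet K f D H -> jet K g E I ->
  jet (8 * K ^+ 2) (fun z => f z * g z) (gradM f D g E) (hessM f D H g E I).
Proof.
move=> [K0 f0 D0 H0 T1] [_ g0 E0 I0 T2].
have K2 : 0 <= K ^+ 2 by rewrite exprn_ge0.
split; first lra.
- by apply: (@blip_le (2 * K ^+ 2)); [lra|exact: blipM].
- move=> a; apply: (@blip_le (2 * K ^+ 2 + 2 * K ^+ 2)); first lra.
  by apply: blipD; exact: blipM.
- move=> a b; apply: (@blip_le ((2 * K ^+ 2 + 2 * K ^+ 2) + (2 * K ^+ 2 + 2 * K ^+ 2))); first lra.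
  by apply: blipD; apply: blipD; exact: blipM.
move=> z v.
have -> : lin (gradM f D g E) z v = f z * lin E z v + g z * lin D z v.
  rewrite /lin !mulr_sumr -big_split; apply: eq_bigr => a _ /=.
  by rewrite /gradM; ring.
have -> : quad (hessM f D H g E I) z v = f z * quad I z v + g z * quad H z v +
   2 * lin D z v * lin E z v.
  have -> : 2 * lin D z v * lin E z v =
     \sum_a \sum_b (D a z * E b z + D b z * E a z) * v a * v b.
    transitivity (lin D z v * lin E z v + lin E z v * lin D z v); first ring.
    rewrite {1 4}/lin !mulr_suml -big_split; apply: eq_bigr => a _ /=.
    rewrite /lin !mulr_sumr -big_split; apply: eq_bigr => b _ /=.
    by ring.
  rewrite /quad !mulr_sumr -!big_split; apply: eq_bigr => a _ /=.
  rewrite !mulr_sumr -!big_split; apply: eq_bigr => b _ /=.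
  by rewrite /hessM; ring.
apply: product_remainder => //; rewrite ?nrm_ge0//;
  by [case: f0|case: g0|exact: lin_le|exact: quad_le].
Qed.

Lemma jet_cst (c : R) : jet `|c| (fun=> c) (fun _ _ => 0) (fun _ _ _ => 0).
Proof.
split=> //.
- exact: blip_cst.
- by move=> a; apply: blip_cst; rewrite normr0.
- by move=> a b; apply: blip_cst; rewrite normr0.
move=> z v; rewrite subrr /lin big1 ?subr0; last by move=> a _; rewrite mul0r.
rewrite /quad big1 ?mulr0 ?subr0 ?normr0 ?mulr_ge0 ?exprn_ge0 ?nrm_ge0// => a _.
by rewrite big1// => b _; rewrite !mul0r.
Qed.

Lemma jet_onem K f D H : jet K f D H ->
  jet (1 + K) (fun z => 1 - f z) (fun a z => - D a z) (fun a b z => - H a b z).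
Proof.
have blipN g : blip K g -> blip K (fun z => - g z).
  by move=> [g1 g2]; split=> [z|z v]; rewrite ?normrN// -opprD normrN.
move=> [K0 f0 D0 H0 T]; split; first lra.
- by apply: blipD (blipN _ f0); apply: blip_cst; rewrite normr1.
- by move=> a; apply: (@blip_le K); [lra|exact: blipN].
- by move=> a b; apply: (@blip_le K); [lra|exact: blipN].
move=> z v.
have -> : lin (fun a z => - D a z) z v = - lin D z v.
  by rewrite /lin -sumrN; apply: eq_bigr => a _; rewrite mulNr.
have -> : quad (fun a b z => - H a b z) z v = - quad H z v.
  rewrite /quad -sumrN; apply: eq_bigr => a _; rewrite -sumrN.
  by apply: eq_bigr => b _; rewrite !mulNr.
have -> : 1 - f (z + v) - (1 - f z) - - lin D z v - 2^-1 * - quad H z v =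
  - (f (z + v) - f z - lin D z v - 2^-1 * quad H z v) by ring.
rewrite normrN (le_trans (T z v))// ler_wpM2r// ?exprn_ge0 ?nrm_ge0//; lra.
Qed.

(** The first-order terms cancel by symmetry, and the signs in different
    directions are uncorrelated, so only the diagonal second-order terms remain. *)
Lemma coins_expansion K f D H (vs : seq V) : jet K f D H ->
  exists2 C, 0 <= C & forall s z, 0 <= s ->
  `|avg (coins R [seq s *: v | v <- vs]) f z - f z
     - 2^-1 * s ^+ 2 * \sum_(v <- vs) quad H z v| <= C * s ^+ 3.
Proof.
move=> [K0 f0 D0 H0 T]; elim: vs => [|v vs [C C0 IH]].
  exists 0 => // s z s0; rewrite /coins /= avg_dirac0 big_nil.
  by rewrite subrr mulr0 subr0 normr0 mul0r.
pose B := \sum_(w <- vs) nrm w ^+ 2.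
have B0 : 0 <= B by apply: sumr_ge0 => w _; rewrite exprn_ge0 ?nrm_ge0.
have n0 := nrm_ge0 v.
exists (C + K * nrm v ^+ 3 + K * nrm v * B).
  by rewrite !addr_ge0 ?mulr_ge0 ?exprn_ge0.
move=> s z s0; rewrite /coins /= avg_conv -/(coins _ _) avg_coin big_cons.
set X := avg _ f.
have X1 := IH s (z + s *: v) s0; have X2 := IH s (z - s *: v) s0.
rewrite -!/X in X1 X2.
pose q y := \sum_(w <- vs) quad H y w.
have qq y : nrm y = s * nrm v -> `|q (z + y) - q z| <= K * (s * nrm v) * B.
  move=> ny; rewrite /q -sumrB (le_trans (ler_norm_sum _ _ _))// mulr_sumr.
  by apply: ler_sum => w _; rewrite -ny; exact: quad_lip.
have nsv : nrm (s *: v) = s * nrm v by rewrite nrmZ ger0_norm.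
have q1 := qq (s *: v) nsv.
have q2 : `|q (z - s *: v) - q z| <= K * (s * nrm v) * B by apply: qq; rewrite nrmN.
have t1 := T z (s *: v); have t2 := T z (- (s *: v)).
rewrite nrmN in t2.
have lN : lin D z (- (s *: v)) = - lin D z (s *: v).
  by rewrite /lin -sumrN; apply: eq_bigr => a _; rewrite ffunE mulrN.
have qN : quad H z (- (s *: v)) = quad H z (s *: v).
  rewrite /quad; apply: eq_bigr => a _; apply: eq_bigr => b _.
  by rewrite !(ffunE (fun _ => - _)); ring.
have qZ : quad H z (s *: v) = s ^+ 2 * quad H z v.
  rewrite /quad mulr_sumr; apply: eq_bigr => a _; rewrite mulr_sumr.
  by apply: eq_bigr => b _; rewrite !ffunE; rewrite /GRing.scale/=; ring.
rewrite lN qN qZ nsv in t2; rewrite qZ nsv in t1.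
rewrite -/(q (z + s *: v)) in X1; rewrite -/(q (z - s *: v)) in X2.
rewrite -/(q z).
have s2 : 0 <= s ^+ 2 by rewrite exprn_ge0.
have q1' : `|s ^+ 2 * (q (z + s *: v) - q z)| <= s ^+ 2 * (K * (s * nrm v) * B).
  by rewrite normrM ger0_norm// ler_wpM2l.
have q2' : `|s ^+ 2 * (q (z - s *: v) - q z)| <= s ^+ 2 * (K * (s * nrm v) * B).
  by rewrite normrM ger0_norm// ler_wpM2l.
move: X1 X2 t1 t2 q1' q2'.
have -> : s ^+ 2 * (K * (s * nrm v) * B) = s ^+ 3 * (K * nrm v * B) by ring.
have -> : K * (s * nrm v) ^+ 3 = s ^+ 3 * (K * nrm v ^+ 3) by ring.
have : 0 <= s ^+ 3 * (K * nrm v * B).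
  by rewrite mulr_ge0 ?exprn_ge0// !mulr_ge0.
have -> : (C + K * nrm v ^+ 3 + K * nrm v * B) * s ^+ 3 =
  C * s ^+ 3 + s ^+ 3 * (K * nrm v ^+ 3) + s ^+ 3 * (K * nrm v * B) by ring.
move: (s ^+ 3 * (K * nrm v * B)) (s ^+ 3 * (K * nrm v ^+ 3)) (C * s ^+ 3) => b k c.
move: (X (z + s *: v)) (X (z - s *: v)) (f (z + s *: v)) (f (z - s *: v)) => x1 x2 y1 y2.
move: (q (z + s *: v)) (q (z - s *: v)) (q z) (f z) (lin D z (s *: v)) (quad H z v) => k1 k2 k3 y l Q.
move: (s ^+ 2) => ss.
rewrite !ler_norml => ? /andP[? ?] /andP[? ?] /andP[? ?] /andP[? ?] /andP[? ?] /andP[? ?].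
by apply/andP; split; lra.
Qed.

(** One-sided Lindeberg comparison: if the second-order terms of one round of
    the two walks compare, then so do the walks of [N] rounds, up to
    [N * O(s^3)].  The rounds are exchanged one at a time. *)
Lemma coins_compare K f D H (vs ws : seq V) : jet K f D H ->
  (forall z, \sum_(w <- ws) quad H z w <= \sum_(v <- vs) quad H z v) ->
  exists2 C, 0 <= C & forall s N z, 0 <= s ->
  avg (cpow (coins R [seq s *: w | w <- ws]) N) f z <=
  avg (cpow (coins R [seq s *: v | v <- vs]) N) f z + N%:R * (C * s ^+ 3).
Proof.
move=> J Q.
have [C1 C10 E1] := coins_expansion vs J; have [C2 C20 E2] := coins_expansion ws J.
exists (C1 + C2) => [|s N z s0]; first exact: addr_ge0.
set B := coins R [seq s *: w | w <- ws]; set A' := coins R [seq s *: v | v <- vs].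
have s3 : 0 <= s ^+ 3 by rewrite exprn_ge0.
have E y : avg B f y <= avg A' f y + (C1 + C2) * s ^+ 3.
  have := E1 s y s0; have := E2 s y s0; rewrite -/A' -/B !ler_norml.
  have : 2^-1 * s ^+ 2 * \sum_(w <- ws) quad H y w <= 2^-1 * s ^+ 2 * \sum_(v <- vs) quad H y v.
    by rewrite ler_wpM2l// mulr_ge0 ?invr_ge0 ?exprn_ge0.
  by move=> ? /andP[? ?] /andP[? ?]; lra.
have sA : subprob A' by exact: subprob_coins.
have sB : subprob B by exact: subprob_coins.
have C0 : 0 <= (C1 + C2) * s ^+ 3 by rewrite mulr_ge0// addr_ge0.
have mass mu g c y : subprob mu -> 0 <= c -> avg mu (fun x => g x + c) y <= avg mu g y + c.
  move=> [m0 m1] c0; rewrite avgD lerD2l /avg -mulr_suml.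
  exact: ler_piMl.
elim: N z => [|N IH] z; first by rewrite /= avg_dirac0 mul0r addr0.
rewrite !avg_cpowS (avgC B).
apply: (@le_trans _ _ (avg (cpow B N) (fun y => avg A' f y + (C1 + C2) * s ^+ 3) z)).
  by apply: avg_le => //; exact: subprob_cpow.
apply: le_trans (mass _ _ _ _ (subprob_cpow N sB) C0) _.
rewrite (avgC (cpow B N)).
have -> : N.+1%:R * ((C1 + C2) * s ^+ 3) =
  N%:R * ((C1 + C2) * s ^+ 3) + (C1 + C2) * s ^+ 3 by rewrite -[N.+1]addn1 natrD; ring.
rewrite addrA.
rewrite lerD2r.
apply: (@le_trans _ _ (avg A' (fun y => avg (cpow A' N) f y + N%:R * ((C1 + C2) * s ^+ 3)) z)).
  exact: avg_le.
by apply: mass => //; rewrite mulr_ge0.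
Qed.

End Jets.

(** * Gordon's comparison inequality *)

Section GordonComparison.
Variables (R : realType) (U W : finType).
Local Notation A := (U * W)%type.
Local Notation V := {ffun A -> R}.

Definition ramp (lam kap r : R) : R := 1 - step0 (kap * (r - lam)).

(** A smooth version of the indicator of [forall u, exists w, lam < z (u, w)]. *)
Definition saddle (lam kap : R) (z : V) : R :=
  \prod_(u : U) (1 - \prod_(w : W) ramp lam kap (z (u, w))).

Lemma ramp_bounds (lam kap r : R) : 0 <= ramp lam kap r <= 1.
Proof. by rewrite /ramp; have [] := step_bounds (kap * (r - lam)); lra. Qed.

Lemma saddle_bounds (lam kap : R) (z : V) : 0 <= saddle lam kap z <= 1.
Proof.
have B u : 0 <= 1 - \prod_(w : W) ramp lam kap (z (u, w)) <= 1.
  have p0 : 0 <= \prod_(w : W) ramp lam kap (z (u, w)).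
    by apply: prodr_ge0 => w _; case/andP: (ramp_bounds lam kap (z (u, w))).
  have p1 : \prod_(w : W) ramp lam kap (z (u, w)) <= 1.
    by apply: prodr_ile1 => w _; exact: ramp_bounds.
  by lra.
apply/andP; split; first by apply: prodr_ge0 => u _; case/andP: (B u).
by apply: prodr_ile1 => u _; exact: B.
Qed.

Lemma saddle_eq0 (lam kap : R) (z : V) : 0 <= kap ->
  (exists u, forall w, z (u, w) <= lam) -> saddle lam kap z = 0.
Proof.
move=> k0 [u zu]; rewrite /saddle (bigD1 u)//= big1 ?subrr ?mul0r// => w _.
by rewrite /ramp step0_le0 ?subr0// mulr_ge0_le0// subr_le0.
Qed.

Lemma saddle_eq1 (lam kap : R) (z : V) :
  (forall u, exists w, 3 <= kap * (z (u, w) - lam)) -> saddle lam kap z = 1.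
Proof.
move=> zu; rewrite /saddle big1// => u _; have [w zw] := zu u.
by rewrite (bigD1 w)//= /ramp step0_ge3// subrr mul0r subr0.
Qed.

Lemma jet_coord (K : R) (f0 f1 f2 : R -> R) (a0 : A) : 0 <= K ->
  (forall r, `|f0 r| <= K) -> (forall r, `|f1 r| <= K) -> (forall r, `|f2 r| <= K) ->
  (forall r h, `|f0 (r + h) - f0 r| <= K * `|h|) ->
  (forall r h, `|f1 (r + h) - f1 r| <= K * `|h|) ->
  (forall r h, `|f2 (r + h) - f2 r| <= K * `|h|) ->
  (forall r h, `|f0 (r + h) - f0 r - f1 r * h - 2^-1 * (f2 r * h * h)| <= K * `|h| ^+ 3) ->
  jet K (fun z : V => f0 (z a0)) (fun a z => if a == a0 then f1 (z a0) else 0)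
    (fun a b z => if (a == a0) && (b == a0) then f2 (z a0) else 0).
Proof.
move=> K0 B0 B1 B2 L0 L1 L2 T.
have bl f : (forall r, `|f r| <= K) -> (forall r h, `|f (r + h) - f r| <= K * `|h|) ->
    blip K (fun z : V => f (z a0)).
  move=> B L; split=> // z v; rewrite ffunE (le_trans (L _ _))//.
  by rewrite ler_wpM2l// nrm_coord.
split=> //; first exact: bl.
- move=> a; case: (a == a0); first exact: bl.
  by apply: blip_cst; rewrite normr0.
- move=> a b; case: ((a == a0) && (b == a0)); first exact: bl.
  by apply: blip_cst; rewrite normr0.
move=> z v.
have -> : lin (fun a z => if a == a0 then f1 (z a0) else 0) z v = f1 (z a0) * v a0.
  rewrite /lin (bigD1 a0)//= eqxx big1 ?addr0// => a /negPf ->; exact: mul0r.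
have -> : quad (fun a b z => if (a == a0) && (b == a0) then f2 (z a0) else 0) z v =
    f2 (z a0) * v a0 * v a0.
  rewrite /quad (bigD1 a0)//= [X in _ + X]big1 ?addr0; last first.
    by move=> a /negPf ->; rewrite big1// => b _; rewrite !mul0r.
  rewrite (bigD1 a0)//= eqxx /= big1 ?addr0// => b /negPf ->.
  by rewrite !mul0r.
rewrite ffunE (le_trans (T _ _))// ler_wpM2l// lerXn2r ?nnegrE ?nrm_ge0//.
exact: nrm_coord.
Qed.

Lemma ramp_jet (lam kap : R) (a0 : A) : 0 <= kap ->
  exists K : R, jet K (fun z : V => ramp lam kap (z a0))
    (fun a z => if a == a0 then - kap * step1 (kap * (z a0 - lam)) else 0)
    (fun a b z => if (a == a0) && (b == a0)
       then - kap ^+ 2 * step2 (kap * (z a0 - lam)) else 0).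
Proof.
move=> k0; exists (1 + 8 * kap + 8 * kap ^+ 2 + 8 * kap ^+ 3).
have k2 : 0 <= kap ^+ 2 by rewrite exprn_ge0.
have k3 : 0 <= kap ^+ 3 by rewrite exprn_ge0.
have E r h : kap * (r + h - lam) = kap * (r - lam) + kap * h by ring.
apply: (@jet_coord _ (ramp lam kap) (fun r => - kap * step1 (kap * (r - lam)))
   (fun r => - kap ^+ 2 * step2 (kap * (r - lam)))); first lra.
- by move=> r; have := ramp_bounds lam kap r; rewrite ler_norml => /andP[? ?]; lra.
- move=> r; have [_ /andP[s0 s1] _] := step_bounds (kap * (r - lam)).
  rewrite mulNr normrN (ger0_norm (mulr_ge0 k0 s0)).
  by have := ler_wpM2l k0 s1; rewrite mulr1; lra.
- move=> r; have [_ _ s] := step_bounds (kap * (r - lam)).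
  rewrite mulNr normrN normrM (ger0_norm k2).
  by have := ler_wpM2l k2 s; rewrite mulr1; lra.
- move=> r h; rewrite /ramp E.
  have := step0_lip (kap * (r - lam)) (kap * h); rewrite normrM (ger0_norm k0) => H.
  set s1 := step0 (_ + _) in H *; set s0 := step0 _ in H *.
  have -> : 1 - s1 - (1 - s0) = - (s1 - s0) by ring.
  rewrite normrN (le_trans H)// mulrA ler_wpM2r//; lra.
- move=> r h; rewrite E -mulrBr mulNr normrN normrM (ger0_norm k0).
  have := step1_lip (kap * (r - lam)) (kap * h); rewrite normrM (ger0_norm k0) => H.
  apply: (le_trans (ler_wpM2l k0 H)).
  have -> : kap * (5 * (kap * `|h|)) = 5 * kap ^+ 2 * `|h| by ring.
  by rewrite ler_wpM2r//; lra.
- move=> r h; rewrite E -mulrBr mulNr normrN normrM (ger0_norm k2).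
  have := step2_lip (kap * (r - lam)) (kap * h); rewrite normrM (ger0_norm k0) => H.
  apply: (le_trans (ler_wpM2l k2 H)).
  have -> : kap ^+ 2 * (8 * (kap * `|h|)) = 8 * kap ^+ 3 * `|h| by ring.
  by rewrite ler_wpM2r//; lra.
- move=> r h; rewrite /ramp E.
  have := step0_taylor (kap * (r - lam)) (kap * h).
  rewrite normrM (ger0_norm k0) exprMn => H.
  set s1 := step0 (_ + _) in H *; set s0 := step0 _ in H *.
  have -> : 1 - s1 - (1 - s0) - - kap * step1 (kap * (r - lam)) * h
      - 2^-1 * (- kap ^+ 2 * step2 (kap * (r - lam)) * h * h) =
    - (s1 - s0 - step1 (kap * (r - lam)) * (kap * h)
      - 2^-1 * (step2 (kap * (r - lam)) * (kap * h) * (kap * h))) by ring.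
  rewrite normrN (le_trans H)// mulrA ler_wpM2r ?exprn_ge0//; lra.
Qed.

(** The inner product over [w] for a fixed [u] only sees the coordinates of the
    block [u] and decreases in each of them. *)
Definition block_jet (u : U) (f : V -> R) := exists K D H,
  [/\ jet K f D H, (forall z, 0 <= f z <= 1), (forall a z, D a z <= 0),
    (forall a z, a.1 != u -> D a z = 0) &
    (forall a b z, (a.1 != u) || (b.1 != u) -> H a b z = 0)].

Lemma block_jetM u f g : block_jet u f -> block_jet u g -> block_jet u (fun z => f z * g z).
Proof.
move=> [K1 [D [H [J1 f01 D0 DS HS]]]] [K2 [E [I [J2 g01 E0 ES IS]]]].
pose K := Num.max K1 K2.
have J1' : jet K f D H by apply: jet_le J1; rewrite le_max lexx.
have J2' : jet K g E I by apply: jet_le J2; rewrite le_max lexx orbT.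
exists (8 * K ^+ 2), (gradM f D g E), (hessM f D H g E I); split.
- exact: jetM.
- move=> z; case/andP: (f01 z) => ? ?; case/andP: (g01 z) => ? ?.
  by rewrite mulr_ge0//= mulr_ile1.
- move=> a z; case/andP: (f01 z) => ? ?; case/andP: (g01 z) => ? ?.
  by rewrite /gradM -[leRHS]addr0 lerD// mulr_ge0_le0.
- by move=> a z au; rewrite /gradM DS// ES// !mulr0 addr0.
- move=> a b z au; rewrite /hessM HS// IS// !mulr0 !addr0.
  by case/orP: au => u0; rewrite (DS _ _ u0) (ES _ _ u0); ring.
Qed.

Lemma block_jet_prod (lam kap : R) u : 0 <= kap ->
  block_jet u (fun z => \prod_(w : W) ramp lam kap (z (u, w))).
Proof.
move=> k0; elim: (index_enum W) => [|w r IH].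
  have -> : (fun z : V => \prod_(w <- [::]) ramp lam kap (z (u, w))) = (fun=> 1).
    by apply/funext => z; rewrite big_nil.
  exists `|1|, (fun _ _ => 0), (fun _ _ _ => 0); split=> //; first exact: jet_cst.
  by move=> z; rewrite ler01 lexx.
have -> : (fun z : V => \prod_(w <- w :: r) ramp lam kap (z (u, w))) =
    (fun z => ramp lam kap (z (u, w)) * \prod_(w <- r) ramp lam kap (z (u, w))).
  by apply/funext => z; rewrite big_cons.
apply: block_jetM IH; have [K J] := ramp_jet lam (u, w) k0.
do 3 eexists; split; first exact: J.
- by move=> z; exact: ramp_bounds.
- move=> a z /=; case: ifP => // _; rewrite mulNr oppr_le0 mulr_ge0//.
  by have [_ /andP[]] := step_bounds (kap * (z (u, w) - lam)).
- by move=> a z au /=; case: ifP => // /eqP e; rewrite e eqxx in au.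
- by move=> a b z au /=; case: ifP => // /andP[/eqP e1 /eqP e2]; rewrite e1 e2 eqxx in au.
Qed.

Variable c : A -> A -> R.
Hypothesis c_ge0 : forall a b, 0 <= c a b.
Hypothesis c_block : forall a b, a.1 = b.1 -> c a b = 0.

(** With [c] the difference of two covariances, this is twice the difference of
    the second-order terms of the two walks. *)
Definition trace_form (H : A -> A -> V -> R) z := \sum_a \sum_b c a b * H a b z.

(** Stable under products: the mixed terms in the Hessian of a product are
    products of first derivatives, which are nonnegative. *)
Definition good_jet (f : V -> R) := exists K D H,
  [/\ jet K f D H, (forall z, 0 <= f z <= 1), (forall a z, 0 <= D a z) &
    (forall z, 0 <= trace_form H z)].

Lemma good_jetM f g : good_jet f -> good_jet g -> good_jet (fun z => f z * g z).
Proof.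
move=> [K1 [D [H [J1 f01 D0 H0]]]] [K2 [E [I [J2 g01 E0 I0]]]].
pose K := Num.max K1 K2.
have J1' : jet K f D H by apply: jet_le J1; rewrite le_max lexx.
have J2' : jet K g E I by apply: jet_le J2; rewrite le_max lexx orbT.
exists (8 * K ^+ 2), (gradM f D g E), (hessM f D H g E I); split.
- exact: jetM.
- move=> z; case/andP: (f01 z) => ? ?; case/andP: (g01 z) => ? ?.
  by rewrite mulr_ge0//= mulr_ile1.
- move=> a z; case/andP: (f01 z) => ? ?; case/andP: (g01 z) => ? ?.
  by rewrite /gradM addr_ge0// mulr_ge0.
move=> z; case/andP: (f01 z) => ? _; case/andP: (g01 z) => ? _.
have -> : trace_form (hessM f D H g E I) z =
  f z * trace_form I z + g z * trace_form H z +
  \sum_a \sum_b c a b * (D a z * E b z + D b z * E a z).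
  rewrite /trace_form !mulr_sumr -!big_split; apply: eq_bigr => a _ /=.
  rewrite !mulr_sumr -!big_split; apply: eq_bigr => b _ /=.
  by rewrite /hessM; ring.
apply: addr_ge0; first by apply: addr_ge0; apply: mulr_ge0.
apply: sumr_ge0 => a _; apply: sumr_ge0 => b _.
by rewrite mulr_ge0 ?addr_ge0 ?mulr_ge0.
Qed.

(** The Hessian is supported in one block, where [c] vanishes. *)
Lemma good_jet_block u f : block_jet u f -> good_jet (fun z => 1 - f z).
Proof.
move=> [K [D [H [J f01 D0 DS HS]]]]; do 3 eexists; split; first exact: jet_onem J.
- by move=> z; have := f01 z; lra.
- by move=> a z; rewrite oppr_ge0.
move=> z; rewrite /trace_form big1// => a _; rewrite big1// => b _.
have [e|ne] := eqVneq a.1 b.1; first by rewrite c_block// mul0r.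
rewrite HS ?oppr0 ?mulr0//.
by have [e|//] := eqVneq a.1 u; rewrite -e eq_sym ne orbT.
Qed.

Lemma good_jet_saddle (lam kap : R) : 0 <= kap -> good_jet (saddle lam kap).
Proof.
move=> k0; rewrite /saddle; elim: (index_enum U) => [|u r IH].
  have -> : (fun z : V => \prod_(u <- [::]) (1 - \prod_w ramp lam kap (z (u, w)))) = (fun=> 1).
    by apply/funext => z; rewrite big_nil.
  exists `|1|, (fun _ _ => 0), (fun _ _ _ => 0); split=> //; first exact: jet_cst.
    by move=> z; rewrite ler01 lexx.
  by move=> z; rewrite /trace_form big1// => a _; rewrite big1// => b _; rewrite mulr0.
have -> : (fun z : V => \prod_(u <- u :: r) (1 - \prod_w ramp lam kap (z (u, w)))) =
  (fun z => (1 - \prod_w ramp lam kap (z (u, w))) *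
     \prod_(u <- r) (1 - \prod_w ramp lam kap (z (u, w)))).
  by apply/funext => z; rewrite big_cons.
by apply: good_jetM => //; apply: good_jet_block; exact: block_jet_prod.
Qed.

End GordonComparison.

(** Gordon's inequality for sign walks.  The covariances of the two families
    agree inside a block [{u} * W], and those of [vs] dominate across blocks;
    there the mixed second derivatives of [saddle] are nonnegative. *)
Lemma gordon_walk (R : realType) (U W : finType) (vs ws : seq {ffun U * W -> R})
  (lam kap : R) : 0 <= kap ->
  (forall a b, \sum_(w <- ws) w a * w b <= \sum_(v <- vs) v a * v b) ->
  (forall a b, a.1 = b.1 -> \sum_(w <- ws) w a * w b = \sum_(v <- vs) v a * v b) ->
  (exists K D H, jet K (saddle (U := U) (W := W) lam kap) D H) /\
  exists2 C, 0 <= C & forall s N z, 0 <= s ->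
    avg (cpow (coins R [seq s *: w | w <- ws]) N) (saddle lam kap) z <=
    avg (cpow (coins R [seq s *: v | v <- vs]) N) (saddle lam kap) z
      + N%:R * (C * s ^+ 3).
Proof.
move=> k0 cle ceq.
pose c a b := \sum_(v <- vs) v a * v b - \sum_(w <- ws) w a * w b.
have c0 a b : 0 <= c a b by rewrite subr_ge0.
have cb a b : a.1 = b.1 -> c a b = 0 by move=> e; rewrite /c ceq// subrr.
have [K [D [H [J _ _ Q]]]] := good_jet_saddle c0 cb lam k0.
split; first by exists K, D, H.
apply: (coins_compare J) => z; rewrite -subr_ge0.
have E (r : seq {ffun U * W -> R}) :
  \sum_(v <- r) quad H z v = \sum_a \sum_b (\sum_(v <- r) v a * v b) * H a b z.
  rewrite /quad exchange_big; apply: eq_bigr => a _; rewrite exchange_big.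
  apply: eq_bigr => b _; rewrite mulr_suml; apply: eq_bigr => v _; ring.
rewrite !E -sumrB; apply: le_trans (Q z) _; rewrite le_eqVlt; apply/orP; left.
apply/eqP; apply: eq_bigr => a _; rewrite -sumrB; apply: eq_bigr => b _.
by rewrite -mulrBl.
Qed.

(** * Gaussian integrals *)

Section StandardGaussian.
Variable R : realType.
Local Notation mu := (@lebesgue_measure R).
Implicit Types (phi psi : R -> R) (x y s a b : R).

Definition gauss : R -> R := normal_pdf 0 1.

Lemma gauss_ge0 x : 0 <= gauss x. Proof. exact: normal_pdf_ge0. Qed.

Lemma measurable_gauss : measurable_fun setT gauss.
Proof. exact: measurable_normal_pdf. Qed.

Lemma continuous_gauss : continuous gauss.
Proof. by apply: continuous_normal_pdf; rewrite oner_neq0. Qed.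

Lemma integral_gauss : (\int[mu]_x (gauss x)%:E = 1)%E.
Proof. exact: integral_normal_pdf. Qed.

Lemma npdfE (m s x : R) : s != 0 ->
  normal_pdf m s x = (Num.sqrt (s ^+ 2 * pi *+ 2))^-1 * expR (- (x - m) ^+ 2 / (s ^+ 2 *+ 2)).
Proof. by move=> s0; rewrite normal_pdfE. Qed.

Lemma gaussE x : gauss x = (Num.sqrt (pi *+ 2))^-1 * expR (- (x ^+ 2 / 2)).
Proof. by rewrite /gauss npdfE ?oner_neq0// expr1n mul1r subr0 mulNr. Qed.

Lemma gauss_even x : gauss (- x) = gauss x.
Proof. by rewrite !gaussE sqrrN. Qed.

Lemma ge0_integral_affine (H : R -> R) a b : 0 < a -> continuous H ->
  (forall x, 0 <= H x) ->
  (\int[mu]_x (H x)%:E = \int[mu]_x (a * H (a * x + b))%:E)%E.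
Proof.
move=> a0 cH H0; pose F (x : R^o) : R^o := a * x + b.
have F'E : F^`()%classic = cst a.
  apply/funext => x; rewrite /F derive1E deriveD// deriveM// derive_cst derive_id.
  by rewrite derive_cst addr0 scaler0 addr0 /GRing.scale /= mulr1.
rewrite (@increasing_ge0_integration_by_substitutionT R F H)//.
- by apply: eq_integral => x _; rewrite F'E /= mulrC.
- by move=> x y xy; rewrite /F ltrD2r ltr_pM2l.
- by rewrite F'E => ?; exact: cvg_cst.
- by rewrite F'E; exact: is_cvg_cst.
- by rewrite F'E; exact: is_cvg_cst.
- apply: (cvg_comp (fun x => a * x) (fun x => x + b)); last exact: cvg_addrr_Ny.
  exact: gt0_cvgMrNy.
- apply: (cvg_comp (fun x => a * x) (fun x => x + b)); last exact: cvg_addrr.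
  exact: gt0_cvgMry.
Qed.

Lemma ge0_integral_opp (H : R -> R) : measurable_fun setT H ->
  (forall x, 0 <= H x) -> (\int[mu]_x (H (- x))%:E = \int[mu]_x (H x)%:E)%E.
Proof.
move=> mH H0.
transitivity (\int[mu]_(x in (-%R : R -> measurableTypeR R) @^-1` setT) ((EFin \o H) \o -%R) x)%E.
  by rewrite preimage_setT.
rewrite -ge0_integral_pushforward//=.
- by apply: eq_measure_integral => A mA _; exact: lebesgue_measureN.
- exact/measurable_EFinP.
- by move=> x _; rewrite lee_fin.
Qed.

(** The sum of two independent standard Gaussians: the convolution of the
    densities is evaluated by completing the square, which turns the inner
    integral into that of a normal density of standard deviation 1/sqrt 2. *)
Lemma gauss_convolution psi : continuous psi -> (forall x, 0 <= psi x) ->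
  (\int[mu]_y \int[mu]_z (psi (y + z) * gauss z * gauss y)%:E =
   \int[mu]_u (psi (Num.sqrt 2 * u) * gauss u)%:E)%E.
Proof.
move=> cpsi psi0.
have r20 : 0 < Num.sqrt 2 :> R by rewrite sqrtr_gt0.
have r2n : Num.sqrt 2 != 0 :> R by rewrite gt_eqF.
have r22 : Num.sqrt 2 ^+ 2 = 2 :> R by rewrite sqr_sqrtr.
transitivity (\int[mu]_y \int[mu]_u (psi u * gauss (u - y) * gauss y)%:E)%E.
  apply: eq_integral => y _.
  rewrite (@ge0_integral_affine (fun z => psi (y + z) * gauss z * gauss y) 1 (- y))//.
  - by apply: eq_integral => u _; rewrite !mul1r subrKC.
  - move=> z; apply: cvgM; last exact: cvg_cst.
    apply: cvgM; last exact: continuous_gauss.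
    apply: (cvg_comp (fun z => y + z) psi); last exact: cpsi.
    by apply: (@cvgD _ R^o); [exact: cvg_cst|exact: cvg_id].
  - by move=> z; rewrite !mulr_ge0// gauss_ge0.
have mpsi : measurable_fun setT psi by exact: continuous_measurable_fun.
rewrite (@fubini_tonelli _ _ _ _ R mu mu (fun p : measurableTypeR R * measurableTypeR R =>
   (psi p.2 * gauss (p.2 - p.1) * gauss p.1)%:E))/=; last 2 first.
- apply/measurable_EFinP; apply: measurable_funM.
    apply: measurable_funM; first exact: measurableT_comp.
    apply: measurableT_comp; first exact: measurable_gauss.
    exact: measurable_funB.
  by apply: measurableT_comp; first exact: measurable_gauss.
- by move=> p; rewrite lee_fin !mulr_ge0// gauss_ge0.
transitivity (\int[mu]_u (psi u * normal_pdf 0 (Num.sqrt 2) u)%:E)%E.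
  apply: eq_integral => u _.
  pose q := (Num.sqrt 2)^-1 : R.
  have q0 : q != 0 by rewrite invr_eq0.
  have E y : psi u * gauss (u - y) * gauss y =
     (psi u * normal_pdf 0 (Num.sqrt 2) u) * normal_pdf (u / 2) q y.
    rewrite -!mulrA; congr (_ * _); rewrite !gaussE !npdfE// /q.
    rewrite subr0 exprVn r22.
    rewrite mulrACA [RHS]mulrACA -!expRD; congr (_ * expR _); last by field.
    rewrite -!invfM; congr (_^-1).
    have p0 : 0 <= pi *+ 2 :> R by rewrite mulrn_wge0 ?pi_ge0.
    rewrite -[LHS]expr2 sqr_sqrtr// -sqrtrM ?mulrn_wge0 ?mulr_ge0 ?pi_ge0//.
    rewrite -[LHS](ger0_norm p0) -sqrtr_sqr; congr Num.sqrt; by field.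
  transitivity (\int[mu]_y ((psi u * normal_pdf 0 (Num.sqrt 2) u)%:E *
      (normal_pdf (u / 2) q y)%:E))%E.
    by apply: eq_integral => y _; rewrite /= E EFinM.
  rewrite ge0_integralZl//; first by rewrite integral_normal_pdf mule1.
  - by apply/measurable_EFinP; exact: measurable_normal_pdf.
  - by move=> y _; rewrite lee_fin normal_pdf_ge0.
  - by rewrite lee_fin mulr_ge0// normal_pdf_ge0.
rewrite (@ge0_integral_affine _ (Num.sqrt 2) 0)//.
- apply: eq_integral => u _; rewrite addr0 mulrCA; congr (_ * _)%:E.
  rewrite gaussE npdfE// subr0 exprMn r22 mulrA.
  congr (_ * expR _); last by field.
  have -> : 2 * pi *+ 2 = 2 * (pi *+ 2) :> R by ring.
  by rewrite sqrtrM// invfM mulrA divff ?mul1r.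
- move=> u; apply: cvgM; first exact: cpsi.
  exact: continuous_normal_pdf.
- by move=> u; rewrite mulr_ge0// normal_pdf_ge0.
Qed.

Definition gexp phi : R := \int[mu]_y (phi y * gauss y).

Definition gint phi := mu.-integrable setT (fun y => (phi y * gauss y)%:E).

Lemma gexp_cst c : gexp (fun=> c) = c.
Proof.
rewrite /gexp /Rintegral; under eq_integral do rewrite EFinM.
rewrite integralZl//; last exact: integrable_normal_pdf.
by rewrite integral_gauss mule1.
Qed.

Lemma gint_cst c : gint (fun=> c).
Proof.
rewrite /gint; under [X in _.-integrable _ X]funext do rewrite EFinM.
by apply: integrableZl => //; exact: integrable_normal_pdf.
Qed.

Lemma gintD phi psi : gint phi -> gint psi -> gint (fun y => phi y + psi y).
Proof.
move=> h1 h2; rewrite /gint; under [X in _.-integrable _ X]funext do rewrite mulrDl EFinD.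
exact: integrableD.
Qed.

Lemma gintZ c phi : gint phi -> gint (fun y => c * phi y).
Proof.
move=> h; rewrite /gint; under [X in _.-integrable _ X]funext do rewrite -mulrA EFinM.
exact: integrableZl.
Qed.

Lemma gexpD phi psi : gint phi -> gint psi ->
  gexp (fun y => phi y + psi y) = gexp phi + gexp psi.
Proof.
move=> h1 h2; rewrite /gexp -RintegralD//.
by apply: eq_Rintegral => y _; rewrite mulrDl.
Qed.

Lemma gexpZ c phi : gint phi -> gexp (fun y => c * phi y) = c * gexp phi.
Proof.
move=> h; rewrite /gexp -RintegralZl//.
by apply: eq_Rintegral => y _; rewrite mulrA.
Qed.

Lemma gexp_le phi psi : gint phi -> gint psi -> (forall y, phi y <= psi y) ->
  gexp phi <= gexp psi.
Proof.
move=> h1 h2 le; rewrite /gexp; apply: le_Rintegral => // y _.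
by rewrite ler_wpM2r// gauss_ge0.
Qed.

Lemma gint_le phi psi : measurable_fun setT phi -> gint psi ->
  (forall y, `|phi y| <= psi y) -> gint phi.
Proof.
move=> mphi h2 le; apply: (le_integrable _ _ _ h2) => //.
  by apply/measurable_EFinP; apply: measurable_funM => //; exact: measurable_gauss.
move=> y _; rewrite /= lee_fin !normrM ler_wpM2r//.
by rewrite (le_trans (le y))// ler_norm.
Qed.

Lemma gint_bounded phi K : measurable_fun setT phi -> (forall y, `|phi y| <= K) -> gint phi.
Proof. by move=> m b; apply: (gint_le m (gint_cst K)). Qed.

Lemma EFin_gexp phi : gint phi -> (gexp phi)%:E = (\int[mu]_y (phi y * gauss y)%:E)%E.
Proof. by move=> h; rewrite /gexp /Rintegral fineK//; exact: integrable_fin_num. Qed.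

Lemma gexp_opp phi K : measurable_fun setT phi -> (forall y, `|phi y| <= K) ->
  gexp (fun y => phi (- y)) = gexp phi.
Proof.
move=> m b.
have m' : measurable_fun setT (fun y => phi (- y)) by exact: measurableT_comp.
have i1 : gint phi := gint_bounded m b.
have i2 : gint (fun y => phi (- y)) by apply: (@gint_bounded _ K).
apply: (addIr K); rewrite -{1 2}(gexp_cst K) -!gexpD//; try exact: gint_cst.
rewrite /gexp /Rintegral; congr fine.
rewrite -(@ge0_integral_opp (fun y => (phi y + K) * gauss y)).
- by apply: eq_integral => y _; rewrite gauss_even.
- by apply: measurable_funM; [exact: measurable_funD|exact: measurable_gauss].
- move=> y; rewrite mulr_ge0 ?gauss_ge0//; have := b y; rewrite ler_norml; lra.
Qed.

Lemma gexp_expsqr k : 0 < k ->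
  (\int[mu]_y (expR ((1 - k ^+ 2) / 2 * y ^+ 2) * gauss y)%:E = k^-1%:E)%E.
Proof.
move=> k0; have kn : k != 0 by rewrite gt_eqF.
have E y : expR ((1 - k ^+ 2) / 2 * y ^+ 2) * gauss y = k^-1 * normal_pdf 0 k^-1 y.
  rewrite gaussE npdfE ?invr_eq0// subr0 exprVn mulrCA -expRD [RHS]mulrA.
  congr (_ * expR _); last by field.
  rewrite -mulrnAr sqrtrM ?invr_ge0 ?exprn_ge0 ?ltW// -exprVn sqrtr_sqr.
  rewrite ger0_norm ?invr_ge0 ?ltW// invfM invrK mulrA mulVf// mul1r//.
under eq_integral do rewrite E EFinM.
rewrite ge0_integralZl//; first by rewrite integral_normal_pdf mule1.
- by apply/measurable_EFinP; exact: measurable_normal_pdf.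
- by move=> y _; rewrite lee_fin normal_pdf_ge0.
- by rewrite lee_fin invr_ge0 ltW.
Qed.

Lemma gint_expsqr k : 0 < k -> gint (fun y => expR ((1 - k ^+ 2) / 2 * y ^+ 2)).
Proof.
move=> k0; apply/integrableP; split.
  apply/measurable_EFinP; apply: measurable_funM; last exact: measurable_gauss.
  by apply: measurableT_comp => //; apply: measurable_funM.
under eq_integral do rewrite /= ger0_norm ?mulr_ge0 ?expR_ge0 ?gauss_ge0//.
by rewrite gexp_expsqr// ltry.
Qed.

Lemma gint_sqr : gint (fun y => y ^+ 2).
Proof.
apply: (@gint_le _ (fun y => 4 * expR ((1 - (Num.sqrt 2^-1) ^+ 2) / 2 * y ^+ 2))) => //.
  by apply: gintZ; apply: gint_expsqr; rewrite sqrtr_gt0 invr_gt0.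
move=> y; rewrite ger0_norm ?sqr_ge0// sqr_sqrtr ?invr_ge0//.
have := @expR_ge1Dx R ((1 - 2^-1) / 2 * y ^+ 2); lra.
Qed.

Lemma gint_cube : gint (fun y => `|y| ^+ 3).
Proof.
pose e y := expR ((1 - (Num.sqrt 2^-1) ^+ 2) / 2 * y ^+ 2) : R.
apply: (@gint_le _ (fun y => 1 + 64 * e y)) => //.
- exact: (@measurableT_comp _ _ _ _ _ _ (fun r : R => r ^+ 3) _ (fun y : R => `|y|)).
- by apply: (gintD (gint_cst 1) (gintZ _ (gint_expsqr _))); rewrite sqrtr_gt0 invr_gt0.
move=> y; rewrite /e sqr_sqrtr ?invr_ge0//.
have -> : (1 - 2^-1) / 2 * y ^+ 2 = y ^+ 2 / 8 + y ^+ 2 / 8 by field.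
rewrite expRD -expr2 ger0_norm ?exprn_ge0//.
have e1 := @expR_ge1Dx R (y ^+ 2 / 8).
have y0 : 0 <= `|y| by []. have -> : y ^+ 2 = `|y| ^+ 2 by rewrite real_normK ?num_real.
rewrite -[y ^+ 2]real_normK ?num_real// in e1.
move: (`|y|) y0 e1 => r r0 e1.
have e2 : (r ^+ 2 / 8) ^+ 2 <= expR (r ^+ 2 / 8) ^+ 2.
  by rewrite lerXn2r ?nnegrE ?expR_ge0 ?mulr_ge0 ?exprn_ge0//; lra.
have : r ^+ 3 <= 1 + r ^+ 4.
  have [r1|r1] := leP r 1.
    by have := exprn_ile1 3 r0 r1; have := exprn_ge0 4 r0; lra.
  have : r ^+ 3 <= r ^+ 4 by rewrite ler_eXn2l.
  by lra.
have e3 : (r ^+ 2 / 8) ^+ 2 = r ^+ 4 / 64 by field.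
rewrite e3 in e2.
by lra.
Qed.

(** Comparing [y^2] with exponentials avoids integrating by parts: the convexity
    of exp sandwiches the second moment between the values [2 / (k (k + 1))] at
    [k > 1] and at [k < 1]. *)
Lemma gexp_sqr : gexp (fun y => y ^+ 2) = 1.
Proof.
set I := gexp _.
have B k : 0 < k -> (1 - k ^+ 2) / 2 * I <= k^-1 - 1.
  move=> k0; rewrite -(gexpZ _ gint_sqr).
  have <- : gexp (fun y => expR ((1 - k ^+ 2) / 2 * y ^+ 2)) = k^-1.
    by apply/EFin_inj; rewrite EFin_gexp ?gexp_expsqr//; exact: gint_expsqr.
  rewrite lerBrDr -[X in _ + X <= _](gexp_cst 1) -gexpD; [|exact/gintZ/gint_sqr|exact: gint_cst].
  apply: gexp_le; [|exact: gint_expsqr|by move=> y; rewrite addrC expR_ge1Dx].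
  by apply: (gintD (gintZ _ gint_sqr) (gint_cst 1)).
apply/eqP; rewrite eq_le; apply/andP; split; rewrite leNgt; apply/negP => HI.
- pose t := (1 - I^-1) / 3; have I0 : 0 < I by lra.
  have Ii : I^-1 < 1 by rewrite invf_lt1.
  have Ii0 : 0 < I^-1 by rewrite invr_gt0.
  have II : I * I^-1 = 1 by rewrite divff// gt_eqF.
  have k0 : 0 < 1 - t by rewrite /t; lra.
  have t0 : 0 < t by rewrite /t; lra.
  have := B _ k0; rewrite -(ler_pM2l k0) mulrBr mulr1 divff ?gt_eqF// => H.
  have : t * ((1 - t) * (2 - t) * I - 2) <= 0 by lra.
  rewrite pmulr_rle0// => H3.
  have tI : t * I = (I - 1) / 3 by rewrite /t; lra.
  have : 0 <= t * (t * I) by rewrite tI mulr_ge0//; lra.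
  have -> : t * (t * I) = (1 - t) * (2 - t) * I - 2 * I + 3 * (t * I) by ring.
  by rewrite tI; lra.
- have I0 : 0 <= I.
    by rewrite -(gexp_cst 0); apply: gexp_le;
      [exact: gint_cst|exact: gint_sqr|move=> y; exact: sqr_ge0].
  pose t := (1 - I) / 4; have t0 : 0 < t by rewrite /t; lra.
  have k0 : 0 < 1 + t by lra.
  have := B _ k0; rewrite -(ler_pM2l k0) mulrBr mulr1 divff ?gt_eqF// => H.
  have : 0 <= t * ((1 + t) * (2 + t) * I - 2) by lra.
  rewrite pmulr_rge0// => H3.
  have tt : t ^+ 2 <= t by rewrite expr2 ler_piMr// ?ltW//; rewrite /t; lra.
  have : (1 + t) * (2 + t) * I <= (2 + 4 * t) * I by rewrite ler_wpM2r//; lra.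
  have : (2 + 4 * t) * I < 2 by rewrite /t; nra.
  by lra.
Qed.

End StandardGaussian.

(** * A central limit theorem for sign walks *)

Section CentralLimit.
Variable R : realType.
Implicit Types (phi psi : R -> R) (x y s r h K : R).

Definition lipb K phi := (forall r, `|phi r| <= K) /\
  (forall r h, `|phi (r + h) - phi r| <= K * `|h|).

Lemma lipb_ge0 K phi : lipb K phi -> 0 <= K.
Proof. by move=> [b _]; exact: le_trans (normr_ge0 _) (b 0). Qed.

Lemma lipb_continuous K phi : lipb K phi -> continuous phi.
Proof.
move=> L; have K0 := lipb_ge0 L; case: L => _ L x.
apply/cvgrPdist_le => e e0; near=> t.
rewrite distrC -[X in phi X - _](subrKC x) (le_trans (L _ _))//.
have d : `|x - t| < e / (K + 1).
  by near: t; apply: cvgr_dist_lt; rewrite ?divr_gt0//; lra.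
rewrite distrC; apply: (@le_trans _ _ ((K + 1) * `|x - t|)).
  by rewrite ler_wpM2r//; lra.
by rewrite mulrC -ler_pdivlMr ?ltW//; lra.
Unshelve. all: by end_near. Qed.

Lemma lipb_measurable K phi : lipb K phi -> measurable_fun setT phi.
Proof. by move=> L; apply: continuous_measurable_fun; exact: lipb_continuous L. Qed.

Lemma lipb_gint K phi : lipb K phi -> gint phi.
Proof. by move=> L; apply: (gint_bounded (lipb_measurable L)); case: L => b _; exact: b. Qed.

Lemma lipb_affine K phi x s : lipb K phi -> lipb (K * (1 + `|s|)) (fun y => phi (x + s * y)).
Proof.
move=> L; have K0 := lipb_ge0 L; case: L => b L; split=> [r|r h].
  by rewrite (le_trans (b _))// ler_peMr// lerDl.
rewrite mulrDr addrA (le_trans (L _ _))// normrM mulrA ler_wpM2r// ler_wpM2l//.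
by rewrite lerDr.
Qed.

Lemma lipb_avg K phi mu : subprob mu -> lipb K phi -> lipb K (avg mu phi).
Proof.
move=> sm L; split=> [r|r h]; first by apply: avg_bound => //; case: L.
rewrite -avg_shift; apply: avg_dist => // y; by case: L.
Qed.

(** The heat semigroup: convolution with a centred Gaussian of variance [s^2]. *)
Definition heat s phi x : R := gexp (fun y => phi (x + s * y)).

Lemma heat_gint K phi s x : lipb K phi -> gint (fun y => phi (x + s * y)).
Proof. by move=> L; exact: lipb_gint (lipb_affine x s L). Qed.

Lemma gexp_dist phi psi e : gint phi -> gint psi -> (forall y, `|phi y - psi y| <= e) ->
  `|gexp phi - gexp psi| <= e.
Proof.
move=> i1 i2 d; rewrite ler_norml; apply/andP; split.
- rewrite lerBrDr -[X in X + _ <= _](gexp_cst (- e)) -gexpD//; last exact: gint_cst.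
  apply: gexp_le => //; first by apply: gintD => //; exact: gint_cst.
  by move=> y; have := d y; rewrite ler_norml; lra.
- rewrite lerBlDr -[X in _ <= X + _](gexp_cst e) -gexpD//; last exact: gint_cst.
  apply: gexp_le => //; first by apply: gintD => //; exact: gint_cst.
  by move=> y; have := d y; rewrite ler_norml; lra.
Qed.

Lemma heat_lipb K phi s : lipb K phi -> lipb K (heat s phi).
Proof.
move=> L; split=> [r|r h].
  rewrite -[heat _ _ _]subr0 -(gexp_cst 0); apply: gexp_dist.
  - exact: heat_gint L.
  - exact: gint_cst.
  - by move=> y; rewrite subr0; case: L.
apply: gexp_dist; [exact: heat_gint L..|].
by move=> y; rewrite addrAC; case: L.
Qed.

Lemma heat_heat K phi s : lipb K phi -> heat s (heat s phi) = heat (Num.sqrt 2 * s) phi.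
Proof.
move=> L; apply/funext => x; have K0 := lipb_ge0 L.
have Lh := heat_lipb s L.
pose psi r := phi (x + s * r) + K.
have Lp : lipb (K * (1 + `|s|) + K) psi.
  have [b l] := lipb_affine x s L; split=> [r|r h].
    by rewrite (le_trans (ler_normD _ _))// lerD// ger0_norm.
  rewrite /psi opprD addrACA subrr addr0 (le_trans (l _ _))//.
  by rewrite ler_wpM2r// lerDl.
have p0 r : 0 <= psi r.
  by rewrite /psi; case: L => b _; have := b (x + s * r); rewrite ler_norml; lra.
have := gauss_convolution (lipb_continuous Lp) p0.
have -> : (fun u : R => (psi (Num.sqrt 2 * u) * gauss u)%:E) =
   (fun u => ((phi (x + Num.sqrt 2 * s * u) + K) * gauss u)%:E).
  by apply/funext => u; rewrite /psi mulrCA mulrA.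
rewrite -(@EFin_gexp _ (fun u => phi (x + Num.sqrt 2 * s * u) + K)); last first.
  by apply: gintD; [exact: heat_gint L|exact: gint_cst].
rewrite (gexpD (heat_gint (Num.sqrt 2 * s) x L) (gint_cst K)) gexp_cst.
have -> : (\int[lebesgue_measure]_y \int[lebesgue_measure]_z
     (psi (y + z) * gauss z * gauss y)%:E)%E =
  (gexp (fun y => heat s phi (x + s * y) + K))%:E.
  rewrite EFin_gexp; last first.
    by apply: gintD; [exact: heat_gint Lh|exact: gint_cst].
  apply: eq_integral => y _.
  have E z : (psi (y + z) * gauss z * gauss y)%:E =
     ((gauss y)%:E * ((phi (x + s * y + s * z) + K) * gauss z)%:E)%E.
    by rewrite /psi mulrDr addrA mulrC EFinM.
  under eq_integral do rewrite E.
  have gi : gint (fun z => phi (x + s * y + s * z) + K).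
    by apply: gintD; [exact: heat_gint L|exact: gint_cst].
  rewrite integralZl// -EFin_gexp// (gexpD (heat_gint s _ L) (gint_cst K)) gexp_cst.
  by rewrite -EFinM mulrC.
rewrite (gexpD (heat_gint s x Lh) (gint_cst K)) gexp_cst => -[] /addIr.
by [].
Qed.

(** A Gaussian of standard deviation [2^k s] splits into [4^k] independent ones of
    standard deviation [s]: quadrupling the number of steps applies [heat_heat]
    in two layers. *)
Lemma heat_iter K phi s k : lipb K phi -> iter (4 ^ k) (heat s) phi = heat (2 ^+ k * s) phi.
Proof.
elim: k phi => [|k IH] phi L; first by rewrite expr0 mul1r.
rewrite expnS iterM /=; set h := 2 ^+ k * s.
have L1 : lipb K (heat h phi) by exact: heat_lipb.
have L2 : lipb K (heat h (heat h phi)) by exact: heat_lipb.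
have L3 : lipb K (heat h (heat h (heat h phi))) by exact: heat_lipb.
rewrite (IH _ L) (IH _ L1) (IH _ L2) (IH _ L3) (heat_heat _ L2) (heat_heat _ L).
by rewrite (heat_heat _ L) mulrA -expr2 sqr_sqrtr// /h exprS mulrA.
Qed.

(** Bounded Lipschitz functions with a second-order expansion of the symmetric
    second difference. *)
Definition class2 K phi := lipb K phi /\ exists phi2 : R -> R, forall r h,
  `|phi (r + h) + phi (r - h) - 2 * phi r - phi2 r * h ^+ 2| <= K * `|h| ^+ 3.

Lemma class2_avg K phi mu : subprob mu -> class2 K phi -> class2 K (avg mu phi).
Proof.
move=> sm [L [phi2 T]]; split; first exact: lipb_avg.
exists (avg mu phi2) => r h.
have := @avg_bound _ _ mu (fun y => phi (y + h) + phi (y - h) - 2 * phi y - phi2 y * h ^+ 2)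
  (K * `|h| ^+ 3) r sm (fun y => T y h).
congr (`|_| <= _).
transitivity (avg mu (fun y => phi (y + h)) r + avg mu (fun y => phi (y - h)) r +
  (- 2) * avg mu phi r + (- h ^+ 2) * avg mu phi2 r).
  rewrite -!avgZ -!avgD; congr avg; apply/funext => y; ring.
by rewrite !avg_shift; ring.
Qed.

Definition third_moment : R := gexp (fun y => `|y| ^+ 3).

Lemma third_moment_ge0 : 0 <= third_moment.
Proof.
rewrite -(gexp_cst 0); apply: gexp_le; [exact: gint_cst|exact: gint_cube|].
by move=> y; rewrite exprn_ge0.
Qed.

(** A Gaussian and a sign have the same variance and are both symmetric, so their
    averages agree to second order. *)
Lemma heat_coin K phi s x : 0 <= s -> class2 K phi ->
  `|heat s phi x - avg (coin R s) phi x| <= K * (1 + third_moment) * s ^+ 3.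
Proof.
move=> s0 [L [phi2 T]]; have K0 := lipb_ge0 L.
have s3 : 0 <= s ^+ 3 by rewrite exprn_ge0.
pose q y := 2 * phi x + phi2 x * s ^+ 2 * y ^+ 2.
have iq : gint q.
  by apply: (gintD (gint_cst _) (gintZ _ (@gint_sqr R))).
have Eq : gexp q = 2 * phi x + phi2 x * s ^+ 2.
  by rewrite (gexpD (gint_cst _) (gintZ _ (@gint_sqr R))) gexp_cst (gexpZ _ (@gint_sqr R)) gexp_sqr mulr1.
have i1 := heat_gint s x L; have i2 := heat_gint (- s) x L.
have sym : gexp (fun y => phi (x + - s * y)) = heat s phi x.
  have [b _] := lipb_affine x s L.
  rewrite /heat -[RHS](gexp_opp (lipb_measurable (lipb_affine x s L)) b).
  by congr gexp; apply/funext => y; rewrite mulNr mulrN.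
have H : `|2 * heat s phi x - gexp q| <= K * s ^+ 3 * third_moment.
  have -> : 2 * heat s phi x = gexp (fun y => phi (x + s * y) + phi (x + - s * y)).
    by rewrite (gexpD i1 i2) sym /heat; ring.
  have i3 : gint (fun y => K * s ^+ 3 * `|y| ^+ 3) by apply: gintZ; exact: gint_cube.
  have E3 : K * s ^+ 3 * third_moment = gexp (fun y => K * s ^+ 3 * `|y| ^+ 3).
    by rewrite (gexpZ _ (@gint_cube R)).
  have B y : `|phi (x + s * y) + phi (x + - s * y) - q y| <= K * s ^+ 3 * `|y| ^+ 3.
    have := T x (s * y); rewrite normrM !exprMn (ger0_norm s0) (mulrA K).
    have -> : phi (x + s * y) + phi (x - s * y) - 2 * phi x - phi2 x * (s ^+ 2 * y ^+ 2) =
      phi (x + s * y) + phi (x + - s * y) - q y by rewrite /q mulNr; ring.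
    by [].
  rewrite ler_norml; apply/andP; split.
    rewrite lerBrDr addrC lerBlDr E3 -(gexpD (gintD i1 i2) i3).
    apply: gexp_le => //; first exact: (gintD (gintD i1 i2) i3).
    by move=> y; have := B y; rewrite ler_norml; lra.
  rewrite lerBlDr E3 -(gexpD i3 iq).
  apply: gexp_le => //; [exact: (gintD i1 i2)|exact: (gintD i3 iq)|].
  by move=> y; have := B y; rewrite ler_norml; lra.
have := T x s; rewrite (ger0_norm s0) avg_coin Eq in H *.
have : 0 <= K * s ^+ 3 * third_moment by rewrite !mulr_ge0// third_moment_ge0.
have : 0 <= K * s ^+ 3 by rewrite mulr_ge0.
have -> : K * (1 + third_moment) * s ^+ 3 = K * s ^+ 3 + K * s ^+ 3 * third_moment by ring.
move: H; rewrite !ler_norml => /andP[? ?] ? ? /andP[? ?]; apply/andP; split; lra.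
Qed.

(** The steps are exchanged one at a time; averaging preserves uniform errors. *)
Lemma heat_walk K phi s n x : 0 <= s -> class2 K phi ->
  `|iter n (heat s) phi x - avg (cpow (coin R s) n) phi x|
    <= n%:R * (K * (1 + third_moment) * s ^+ 3).
Proof.
move=> s0 Cl; have L : lipb K phi by case: Cl.
have Li m : lipb K (iter m (heat s) phi) by elim: m => //= m; exact: heat_lipb.
elim: n x => [|n IH] x; first by rewrite /= avg_dirac0 subrr normr0 mul0r.
rewrite avg_cpowS iterS; set b := avg (cpow _ n) phi.
have Cb : class2 K b by apply: class2_avg => //; apply: subprob_cpow; exact: subprob_coin.
rewrite -[X in `|X| <= _](subrKA (heat s b x)) (le_trans (ler_normD _ _))//.
rewrite -natr1 mulrDl mul1r lerD//; last exact: heat_coin.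
apply: gexp_dist; [exact: heat_gint (Li n)|by apply: heat_gint; case: Cb => Lb _; exact: Lb|].
by move=> y; exact: IH.
Qed.

(** Central limit theorem for class [class2], uniformly: the walk of [4^k] steps
    of length [2^-k] follows the heat semigroup. *)
Lemma walk_clt K e : 0 <= K -> 0 < e -> exists k0 : nat, forall k, (k0 <= k)%N ->
  forall phi, class2 K phi ->
  `|gexp phi - avg (cpow (coin R (2 ^- k)) (4 ^ k)) phi 0| <= e.
Proof.
move=> K0 e0; pose M := K * (1 + third_moment).
have M0 : 0 <= M by rewrite mulr_ge0// addr_ge0// third_moment_ge0.
exists (Num.truncn (M / e)).+1 => k k0 phi Cl.
have s0 : 0 <= 2 ^- k :> R by rewrite invr_ge0 exprn_ge0.
have -> : gexp phi = iter (4 ^ k) (heat (2 ^- k)) phi 0.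
  rewrite (heat_iter _ _ (proj1 Cl)) divff ?expf_neq0// /heat.
  by congr gexp; apply/funext => y; rewrite add0r mul1r.
apply: le_trans (heat_walk _ _ s0 Cl) _; rewrite -/M.
have -> : (4 ^ k)%:R * (M * 2 ^- k ^+ 3) = M * 2 ^- k :> R.
  have -> : (4 ^ k)%:R = 2 ^+ k ^+ 2 :> R.
    by rewrite (_ : 4 = 2 ^ 2)%N// -expnM mulnC expnM !natrX.
  have : 2 ^+ k != 0 :> R by rewrite expf_neq0.
  by move=> n0; field.
rewrite ler_pdivrMr ?exprn_gt0// mulrC -ler_pdivrMr//.
apply: (@le_trans _ _ k%:R).
  by rewrite (le_trans (ltW (truncnS_gt _)))// ler_nat.
by rewrite -natrX ler_nat ltnW// ltn_expl.
Qed.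

End CentralLimit.

(** * Rounding Gaussian variables *)

Section Discretization.
Variable R : realType.
Implicit Types (phi : R -> R) (a b e y : R).

Definition cell a e (i : nat) : set R := [set` `[a + i%:R * e, a + i.+1%:R * e[ ].

Definition gmass (A : set R) : R := gexp \1_A.

(** The standard Gaussian rounded down to a grid of [L] cells of width [e]
    starting at [a]; the mass outside the grid is dropped. *)
Definition grid a e (L : nat) : seq (R * R) :=
  [seq (gmass (cell a e i), a + i%:R * e) | i <- iota 0 L].

Lemma indic_itvco a b y : \1_[set` `[a, b[ ] y = ((a <= y) && (y < b))%:R :> R.
Proof. by rewrite indicE mem_setE in_itv. Qed.

Lemma sum_cells a e L y : 0 <= e ->
  \sum_(i <- iota 0 L) \1_(cell a e i) y = \1_[set` `[a, a + L%:R * e[ ] y :> R.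
Proof.
move=> e0; elim: L => [|L IH].
  by rewrite big_nil mul0r addr0 indic_itvco; case: leP => //= h; rewrite ltNge ltW ?orbT.
rewrite -addn1 iotaD big_cat big_seq1 IH /= add0n addn1 /cell !indic_itvco.
have h1 : a <= a + L%:R * e by rewrite lerDl mulr_ge0.
have h2 : a + L%:R * e <= a + L.+1%:R * e by rewrite lerD2l ler_wpM2r// ler_nat.
case: (leP a y) => ay; case: (ltP y (a + L%:R * e)) => yL /=.
- by rewrite addr0 (lt_le_trans yL h2).
- by rewrite add0r.
- by rewrite addr0; have := lt_le_trans ay h1; rewrite ltNge; case: leP.
- by have := le_trans h1 yL; rewrite leNgt ay.
Qed.

Lemma gint_indic A : measurable A -> gint (\1_A : R -> R).
Proof.
move=> mA; apply: (@gint_bounded _ _ 1); first exact: measurable_indic.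
by move=> y; rewrite indicE; case: (_ \in _); rewrite ?normr1 ?normr0.
Qed.

Lemma gmass_ge0 A : measurable A -> 0 <= gmass A.
Proof.
move=> mA; rewrite -(gexp_cst 0); apply: gexp_le; [exact: gint_cst|exact: gint_indic|].
by move=> y; rewrite indicE.
Qed.

Lemma gexp_sum (I : Type) (r : seq I) (F : I -> R -> R) :
  (forall i, gint (F i)) ->
  gint (fun y => \sum_(i <- r) F i y) /\
  gexp (fun y => \sum_(i <- r) F i y) = \sum_(i <- r) gexp (F i).
Proof.
move=> iF; elim: r => [|i r [IH1 IH2]].
  have -> : (fun y => \sum_(i <- [::]) F i y) = fun=> 0.
    by apply/funext => y; rewrite big_nil.
  by rewrite big_nil gexp_cst; split=> //; exact: gint_cst.
have -> : (fun y => \sum_(j <- i :: r) F j y) = fun y => F i y + \sum_(j <- r) F j y.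
  by apply/funext => y; rewrite big_cons.
by rewrite big_cons (gexpD (iF i) IH1) IH2; split=> //; exact: gintD.
Qed.

Lemma measurable_cell a e i : measurable (cell a e i).
Proof. exact: measurable_itv. Qed.

Lemma sum_gmass_cells a e L : 0 <= e ->
  \sum_(i <- iota 0 L) gmass (cell a e i) = gmass [set` `[a, a + L%:R * e[ ].
Proof.
move=> e0; rewrite /gmass.
have [_ <-] := gexp_sum (iota 0 L) (fun i => gint_indic (measurable_cell a e i)).
by congr gexp; apply/funext => y; rewrite sum_cells.
Qed.

Lemma gmass_le1 A : measurable A -> gmass A <= 1.
Proof.
move=> mA; rewrite -(gexp_cst 1); apply: gexp_le; [exact: gint_indic|exact: gint_cst|].
by move=> y; rewrite indicE; case: (_ \in _).
Qed.

Lemma subprob_grid a e L : 0 <= e -> subprob (grid a e L).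
Proof.
move=> e0; split.
  by move=> _ /mapP[i _ ->]; apply: gmass_ge0; exact: measurable_cell.
rewrite big_map /= sum_gmass_cells//; apply: gmass_le1; exact: measurable_itv.
Qed.

(** Rounding moves points inside the grid by at most [e]; the mass outside is
    dropped. *)
Lemma grid_approx K phi a e L : 0 <= e -> lipb K phi ->
  `|gexp phi - avg (grid a e L) phi 0| <=
    K * e + K * (1 - gmass [set` `[a, a + L%:R * e[ ]).
Proof.
move=> e0 Lp; have K0 := lipb_ge0 Lp; have iphi := lipb_gint Lp; case: Lp => B Lp.
pose v i : R := a + i%:R * e; pose box : set R := [set` `[a, a + L%:R * e[ ].
have mbox : measurable box by exact: measurable_itv.
have [i2 E2] := gexp_sum (iota 0 L) (fun i => gintZ (phi (v i)) (gint_indic (measurable_cell a e i))).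
have -> : avg (grid a e L) phi 0 =
    gexp (fun y => \sum_(i <- iota 0 L) phi (v i) * \1_(cell a e i) y).
  rewrite E2 /avg big_map; apply: eq_bigr => i _ /=.
  by rewrite add0r (gexpZ _ (gint_indic (measurable_cell a e i))) mulrC.
have i3 := gintD (gint_cst (K * e + K)) (gintZ (- K) (gint_indic mbox)).
have -> : K * e + K * (1 - gmass box) = gexp (fun y => (K * e + K) + - K * \1_box y).
  rewrite (gexpD (gint_cst _) (gintZ _ (gint_indic mbox))) gexp_cst.
  by rewrite (gexpZ _ (gint_indic mbox)) /gmass; ring.
have P y : `|phi y - \sum_(i <- iota 0 L) phi (v i) * \1_(cell a e i) y| <=
    (K * e + K) + - K * \1_box y.
  have -> : phi y - \sum_(i <- iota 0 L) phi (v i) * \1_(cell a e i) y =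
    phi y * (1 - \1_box y) + \sum_(i <- iota 0 L) (phi y - phi (v i)) * \1_(cell a e i) y.
    under [in RHS]eq_bigr do rewrite mulrBl.
    by rewrite sumrB -mulr_sumr sum_cells// /box; ring.
  have b01 : 0 <= (\1_box y : R) <= 1 by rewrite indicE; case: (_ \in _); rewrite ?lexx ?ler01.
  case/andP: b01 => b0 b1.
  have T1 : `|phi y * (1 - \1_box y)| <= K * (1 - \1_box y).
    by rewrite normrM (ger0_norm (x := 1 - _)) ?subr_ge0// ler_wpM2r ?subr_ge0.
  have T2 : `|\sum_(i <- iota 0 L) (phi y - phi (v i)) * \1_(cell a e i) y| <= K * e * \1_box y.
    rewrite /box -sum_cells// mulr_sumr (le_trans (ler_norm_sum _ _ _))//.
    apply: ler_sum => i _; rewrite normrM (ger0_norm (x := \1_(cell a e i) y))//.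
    rewrite indic_itvco; case: andP => [[h1 h2]|_]; last by rewrite !mulr0.
    rewrite !mulr1; have := Lp (v i) (y - v i); rewrite subrKC => H.
    rewrite (le_trans H)// ler_wpM2l// ger0_norm ?subr_ge0//.
    by move: h2; rewrite /v -natr1 mulrDl; lra.
  apply: le_trans (ler_normD _ _) _.
  have : K * e * \1_box y <= K * e by rewrite ler_piMr// mulr_ge0.
  by lra.
rewrite ler_norml; apply/andP; split.
  rewrite lerBrDr addrC lerBlDr -(gexpD iphi i3).
  apply: gexp_le => //; first exact: (gintD iphi i3).
  by move=> y; have := P y; rewrite ler_norml; lra.
rewrite lerBlDr -(gexpD i3 i2).
apply: gexp_le => //; first exact: (gintD i3 i2).
by move=> y; have := P y; rewrite ler_norml; lra.
Qed.

(** Chebyshev's inequality, from the second moment [gexp_sqr]. *)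
Lemma gmass_box_ge b : 0 < b -> 1 - gmass [set` `[- b, b[ ] <= b ^- 2.
Proof.
move=> b0; have mb : measurable [set` `[- b, b[ ] by exact: measurable_itv.
have b2 : 0 < b ^+ 2 by rewrite exprn_gt0.
have -> : b ^- 2 = gexp (fun y => b ^- 2 * y ^+ 2).
  by rewrite (gexpZ _ (@gint_sqr R)) gexp_sqr mulr1.
have E : 1 = gexp (fun=> 1) :> R by rewrite gexp_cst.
rewrite lerBlDr {1}E /gmass -(gexpD (gintZ _ (@gint_sqr R)) (gint_indic mb)).
apply: gexp_le; [exact: gint_cst|exact: (gintD (gintZ _ (@gint_sqr R)) (gint_indic mb))|].
move=> y; rewrite indic_itvco; have q0 : 0 <= b ^- 2 * y ^+ 2.
  by rewrite mulr_ge0 ?invr_ge0 ?sqr_ge0 ?ltW.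
have [/andP|] := boolP (_ && _); first by move=> _; rewrite lerDr.
rewrite addr0 negb_and -ltNge -leNgt mulrC ler_pdivlMr// mul1r => /orP[h|h].
  by rewrite -(sqrrN y) lerXn2r ?nnegrE; lra.
by rewrite lerXn2r ?nnegrE; lra.
Qed.

End Discretization.

(** The restriction of a jet to a line is a function to which [walk_clt] applies,
    uniformly over directions of bounded length. *)
Lemma jet_class2 (R : realType) (A : finType) K (f : {ffun A -> R} -> R) D H z v M :
  jet K f D H -> nrm v <= M ->
  class2 (K * (1 + M + 2 * M ^+ 3)) (fun r : R => f (z + r *: v)).
Proof.
move=> [K0 [B L] _ _ T] vM; have n0 := nrm_ge0 v; have M0 : 0 <= M by exact: le_trans vM.
have M3 : 0 <= M ^+ 3 by rewrite exprn_ge0.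
have n3 : nrm v ^+ 3 <= M ^+ 3 by rewrite lerXn2r ?nnegrE.
split.
  split=> [r|r h]; first by rewrite (le_trans (B _))// ler_peMr//; lra.
  rewrite scalerDl addrA (le_trans (L _ _))// nrmZ mulrCA mulrC ler_wpM2r//.
  by rewrite ler_wpM2l//; lra.
exists (fun r => quad H (z + r *: v) v) => r h.
set y := z + r *: v.
have -> : z + (r + h) *: v = y + h *: v by rewrite scalerDl addrA.
have -> : z + (r - h) *: v = y + - (h *: v) by rewrite scalerBl addrA.
have t1 := T y (h *: v); have t2 := T y (- (h *: v)); rewrite nrmN in t2.
have lN : lin D y (- (h *: v)) = - lin D y (h *: v).
  by rewrite /lin -sumrN; apply: eq_bigr => a _; rewrite ffunE mulrN.
have qN : quad H y (- (h *: v)) = quad H y (h *: v).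
  rewrite /quad; apply: eq_bigr => a _; apply: eq_bigr => b _.
  by rewrite !(ffunE (fun _ => - _)); ring.
have qZ : quad H y (h *: v) = quad H y v * h ^+ 2.
  rewrite /quad mulr_suml; apply: eq_bigr => a _; rewrite mulr_suml.
  by apply: eq_bigr => b _; rewrite !ffunE /GRing.scale/=; ring.
rewrite lN qN qZ nrmZ exprMn in t2; rewrite qZ nrmZ exprMn in t1.
have h3 : 0 <= `|h| ^+ 3 by rewrite exprn_ge0.
have bd : K * (`|h| ^+ 3 * nrm v ^+ 3) <= K * M ^+ 3 * `|h| ^+ 3.
  by rewrite -mulrA ler_wpM2l// mulrC ler_wpM2r.
have : 0 <= K * (1 + M) * `|h| ^+ 3 by rewrite !mulr_ge0//; lra.
have -> : K * (1 + M + 2 * M ^+ 3) * `|h| ^+ 3 =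
  K * (1 + M) * `|h| ^+ 3 + 2 * (K * M ^+ 3 * `|h| ^+ 3) by ring.
move: t1 t2; rewrite !ler_norml => /andP[? ?] /andP[? ?] ?.
by apply/andP; split; lra.
Qed.

Section Rays.
Variables (R : realType) (V : lmodType R) (v : V).

Definition ray (r : R) : V := r *: v.

Lemma ray_is_zmod_morphism : zmod_morphism ray.
Proof. by move=> x y; rewrite /ray scalerBl. Qed.

HB.instance Definition _ := GRing.isZmodMorphism.Build R V ray ray_is_zmod_morphism.

End Rays.

Section LinearCombination.
Variables (R : realType) (I : finType) (V : lmodType R) (vec : I -> V).

Definition combine (z : {ffun I -> R}) : V := \sum_i z i *: vec i.

Lemma combine_is_zmod_morphism : zmod_morphism combine.
Proof.
move=> x y; rewrite /combine -sumrB; apply: eq_bigr => i _.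
by rewrite !ffunE scalerBl.
Qed.

HB.instance Definition _ :=
  GRing.isZmodMorphism.Build {ffun I -> R} V combine combine_is_zmod_morphism.

Definition unitv (i : I) : {ffun I -> R} := [ffun j => (j == i)%:R].

Lemma combine_unitv (r : R) i : combine (r *: unitv i) = r *: vec i.
Proof.
have E j : (r *: unitv i) j = r * (j == i)%:R by rewrite !ffunE.
rewrite /combine (bigD1 i)//= big1 ?addr0; first by rewrite E eqxx mulr1.
by move=> j /negPf ji; rewrite E ji mulr0 scale0r.
Qed.

Lemma push_combine (mu : seq (R * R)) i :
  push (combine : {additive _ -> _}) (push (ray (unitv i) : {additive _ -> _}) mu) =
  push (ray (vec i) : {additive _ -> _}) mu.
Proof. by rewrite /push -map_comp; apply: eq_map => p /=; rewrite combine_unitv. Qed.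

End LinearCombination.

Section IndependentGaussians.
Variables (R : realType) (d : measure_display) (T : measurableType d)
  (P : probability T R) (I : finType) (X : I -> {RV P >-> R}).
Hypothesis Xind : mutually_independent X.
Hypothesis Xstd : forall i, standard_normal (X i).

Definition pr (S : set T) : R := fine (P S).

Lemma EFin_pr S : measurable S -> (pr S)%:E = P S.
Proof. by move=> mS; rewrite /pr fineK// fin_num_measure. Qed.

Lemma pr_le S S' : measurable S -> measurable S' -> S `<=` S' -> pr S <= pr S'.
Proof. by move=> mS mS' SS; rewrite -lee_fin !EFin_pr// le_measure ?inE. Qed.

Lemma pr_bigsetU (S : set T) (F : nat -> set T) n : measurable S ->
  (forall k, measurable (F k)) -> S `<=` \big[setU/set0]_(k < n) F k ->
  pr S <= \sum_(k < n) pr (F k).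
Proof.
move=> mS mF SF; rewrite -lee_fin EFin_pr// -sumEFin.
under eq_bigr do rewrite EFin_pr//.
exact: content_subadditive.
Qed.

Lemma pr_setU S S' S'' : measurable S -> measurable S' -> measurable S'' ->
  S `<=` S' `|` S'' -> pr S <= pr S' + pr S''.
Proof.
move=> mS mS' mS'' SS.
have := @pr_bigsetU S (fun k => if k == 0%N then S' else S'') 2%N mS.
rewrite !big_ord_recl !big_ord0 /= addr0 setU0; apply => //.
by move=> k; case: ifP.
Qed.

Lemma pr_preimage i A : measurable A -> P (X i @^-1` A) = (gmass A)%:E.
Proof.
move=> mA; have := Xstd i mA; rewrite /distribution /pushforward /= => ->.
rewrite /gmass (EFin_gexp (gint_indic mA)) /normal_prob integral_mkcond.
apply: eq_integral => x _; rewrite patchE indicE; case: (x \in A).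
  by rewrite mul1r.
by rewrite mul0r.
Qed.

Lemma measurable_box (A : I -> set R) : (forall i, measurable (A i)) ->
  measurable [set w | forall i, A i (X i w)].
Proof.
move=> mA; have -> : [set w | forall i, A i (X i w)] = \bigcap_(i in [set: I]) (X i @^-1` A i).
  by apply/seteqP; split => w /= H i; [move=> _; exact: H|exact: H].
apply: fin_bigcap_measurable => // i _.
by rewrite -[X in measurable X]setTI; exact: (measurable_funPT (X i)).
Qed.

Lemma pr_box (A : I -> set R) : (forall i, measurable (A i)) ->
  pr [set w | forall i, A i (X i w)] = \prod_i gmass (A i).
Proof.
move=> mA; apply: EFin_inj; rewrite EFin_pr; last exact: measurable_box.
have := Xind [set: I]%SET mA.
have -> : [set w | forall i, i \in [set: I]%SET -> A i (X i w)] = [set w | forall i, A i (X i w)].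
  by apply/seteqP; split => w /= H i; [apply: H; rewrite inE|move=> _; exact: H].
move=> ->; rewrite -prodEFin; apply: eq_big => [i|i _]; first by rewrite inE.
exact: pr_preimage.
Qed.

(** Conditioning on the cells of the coordinates in [r], one coordinate at a
    time. *)
Lemma pr_le_grid (E0 : set T) (F : {ffun I -> R} -> R) (a e : R) (L : nat) :
  measurable E0 -> 0 <= e -> (forall z, 0 <= F z) ->
  (forall w, E0 w -> forall z : {ffun I -> R}, (forall i, z i <= X i w < z i + e) -> 1 <= F z) ->
  forall (r : seq I) (A : I -> set R) (z : {ffun I -> R}), uniq r ->
  (forall i, measurable (A i)) ->
  (forall i, i \in r -> A i = [set` `[a, a + L%:R * e[ ] /\ z i = 0) ->
  (forall i, i \notin r -> A i = [set` `[z i, z i + e[ ]) ->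
  pr (E0 `&` [set w | forall i, A i (X i w)]) <=
    \prod_(i | i \notin r) gmass (A i) *
    avg (bigconv [seq push (ray (unitv R i) : {additive _ -> _}) (grid a e L) | i <- r]) F z.
Proof.
move=> mE0 e0 F0 HF; elim=> [|i r IH] A z.
  move=> _ mA _ HA; rewrite /= avg_dirac0 (eq_bigl xpredT)//.
  have p0 : 0 <= \prod_i gmass (A i).
    by apply: prodr_ge0 => i _; exact: gmass_ge0.
  have [[w [Ew Aw]]|H] := pselect (exists w, (E0 `&` [set w | forall i, A i (X i w)]) w); last first.
    have -> : E0 `&` [set w | forall i, A i (X i w)] = set0.
      by apply/seteqP; split => // w Hw; case: H; exists w.
    by rewrite /pr measure0 mulr_ge0.
  apply: (@le_trans _ _ (\prod_i gmass (A i))).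
    rewrite -pr_box//; apply: pr_le => //.
    - by apply: measurableI => //; exact: measurable_box.
    - exact: measurable_box.
  apply: ler_peMr => //; apply: (HF w Ew) => i.
  by have := Aw i; rewrite HA//= in_itv.
move=> /= /andP[ir ur] mA Hr HA.
have [Ai zi] : A i = [set` `[a, a + L%:R * e[ ] /\ z i = 0 by apply: Hr; rewrite mem_head.
pose Ak k j := if j == i then cell a e k else A j.
have mAk k j : measurable (Ak k j) by rewrite /Ak; case: ifP => // _; exact: measurable_cell.
have mE A' : (forall j, measurable (A' j)) -> measurable (E0 `&` [set w | forall i, A' i (X i w)]).
  by move=> mA'; apply: measurableI => //; exact: measurable_box.
apply: (@le_trans _ _ (\sum_(k < L) pr (E0 `&` [set w | forall j, Ak k j (X j w)]))).
  apply: (@pr_bigsetU _ (fun k => E0 `&` [set w | forall j, Ak k j (X j w)])); [exact: mE|by move=> k; exact: mE|].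
  move=> w [Ew Aw]; rewrite -(bigcup_mkord L (fun k => E0 `&` [set w | forall j, Ak k j (X j w)])).
  have : \1_[set` `[a, a + L%:R * e[ ] (X i w) = 1 :> R.
    by rewrite indicE mem_set//; have := Aw i; rewrite Ai.
  rewrite -sum_cells// => S1.
  have [k kL ck] : exists2 k, (k < L)%N & cell a e k (X i w).
    apply: contrapT => H; move: S1; rewrite big_seq big1.
      by move/esym/eqP; rewrite oner_eq0.
    move=> k; rewrite mem_iota add0n => /andP[_ kL]; rewrite indicE memNset// => ck.
    by apply: H; exists k.
  exists k => //; split=> // j; rewrite /Ak; case: eqP => [->//|_]; exact: Aw.
rewrite avg_conv avg_push.
rewrite /avg big_map -(big_mkord xpredT (fun k => pr (E0 `&` [set w | forall j, Ak k j (X j w)]))).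
rewrite /index_iota subn0 mulr_sumr; apply: ler_sum => k _ /=.
pose zk := z + ray (unitv R i) (a + k%:R * e).
have zkj j : zk j = if j == i then a + k%:R * e else z j.
  rewrite /zk !ffunE; case: eqP => [->|_]; rewrite /GRing.scale /=.
    by rewrite mulr1 zi add0r.
  by rewrite mulr0 addr0.
have := IH (Ak k) zk ur (mAk k).
rewrite (bigD1 i)//= (_ : Ak k i = cell a e k); last by rewrite /Ak eqxx.
have -> : \prod_(j | (j \notin r) && (j != i)) gmass (Ak k j) = \prod_(j | j \notin i :: r) gmass (A j).
  apply: eq_big => [j|j /andP[_ /negPf ji]]; last by rewrite /Ak ji.
  by rewrite inE negb_or andbC.
move=> H; rewrite add0r -/zk mulrCA mulrA; apply: H.
- move=> j jr; rewrite /Ak zkj; case: eqP => [ji|_]; first by rewrite -ji jr in ir.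
  by apply: Hr; rewrite inE jr orbT.
- move=> j jr; rewrite /Ak zkj; case: eqP => [_|/eqP ji].
    by rewrite /cell -natr1 mulrDl mul1r addrA.
  by apply: HA; rewrite inE negb_or ji.
Qed.

End IndependentGaussians.

Lemma jet_avg (R : realType) (A : finType) K (f : {ffun A -> R} -> R) D H mu :
  subprob mu -> jet K f D H ->
  jet K (avg mu f) (fun a => avg mu (D a)) (fun a b => avg mu (H a b)).
Proof.
move=> sm [K0 f0 D0 H0 T].
have bl g : blip K g -> blip K (avg mu g).
  move=> [B L]; split=> [z|z v]; first exact: avg_bound.
  by rewrite -avg_shift; apply: avg_dist => // y; exact: L.
split=> //; [exact: bl|by move=> a; exact: bl|by move=> a b; exact: bl|].
move=> z v.
have := @avg_bound _ _ mu (fun z => f (z + v) - f z - lin D z v - 2^-1 * quad H z v)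
  (K * nrm v ^+ 3) z sm (fun y => T y v).
have -> : (fun z => f (z + v) - f z - lin D z v - 2^-1 * quad H z v) =
  (fun z => f (z + v) + ((- 1) * f z + ((- 1) * lin D z v + (- 2^-1) * quad H z v))).
  by apply/funext => y; ring.
rewrite !avgD !avgZ avg_shift.
have -> : avg mu (fun y => lin D y v) z = lin (fun a => avg mu (D a)) z v.
  rewrite /lin avg_sum; apply: eq_bigr => a _.
  have -> : (fun y => D a y * v a) = (fun y => v a * D a y) by apply/funext => y; rewrite mulrC.
  by rewrite avgZ mulrC.
have -> : avg mu (fun y => quad H y v) z = quad (fun a b => avg mu (H a b)) z v.
  rewrite /quad avg_sum; apply: eq_bigr => a _; rewrite avg_sum; apply: eq_bigr => b _.
  have -> : (fun y => H a b y * v a * v b) = (fun y => (v a * v b) * H a b y).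
    by apply/funext => y; ring.
  by rewrite avgZ; ring.
set F1 := avg mu f (z + v); set F2 := avg mu f z; set F3 := lin _ _ _; set F4 := quad _ _ _.
by have -> : F1 + (-1 * F2 + (-1 * F3 + - 2^-1 * F4)) = F1 - F2 - F3 - 2^-1 * F4 by ring.
Qed.

Lemma expr_ge_bernoulli (R : realType) (p : R) n : 0 <= p <= 1 -> 1 - p ^+ n <= n%:R * (1 - p).
Proof.
case/andP=> p0 p1; elim: n => [|n IH]; first by rewrite expr0 subrr mul0r.
rewrite -natr1 mulrDl mul1r exprS.
have -> : 1 - p * p ^+ n = p * (1 - p ^+ n) + (1 - p) by ring.
rewrite lerD2r (le_trans _ IH)// ler_piMl// subr_ge0 exprn_ile1//.
Qed.

Section GaussianToWalk.
Variables (R : realType) (d : measure_display) (T : measurableType d)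
  (P : probability T R) (I : finType) (X : I -> {RV P >-> R}).
Hypothesis Xind : mutually_independent X.
Hypothesis Xstd : forall i, standard_normal (X i).
Local Notation along v := (push (ray v : {additive _ -> _})).

(** Independent standard Gaussians leave a large box with small probability, so
    events may be studied inside the box. *)
Lemma pr_le_box (E0 : set T) (b : R) : measurable E0 -> 0 < b ->
  pr P E0 <= pr P (E0 `&` [set w | forall i, [set` `[- b, b[] (X i w)]) + #|I|%:R * b ^- 2.
Proof.
move=> mE b0; set box := [set` `[- b, b[ ].
have mbox : measurable box by exact: measurable_itv.
set B := [set w | _].
have mB : measurable B by exact: (@measurable_box _ _ _ P I X (fun=> box)).
apply: (@le_trans _ _ (pr P (E0 `&` B) + pr P (~` B))).
  apply: pr_setU => //; [exact: measurableI|exact: measurableC|].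
  by move=> w Ew; have [Bw|Bw] := pselect (B w); [left|right].
rewrite lerD2l; have -> : pr P (~` B) = 1 - pr P B.
  by apply: EFin_inj; rewrite EFinB !EFin_pr//; [exact: probability_setC|exact: measurableC].
rewrite (pr_box Xind Xstd (fun=> mbox)) prodr_const.
rewrite (le_trans (expr_ge_bernoulli _ _))// ?gmass_ge0 ?gmass_le1//.
by rewrite cardT -cardE ler_wpM2l// gmass_box_ge.
Qed.

(** Rounding changes the [X i] by less than [e0] inside a large box; the rounded
    coordinates are then exchanged for walks one at a time, by [walk_clt]. *)
Lemma gaussian_to_walk (A : finType) (K c e0 eps : R) (vec : I -> {ffun A -> R})
    (f : nat -> {ffun A -> R} -> R) (E0 : set T) :
  measurable E0 -> 0 <= K -> 0 <= c -> 0 < e0 -> 0 < eps ->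
  (forall k z, 0 <= f k z) -> (forall k, exists D H, jet K (f k) D H) ->
  (forall k w, E0 w -> forall z : {ffun I -> R},
     (forall i, z i <= X i w < z i + e0) -> 1 <= c * f k (combine vec z)) ->
  exists k0 : nat, forall k, (k0 <= k)%N ->
    pr P E0 <= c * avg (cpow (coins R [seq 2 ^- k *: vec i | i <- enum I]) (4 ^ k)) (f k) 0 + eps.
Proof.
move=> mE K0 c0 e00 eps0 f0 J HE.
pose n : R := #|I|%:R; have n0 : 0 <= n by [].
pose M := \sum_i nrm (vec i).
have vM i : nrm (vec i) <= M.
  by rewrite /M (bigD1 i)//= lerDl sumr_ge0// => j _; exact: nrm_ge0.
have M0 : 0 <= M by apply: sumr_ge0 => j _; exact: nrm_ge0.
pose K' := K * (1 + M + 2 * M ^+ 3).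
have K'0 : 0 <= K' by rewrite mulr_ge0//; have := exprn_ge0 3 M0; lra.
pose tau := eps / (n * (1 + c * (2 * K' + 1)) + 1).
have den0 : 0 < n * (1 + c * (2 * K' + 1)) + 1.
  by rewrite ltr_wpDl// mulr_ge0// addr_ge0// mulr_ge0// addr_ge0// mulr_ge0.
have tau0 : 0 < tau by rewrite divr_gt0.
have tauE : tau * (n * (1 + c * (2 * K' + 1)) + 1) = eps by rewrite divfK// gt_eqF.
pose b := 1 + tau^-1.
have b1 : 1 <= b by rewrite lerDl invr_ge0 ltW.
have b0 : 0 < b by lra.
have b2 : b ^- 2 <= tau.
  rewrite -[leRHS]invrK lef_pV2 ?posrE ?exprn_gt0 ?invr_gt0//.
  by apply: (@le_trans _ _ b); [rewrite /b lerDr|rewrite expr2 ler_peMr// ltW].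
pose em := Num.min tau e0.
have em0 : 0 < em by rewrite lt_min tau0.
pose L := (Num.truncn (2 * b / em)).+1.
have L0 : 0 < L%:R :> R by [].
pose e := 2 * b / L%:R.
have e_gt0 : 0 < e by rewrite divr_gt0// mulr_gt0.
have eem : e <= em.
  have := ltW (truncnS_gt (2 * b / em)); rewrite -/L ler_pdivrMr//.
  by rewrite /e ler_pdivrMr// (mulrC em).
have etau : e <= tau by rewrite (le_trans eem)// ge_min lexx.
have ee0 : e <= e0 by rewrite (le_trans eem)// ge_min lexx orbT.
have boxE : - b + L%:R * e = b by rewrite /e mulrC divfK ?gt_eqF//; ring.
pose box : set R := [set` `[- b, - b + L%:R * e[ ].
have mbox : measurable box by exact: measurable_itv.
have gb : 1 - gmass box <= tau by rewrite /box boxE (le_trans (gmass_box_ge b0)).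
have [k0 Hk0] := walk_clt K'0 tau0.
exists k0 => k kk; have Hk := Hk0 k kk.
set W := cpow (coin R (2 ^- k : R)) (4 ^ k) in Hk.
have sW : subprob W by apply: subprob_cpow; exact: subprob_coin.
have sG : subprob (grid (- b) e L) by apply: subprob_grid; exact: ltW.
pose B := [set w | forall i : I, box (X i w)].
have pr1 : pr P E0 <= pr P (E0 `&` B) + n * tau.
  by rewrite (le_trans (pr_le_box mE b0))// /B /box boxE lerD2l ler_wpM2l.
have pr2 : pr P (E0 `&` B) <=
    c * avg (bigconv [seq along (vec i) (grid (- b) e L) | i <- enum I]) (f k) 0.
  have := @pr_le_grid _ _ _ _ _ _ Xind Xstd E0 (fun z => c * f k (combine vec z)) (- b) e L
    mE (ltW e_gt0) _ _ (enum I) (fun=> box) 0 (enum_uniq _) (fun=> mbox) _ _.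
  rewrite big1 ?mul1r; last by move=> i; rewrite mem_enum.
  rewrite avgZ => H; apply: (le_trans (H _ _ _ _)).
  - by move=> z; rewrite mulr_ge0.
  - move=> w Ew z Hz; apply: (HE k w Ew) => i; case/andP: (Hz i) => -> h /=.
    by rewrite (lt_le_trans h)// lerD2l.
  - by move=> i _; rewrite ffunE.
  - by move=> i; rewrite mem_enum.
  rewrite -(avg_pushL (combine vec : {additive _ -> _})) raddf0 push_bigconv -map_comp.
  rewrite (@eq_map _ _ _ (fun i => along (vec i) (grid (- b) e L)))//.
  by move=> i; exact: push_combine.
have rep := @bigconv_replace _ _ _ (enum I)
  (fun i => along (vec i) (grid (- b) e L))
  (fun i => along (vec i) W) (f k) (K' * tau + K' * tau + tau) 0
  (fun i _ => subprob_push _ sG) (fun i _ => subprob_push _ sW).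
have Cl i y : class2 K' (fun r => f k (y + r *: vec i)).
  by have [D [H Jk]] := J k; exact: (jet_class2 y Jk (vM i)).
have {}rep := rep _; have step i y : `|avg (along (vec i) (grid (- b) e L)) (f k) y -
    avg (along (vec i) W) (f k) y| <= K' * tau + K' * tau + tau.
  rewrite !avg_push /=; have h1 := Hk _ (Cl i y).
  have h2 := grid_approx (- b) L (ltW e_gt0) (proj1 (Cl i y)).
  have h3 : K' * e <= K' * tau by rewrite ler_wpM2l.
  have h4 : K' * (1 - gmass box) <= K' * tau by rewrite ler_wpM2l.
  move: h1 h2 h3 h4; rewrite /ray -/box !ler_norml; clear.
  by move=> /andP[? ?] /andP[? ?] ? ?; apply/andP; split; lra.
have {}rep := rep (fun i y _ => step i y).
have wE : avg (bigconv [seq along (vec i) W | i <- enum I]) (f k) 0 =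
  avg (cpow (coins R [seq 2 ^- k *: vec i | i <- enum I]) (4 ^ k)) (f k) 0.
  rewrite /coins avg_cpow_bigconv -!map_comp; congr (avg (bigconv _) _ _).
  by apply: eq_map => i /=; rewrite /W push_cpow push_coin.
rewrite -wE.
move: rep; rewrite -cardE -/n ler_norml => /andP[_ rep].
have := ler_wpM2l c0 rep; rewrite mulrBr => rep'.
have : tau * (n * (1 + c * (2 * K' + 1))) <= eps.
  by rewrite -tauE ler_wpM2l ?lerDl// ltW.
have -> : tau * (n * (1 + c * (2 * K' + 1))) = n * tau + c * (n * (K' * tau + K' * tau + tau)) by ring.
move: rep' pr1 pr2; clear; lra.
Qed.

End GaussianToWalk.

(** * Moments and Chernoff bounds for sign walks *)

Section Exponentials.
Variable R : realType.
Implicit Types u y : R.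

Lemma expR_le_quad u : expR u <= 1 + u + u ^+ 2 * expR `|u|.
Proof.
have [u0|u0] := leP 0 u.
  rewrite ger0_norm//; have e0 := expR_gt0 u.
  have h : expR u <= 1 + u * expR u.
    have := expR_ge1Dx (- u); rewrite -(ler_pM2r e0) -expRD addNr expR0; lra.
  have : u * expR u <= u * (1 + u * expR u) by rewrite ler_wpM2l.
  by rewrite mulrDr mulr1 mulrA -expr2; lra.
have e0 := expR_gt0 u; have n0 := expR_ge0 `|u|.
have h : expR u * (1 - u) <= 1.
  have ee : expR u * expR (- u) = 1 by rewrite -expRD subrr expR0.
  by rewrite -[leRHS]ee; apply: ler_wpM2l; [exact: ltW|exact: expR_ge1Dx].
have en : 1 <= expR `|u|.
  by rewrite (le_trans _ (expR_ge1Dx _))// lerDl.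
have : u ^+ 2 <= u ^+ 2 * expR `|u| by rewrite ler_peMr// sqr_ge0.
suff : expR u <= 1 + u + u ^+ 2 by lra.
have u1 : 0 < 1 - u by lra.
rewrite -(ler_pM2r u1) (le_trans h)//.
have -> : (1 + u + u ^+ 2) * (1 - u) = 1 - u ^+ 3 by ring.
have : 0 <= (- u) ^+ 3 by rewrite exprn_ge0//; lra.
have -> : (- u) ^+ 3 = - u ^+ 3 by ring.
lra.
Qed.

(** A weak form of [cosh y <= exp (y^2 / 2)] that follows from [1 + u <= exp u]
    alone; the walks below only need some constant in the exponent. *)
Lemma cosh_le y : 2^-1 * (expR y + expR (- y)) <= expR (2 * y ^+ 2).
Proof.
have [y2|y2] := leP (y ^+ 2) 2^-1.
  have yb : `|y| < 1.
    rewrite ltNge; apply/negP => h; have : 1 <= `|y| ^+ 2 by rewrite exprn_ege1.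
    by rewrite real_normK ?num_real//; lra.
  move: yb; rewrite ltr_norml => /andP[y1 y3].
  have e0 := expR_gt0 y; have e1 := expR_gt0 (- y).
  have ee : expR y * expR (- y) = 1 by rewrite -expRD subrr expR0.
  have h1 : expR y * (1 - y) <= 1.
    by rewrite -[leRHS]ee; apply: ler_wpM2l; [exact: ltW|exact: expR_ge1Dx].
  have h2 : expR (- y) * (1 + y) <= 1.
    by rewrite -[leRHS]ee [leRHS]mulrC; apply: ler_wpM2l; [exact: ltW|exact: expR_ge1Dx].
  have h3 : (expR y + expR (- y)) * (1 - y ^+ 2) <= 2.
    have a1 : expR y * (1 - y) * (1 + y) <= 1 * (1 + y) by rewrite ler_wpM2r//; lra.
    have a2 : expR (- y) * (1 + y) * (1 - y) <= 1 * (1 - y) by rewrite ler_wpM2r//; lra.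
    have -> : (expR y + expR (- y)) * (1 - y ^+ 2) =
      expR y * (1 - y) * (1 + y) + expR (- y) * (1 + y) * (1 - y) by ring.
    by lra.
  have q0 : 0 < 1 - y ^+ 2 by lra.
  apply: le_trans (expR_ge1Dx _); rewrite -(ler_pM2r q0).
  have : 0 <= y ^+ 2 * (1 - 2 * y ^+ 2) by rewrite mulr_ge0 ?sqr_ge0//; lra.
  have -> : (1 + 2 * y ^+ 2) * (1 - y ^+ 2) = 1 + y ^+ 2 * (1 - 2 * y ^+ 2) by ring.
  by rewrite -mulrA; lra.
have yy : `|y| <= 2 * y ^+ 2.
  rewrite leNgt; apply/negP => h; rewrite -[y ^+ 2]real_normK ?num_real// in h y2.
  have n0 := normr_ge0 y; move: (`|y|) n0 h y2 => r r0 h r2.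
  have : r * 2 < 1 by rewrite ltNge; apply/negP => ?; nra.
  by nra.
have : expR y <= expR (2 * y ^+ 2) by rewrite ler_expR (le_trans (ler_norm y)).
have : expR (- y) <= expR (2 * y ^+ 2).
  by rewrite ler_expR (le_trans (ler_norm (- y)))// normrN.
by lra.
Qed.

End Exponentials.

Section WalkMoments.
Variable R : realType.
Implicit Types (s z : R) (phi : R -> R).

Local Notation W s N := (cpow (coin R s) N).

Lemma subprob_walk s N : subprob (W s N).
Proof. by apply: subprob_cpow; exact: subprob_coin. Qed.

Lemma walk_opp s N phi z : avg (W s N) (fun x => phi (- x)) z = avg (W s N) phi (- z).
Proof.
elim: N z => [|N IH] z; first by rewrite /= !avg_dirac0.
rewrite !avg_cpowS !avg_coin !IH.
have -> : - (z - s) = - z + s by ring.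
have -> : - (z + s) = - z - s by ring.
by congr (_ * _); exact: addrC.
Qed.

Lemma walk_sqr s N z : avg (W s N) (fun x => x ^+ 2) z = z ^+ 2 + N%:R * s ^+ 2.
Proof.
elim: N z => [|N IH] z; first by rewrite /= avg_dirac0 mul0r addr0.
by rewrite avg_cpowS avg_coin !IH -natr1; field.
Qed.

Lemma walk_quartic s N z : avg (W s N) (fun x => x ^+ 4) z <=
  z ^+ 4 + 6 * N%:R * s ^+ 2 * z ^+ 2 + 3 * N%:R ^+ 2 * s ^+ 4.
Proof.
elim: N z => [|N IH] z; first by rewrite /= avg_dirac0 expr0n /= !(mulr0, mul0r, addr0).
have nS : N.+1%:R = N%:R + 1 :> R by rewrite -addn1 natrD.
rewrite avg_cpowS avg_coin nS; have := IH (z + s); have := IH (z - s).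
set a := avg _ _ _; set b := avg _ _ _.
have s4 : 0 <= s ^+ 4 by rewrite exprn_even_ge0.
have -> : z ^+ 4 + 6 * (N%:R + 1) * s ^+ 2 * z ^+ 2 + 3 * (N%:R + 1) ^+ 2 * s ^+ 4 =
  2^-1 * (((z + s) ^+ 4 + 6 * N%:R * s ^+ 2 * (z + s) ^+ 2 + 3 * N%:R ^+ 2 * s ^+ 4) +
   ((z - s) ^+ 4 + 6 * N%:R * s ^+ 2 * (z - s) ^+ 2 + 3 * N%:R ^+ 2 * s ^+ 4)) + 2 * s ^+ 4.
  by field.
by lra.
Qed.

(** Induction on the number of steps: one step turns an exponent [c z^2] into at most
    [c (z^2 + s^2) + 8 c^2 s^2 z^2], and the coefficient [c] stays below 1/16. *)
Lemma walk_exp_sqr s N z : N%:R * s ^+ 2 <= 1 ->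
  avg (W s N) (fun x => expR (32^-1 * x ^+ 2)) z <=
  expR (N%:R * s ^+ 2 / 16 + (32^-1 + N%:R * s ^+ 2 / 32) * z ^+ 2).
Proof.
elim: N z => [|N IH] z h.
  by rewrite /= avg_dirac0 !mul0r add0r addr0.
have s2 : 0 <= s ^+ 2 by rewrite sqr_ge0.
have nS : N.+1%:R = N%:R + 1 :> R by rewrite -addn1 natrD.
have h' : N%:R * s ^+ 2 <= 1 by move: h; rewrite nS; lra.
rewrite avg_cpowS; set a := N%:R * s ^+ 2 in h' IH *.
have a0 : 0 <= a by rewrite mulr_ge0.
have -> : N.+1%:R * s ^+ 2 = a + s ^+ 2 by rewrite nS mulrDl mul1r.
set c := 32^-1 + a / 32.
have c0 : 0 <= c <= 16^-1 by rewrite /c; apply/andP; split; lra.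
apply: (@le_trans _ _ (avg (coin R s) (fun x => expR (a / 16 + c * x ^+ 2)) z)).
  by apply: avg_le => [|y]; [exact: subprob_coin|exact: IH].
rewrite avg_coin.
have -> : expR (a / 16 + c * (z + s) ^+ 2) =
  expR (a / 16 + c * (z ^+ 2 + s ^+ 2)) * expR (2 * c * s * z) by rewrite -expRD; congr expR; ring.
have -> : expR (a / 16 + c * (z - s) ^+ 2) =
  expR (a / 16 + c * (z ^+ 2 + s ^+ 2)) * expR (- (2 * c * s * z)) by rewrite -expRD; congr expR; ring.
rewrite -mulrDr mulrCA; apply: (le_trans (ler_wpM2l (expR_ge0 _) (cosh_le _))).
rewrite -expRD ler_expR; case/andP: c0 => c0 c1.
have z2 : 0 <= z ^+ 2 by rewrite sqr_ge0.
have cc : c * c <= 16^-1 * 16^-1 by rewrite ler_pM.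
have : c * s ^+ 2 <= 16^-1 * s ^+ 2 by rewrite ler_wpM2r.
have : (c * c) * (s ^+ 2 * z ^+ 2) <= (16^-1 * 16^-1) * (s ^+ 2 * z ^+ 2).
  by rewrite ler_wpM2r// mulr_ge0.
have -> : 2 * (2 * c * s * z) ^+ 2 = 8 * (c * c * (s ^+ 2 * z ^+ 2)) by ring.
have -> : 32^-1 + (a + s ^+ 2) / 32 = c + s ^+ 2 / 32 by rewrite /c; ring.
by lra.
Qed.

Variables (s : R) (N : nat).
Hypothesis sN : N%:R * s ^+ 2 = 1.

Definition wexp phi := avg (W s N) phi 0.

Lemma wexp_le phi psi : (forall x, phi x <= psi x) -> wexp phi <= wexp psi.
Proof. by move=> h; apply: avg_le => //; exact: subprob_walk. Qed.

Lemma wexp_cst c : wexp (fun=> c) = c.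
Proof. by apply: cpow_cst => y; exact: coin_cst. Qed.

Lemma wexp_opp phi : wexp (fun x => phi (- x)) = wexp phi.
Proof. by rewrite /wexp walk_opp oppr0. Qed.

Lemma wexp_sqr : wexp (fun x => x ^+ 2) = 1.
Proof. by rewrite /wexp walk_sqr sN expr0n /= add0r. Qed.

Lemma wexp_quartic : wexp (fun x => x ^+ 4) <= 3.
Proof.
apply: le_trans (walk_quartic s N 0) _; rewrite !expr0n /= mulr0 !add0r.
have -> : 3 * N%:R ^+ 2 * s ^+ 4 = 3 * (N%:R * s ^+ 2) ^+ 2 by ring.
by rewrite sN expr1n mulr1.
Qed.

Lemma wexp_pos_sqr : wexp (fun x => pos x ^+ 2) = 2^-1.
Proof.
have := wexp_sqr; have -> : (fun x : R => x ^+ 2) = (fun x => pos x ^+ 2 + pos (- x) ^+ 2).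
  by apply/funext => x; rewrite pos_sqrD.
by rewrite /wexp avgD -/(wexp _) -/(wexp _) (wexp_opp (fun x => pos x ^+ 2)); lra.
Qed.

Lemma wexp_neg_sqr : wexp (fun x => pos (- x) ^+ 2) = 2^-1.
Proof. by rewrite (wexp_opp (fun x => pos x ^+ 2)) wexp_pos_sqr. Qed.

(** From [(x - 1)_+ <= x_+^2 / 4] and the fourth moment, which symmetry halves. *)
Lemma wexp_pos_excess : wexp (fun x => pos (x - 1) ^+ 2) <= 3 / 32.
Proof.
have p4 : wexp (fun x => pos x ^+ 4) <= 3 / 2.
  have := wexp_quartic; have -> : (fun x : R => x ^+ 4) = (fun x => pos x ^+ 4 + pos (- x) ^+ 4).
    by apply/funext => x; rewrite pos_quarticD.
  by rewrite /wexp avgD -/(wexp _) -/(wexp _) (wexp_opp (fun x => pos x ^+ 4)); lra.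
apply: (@le_trans _ _ (wexp (fun x => 16^-1 * pos x ^+ 4))).
  apply: wexp_le => x; rewrite !posE.
  have [h|h] := leP 0 (x - 1); last by rewrite expr0n /= mulr_ge0// exprn_even_ge0.
  have -> : 0 <= x by lra.
  have : (x - 1) ^+ 2 <= (x ^+ 2 / 4) ^+ 2.
    rewrite lerXn2r ?nnegrE//; first by rewrite mulr_ge0 ?sqr_ge0.
    have := sqr_ge0 (x - 2); have -> : (x - 2) ^+ 2 = x ^+ 2 - 4 * x + 4 by ring.
    by lra.
  by have -> : (x ^+ 2 / 4) ^+ 2 = 16^-1 * x ^+ 4 by field.
by rewrite /wexp avgZ -/(wexp _); lra.
Qed.

Lemma wexp_neg_excess : wexp (fun x => pos (- x - 1) ^+ 2) <= 3 / 32.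
Proof. by rewrite (wexp_opp (fun x => pos (x - 1) ^+ 2)) wexp_pos_excess. Qed.

Lemma wexp_exp_sqr : wexp (fun x => expR (32^-1 * x ^+ 2)) <= 2.
Proof.
apply: (le_trans (walk_exp_sqr 0 _)); rewrite ?sN// expr0n /= mulr0 addr0.
have ee : expR (1 / 16) * expR (- (1 / 16)) = 1 :> R by rewrite -expRD subrr expR0.
have := ler_wpM2l (expR_ge0 (1 / 16 : R)) (expR_ge1Dx (- (1 / 16) : R)).
by rewrite ee; lra.
Qed.

(** A variable between 0 and [x^2] is sub-exponential.  The constant 2 * 128^2
    comes from [x^4 <= 128^2 * exp (x^2 / 64)] and [wexp_exp_sqr]. *)
Lemma wexp_mgf phi lam : `|lam| <= 64^-1 -> (forall x, 0 <= phi x <= x ^+ 2) ->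
  wexp (fun x => expR (lam * phi x)) <= expR (lam * wexp phi + 128 * 128 * 2 * lam ^+ 2).
Proof.
move=> l0 hphi.
apply: (@le_trans _ _ (wexp (fun x => (1 + lam * phi x) + (128 * 128 * lam ^+ 2) * expR (32^-1 * x ^+ 2)))).
  apply: wexp_le => x; apply: le_trans (expR_le_quad _) _; rewrite lerD2l.
  case/andP: (hphi x) => p0 p1; have x2 := sqr_ge0 x.
  have e0 := expR_ge0 (x ^+ 2 / 128).
  have h1 : x ^+ 2 / 128 <= expR (x ^+ 2 / 128).
    by apply: le_trans (expR_ge1Dx _); rewrite lerDr.
  have h2 : (x ^+ 2 / 128) ^+ 2 <= expR (x ^+ 2 / 64).
    have -> : x ^+ 2 / 64 = x ^+ 2 / 128 + x ^+ 2 / 128 by field.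
    by rewrite expRD -expr2 lerXn2r ?nnegrE// mulr_ge0.
  have h3 : expR `|lam * phi x| <= expR (x ^+ 2 / 64).
    rewrite ler_expR normrM (ger0_norm p0) mulrC.
    exact: ler_pM.
  have h4 : phi x ^+ 2 <= x ^+ 2 ^+ 2 by rewrite lerXn2r ?nnegrE.
  have -> : expR (32^-1 * x ^+ 2) = expR (x ^+ 2 / 64) * expR (x ^+ 2 / 64).
    by rewrite -expRD; congr expR; field.
  set g := expR (x ^+ 2 / 64) in h2 h3 *; have g0 : 0 <= g by exact: expR_ge0.
  have h5 : phi x ^+ 2 * expR `|lam * phi x| <= (128 * 128 * g) * g.
    apply: ler_pM => //; rewrite ?sqr_ge0 ?expR_ge0//.
    have e4 : (x ^+ 2 / 128) ^+ 2 = x ^+ 2 ^+ 2 / (128 * 128) by field.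
    by rewrite e4 in h2; lra.
  have := ler_wpM2l (sqr_ge0 lam) h5; rewrite exprMn; lra.
rewrite /wexp !avgD !avgZ -!/(wexp _) wexp_cst.
apply: le_trans (expR_ge1Dx _); rewrite addrA lerD2l.
have := wexp_exp_sqr; have l2 := sqr_ge0 lam => h.
have := ler_wpM2l l2 h.
lra.
Qed.

End WalkMoments.

Section WalkChernoff.
Variables (R : realType) (J : finType).
Local Notation V := {ffun J -> R}.
Local Notation on_axis j := (push (ray (unitv R j) : {additive _ -> _})).

Lemma avg_product (mu : seq (R * R)) (u : J -> R -> R) (r : seq J) (z : V) : uniq r ->
  avg (bigconv [seq on_axis j mu | j <- r])
    (fun z => \prod_j u j (z j)) z =
  \prod_j (if j \in r then avg mu (u j) (z j) else u j (z j)).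
Proof.
elim: r z => [|j r IH] z; first by rewrite /= avg_dirac0.
move=> /= /andP[jr ur]; rewrite avg_conv avg_push.
have E t : (z + ray (unitv R j) t) j = z j + t.
  by rewrite !ffunE eqxx /GRing.scale /= mulr1.
have E' t i : i != j -> (z + ray (unitv R j) t) i = z i.
  by move=> /negPf ij; rewrite !ffunE ij /GRing.scale /= mulr0 addr0.
have step t : avg (bigconv [seq on_axis j mu | j <- r])
    (fun z => \prod_j u j (z j)) (z + ray (unitv R j) t) =
  \prod_(i | i != j) (if i \in j :: r then avg mu (u i) (z i) else u i (z i)) * u j (z j + t).
  rewrite (IH _ ur) (bigD1 j)//= (negPf jr) E mulrC; congr (_ * _).
  by apply: eq_bigr => i ij; rewrite E'// inE (negPf ij).
rewrite [RHS](bigD1 j)//= mem_head mulrC.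
have -> : (fun y => avg (bigconv [seq on_axis j mu | j <- r])
    (fun z => \prod_j u j (z j)) (z + ray (unitv R j) y)) =
  (fun t => \prod_(i | i != j) (if i \in j :: r then avg mu (u i) (z i) else u i (z i)) * u j (z j + t)).
  by apply/funext => t; rewrite step.
rewrite avgZ; congr (_ * _).
by rewrite /avg; apply: eq_bigr => p _; rewrite add0r.
Qed.

Variables (s : R) (N : nat).
Hypothesis sN : N%:R * s ^+ 2 = 1.

Definition jwalk := cpow (coins R [seq s *: unitv R j | j <- enum J]) N.

Lemma subprob_jwalk : subprob jwalk.
Proof. by apply: subprob_cpow; exact: subprob_coins. Qed.

Lemma jwalk_product (u : J -> R -> R) :
  avg jwalk (fun z : V => \prod_j u j (z j)) 0 = \prod_j wexp s N (u j).
Proof.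
have := @avg_product (cpow (coin R s) N) u (enum J) 0 (enum_uniq _).
have -> : \prod_j (if j \in enum J then avg (cpow (coin R s) N) (u j) ((0 : V) j)
    else u j ((0 : V) j)) = \prod_j wexp s N (u j).
  by apply: eq_bigr => j _; rewrite mem_enum inE ffunE.
move=> <-; rewrite /jwalk /coins avg_cpow_bigconv -!map_comp.
congr (avg (bigconv _) _ _); apply: eq_map => j /=.
by rewrite push_cpow push_coin.
Qed.

(** The coordinates are independent, so [wexp_mgf] applies to each of them. *)
Lemma jwalk_chernoff (phi : J -> R -> R) (lam a : R) : `|lam| <= 64^-1 ->
  (forall j x, 0 <= phi j x <= x ^+ 2) ->
  avg jwalk (fun z : V => expR (lam * (\sum_j phi j (z j) - a))) 0 <=
  expR (lam * (\sum_j wexp s N (phi j) - a) + 128 * 128 * 2 * #|J|%:R * lam ^+ 2).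
Proof.
move=> l0 hphi.
have -> : (fun z : V => expR (lam * (\sum_j phi j (z j) - a))) =
  (fun z => expR (- (lam * a)) * \prod_j expR (lam * phi j (z j))).
  by apply/funext => z; rewrite -expR_sum -expRD mulrBr mulr_sumr addrC.
rewrite avgZ (jwalk_product (fun j x => expR (lam * phi j x))).
apply: (@le_trans _ _ (expR (- (lam * a)) *
   \prod_j expR (lam * wexp s N (phi j) + 128 * 128 * 2 * lam ^+ 2))).
  rewrite ler_wpM2l ?expR_ge0//; apply: ler_prod => j _; apply/andP; split.
    rewrite -(wexp_cst s N 0); apply: wexp_le => x; exact: expR_ge0.
  exact: wexp_mgf.
rewrite -expR_sum -expRD ler_expR big_split /= -mulr_sumr sumr_const.
rewrite -[_ *+ #|_|]mulr_natl; lra.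
Qed.

End WalkChernoff.

(** * The auxiliary game *)

Section SumInequalities.
Variable R : realType.

Lemma cauchy_schwarz (I : finType) (x y : I -> R) :
  (\sum_i x i * y i) ^+ 2 <= (\sum_i x i ^+ 2) * (\sum_i y i ^+ 2).
Proof.
have : 0 <= \sum_i \sum_j (x i * y j - x j * y i) ^+ 2.
  by apply: sumr_ge0 => i _; apply: sumr_ge0 => j _; exact: sqr_ge0.
have -> : \sum_i \sum_j (x i * y j - x j * y i) ^+ 2 =
  2 * ((\sum_i x i ^+ 2) * (\sum_i y i ^+ 2)) - 2 * (\sum_i x i * y i) ^+ 2.
  have E1 : (\sum_i x i ^+ 2) * (\sum_i y i ^+ 2) = \sum_i \sum_j x i ^+ 2 * y j ^+ 2.
    by rewrite mulr_suml; apply: eq_bigr => i _; rewrite mulr_sumr.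
  have E2 : (\sum_i x i ^+ 2) * (\sum_i y i ^+ 2) = \sum_i \sum_j x j ^+ 2 * y i ^+ 2.
    by rewrite E1 exchange_big.
  have E3 : (\sum_i x i * y i) ^+ 2 = \sum_i \sum_j (x i * y i) * (x j * y j).
    by rewrite expr2 mulr_suml; apply: eq_bigr => i _; rewrite mulr_sumr.
  rewrite E3 [2 * (_ * _)]mulr_natl mulr2n {1}E1 E2 mulr_sumr -big_split /= -sumrB.
  apply: eq_bigr => i _; rewrite mulr_sumr -big_split /= -sumrB.
  by apply: eq_bigr => j _ /=; ring.
by lra.
Qed.

Definition norm2 (I : finType) (x : I -> R) := Num.sqrt (\sum_i x i ^+ 2).

Lemma sumsq_ge0 (I : finType) (x : I -> R) : 0 <= \sum_i x i ^+ 2.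
Proof. by apply: sumr_ge0 => i _; exact: sqr_ge0. Qed.

Lemma norm2_ge0 (I : finType) (x : I -> R) : 0 <= norm2 x.
Proof. exact: sqrtr_ge0. Qed.

Lemma norm2_sqr (I : finType) (x : I -> R) : norm2 x ^+ 2 = \sum_i x i ^+ 2.
Proof. by rewrite sqr_sqrtr// sumsq_ge0. Qed.

Lemma dot_le_norm2 (I : finType) (x y : I -> R) :
  \sum_i x i * y i <= norm2 x * norm2 y.
Proof.
apply: (le_trans (ler_norm _)).
rewrite -(@ler_pXn2r _ 2)// ?nnegrE ?mulr_ge0 ?norm2_ge0//.
by rewrite real_normK ?num_real// exprMn !norm2_sqr cauchy_schwarz.
Qed.

Definition prob_vec (I : finType) (x : I -> R) :=
  (forall i, 0 <= x i) /\ \sum_i x i = 1.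

Lemma prob_vec_le1 (I : finType) (x : I -> R) i : prob_vec x -> x i <= 1.
Proof. by move=> [x0 <-]; rewrite (bigD1 i)//= lerDl sumr_ge0. Qed.

Lemma norm2_le1 (I : finType) (x : I -> R) : prob_vec x -> norm2 x <= 1.
Proof.
move=> px; have [x0 x1] := px; rewrite -[leRHS]sqrtr1 ler_sqrt// -[leRHS]x1.
by apply: ler_sum => i _; rewrite expr2 ler_piMr// prob_vec_le1.
Qed.

(** A probability vector is shortest when uniform. *)
Lemma norm2_ge (n : nat) (x : 'I_n -> R) : prob_vec x -> 1 <= Num.sqrt n%:R * norm2 x.
Proof.
move=> [x0 x1]; have := @dot_le_norm2 _ (fun=> 1) x.
under eq_bigr do rewrite mul1r.
by rewrite x1 {1}/norm2; under eq_bigr do rewrite expr1n; rewrite sumr_const cardT size_enum_ord.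
Qed.

Lemma norm2_dist (n : nat) (x y : 'I_n -> R) : prob_vec x -> prob_vec y ->
  norm2 x - norm2 y <= Num.sqrt n%:R * \sum_i `|x i - y i|.
Proof.
move=> px py; set D := \sum_i _; set r := Num.sqrt _.
have D0 : 0 <= D by apply: sumr_ge0.
have r0 : 0 <= r by exact: sqrtr_ge0.
have x1 := norm2_ge px; have y1 := norm2_ge py; rewrite -/r in x1 y1.
have H : norm2 x ^+ 2 - norm2 y ^+ 2 <= 2 * D.
  rewrite !norm2_sqr -sumrB mulr_sumr; apply: ler_sum => i _.
  rewrite subr_sqr; apply: le_trans (ler_norm _) _; rewrite normrM mulrC.
  rewrite ler_wpM2r// ger0_norm; last by rewrite addr_ge0//; [case: px|case: py].
  by have := prob_vec_le1 i px; have := prob_vec_le1 i py; lra.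
rewrite leNgt; apply/negP => h.
have p0 : 0 <= r * D by rewrite mulr_ge0.
have nx := norm2_ge0 x; have ny := norm2_ge0 y.
have h1 : 0 < norm2 x - norm2 y by exact: le_lt_trans h.
have h2 : r * (norm2 x ^+ 2 - norm2 y ^+ 2) <= r * (2 * D) by rewrite ler_wpM2l.
have h3 : 2 * (norm2 x - norm2 y) <= r * (norm2 x ^+ 2 - norm2 y ^+ 2).
  rewrite subr_sqr mulrCA mulrC; apply: ler_wpM2l; first exact: ltW.
  by rewrite mulrDr; lra.
by move: h3 h2 h; rewrite mulrCA; lra.
Qed.

End SumInequalities.

Section AuxiliaryGame.
Variables (R : realType) (p q : nat).
Implicit Types (x g : 'I_p -> R) (y h : 'I_q -> R).

(** The payoff of Gordon's auxiliary process. *)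
Definition payoff g h x y : R :=
  norm2 x * (\sum_j h j * y j) + norm2 y * (\sum_i g i * x i).

(** Among the nonnegative vectors of a given length, those in the direction of the
    positive part of [h] maximise [h . y]. *)
Definition response h : 'I_q -> R := fun j => pos (h j) / \sum_k pos (h k).

Lemma pos_ge0 (r : R) : 0 <= pos r.
Proof. by rewrite /pos le_max lexx orbT. Qed.

Lemma pos_ge (r : R) : r <= pos r.
Proof. by rewrite /pos le_max lexx. Qed.

Variables (g : 'I_p -> R) (h : 'I_q -> R).
Let A := \sum_j pos (h j) ^+ 2.
Let A1 := \sum_j pos (h j - 1) ^+ 2.
Let B := \sum_i pos (- g i) ^+ 2.
Let B1 := \sum_i pos (- g i - 1) ^+ 2.
Let S := \sum_j pos (h j).
Let a := Num.sqrt A.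
Let b := Num.sqrt B.
Let b1 := Num.sqrt B1.

(** From [t^2 - (t - 1)_+^2 <= 2 t] for [t >= 0]. *)
Lemma positive_mass_ge : A - A1 <= 2 * S.
Proof.
rewrite /A /A1 /S -sumrB mulr_sumr; apply: ler_sum => j _.
have := pos_ge0 (h j); rewrite !posE.
by case: (leP 0 (h j)) => h0; case: (leP 0 (h j - 1)) => h1 ?; nra.
Qed.

Lemma response_prob_vec : 0 < S -> prob_vec (response h).
Proof.
move=> S0; split=> [j|]; first by rewrite /response divr_ge0 ?pos_ge0// ltW.
by rewrite /response -mulr_suml divff// gt_eqF.
Qed.

Lemma payoff_response x : 0 < S ->
  payoff g h x (response h) = a / S * (norm2 x * a + \sum_i g i * x i).
Proof.
move=> S0; have A0 : 0 <= A by exact: sumsq_ge0.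
have aa : a * a = A by rewrite -expr2 sqr_sqrtr.
have -> : payoff g h x (response h) = norm2 x * (A / S) + a / S * \sum_i g i * x i.
  rewrite /payoff; congr (_ * _ + _ * _).
    rewrite /A mulr_suml; apply: eq_bigr => j _; rewrite /response -/S mulrA; congr (_ / _).
    by rewrite posE; case: (leP 0 (h j)) => _; rewrite ?expr2 ?mulr0.
  rewrite /norm2 /response -/S; under eq_bigr do rewrite exprMn.
  rewrite -mulr_suml -/A sqrtrM// sqrtr_sqr ger0_norm// invr_ge0 ltW//.
by rewrite -aa; ring.
Qed.

Lemma dot_ge_neg x : prob_vec x -> - (norm2 x * b) <= \sum_i g i * x i.
Proof.
move=> [x0 _]; rewrite lerNl -sumrN.
apply: (@le_trans _ _ (\sum_i x i * pos (- g i))).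
  by apply: ler_sum => i _; rewrite -mulNr mulrC ler_wpM2l// pos_ge.
exact: dot_le_norm2.
Qed.

(** The coordinates of [g] above -1 cost at most 1 in total, because [x] has total
    mass 1. *)
Lemma dot_ge_excess x : prob_vec x -> - (1 + norm2 x * b1) <= \sum_i g i * x i.
Proof.
move=> [x0 x1]; rewrite lerNl -sumrN.
apply: (@le_trans _ _ (\sum_i (x i + x i * pos (- g i - 1)))).
  apply: ler_sum => i _; have -> : - (g i * x i) = x i + x i * (- g i - 1) by ring.
  by rewrite lerD2l ler_wpM2l// pos_ge.
by rewrite big_split /= x1 lerD2l; exact: dot_le_norm2.
Qed.

Lemma a_over_S : 0 < S -> 0 < (q%:R : R) -> (Num.sqrt q%:R)^-1 <= a / S.
Proof.
move=> S0 q0; have r0 : 0 < Num.sqrt q%:R :> R by rewrite sqrtr_gt0.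
have a0 : 0 <= a by exact: sqrtr_ge0.
rewrite ler_pdivlMr// mulrC ler_pdivrMr//.
have := @dot_le_norm2 R _ (fun j => pos (h j)) (fun=> 1).
under eq_bigr do rewrite mulr1.
by rewrite -/S /norm2 -/A -/a; under [X in _ * Num.sqrt X]eq_bigr do rewrite expr1n;
  rewrite sumr_const cardT size_enum_ord.
Qed.

(** The payoff is at least [a / S * (a - b) * norm2 x], so the uniform [x] is the
    worst one. *)
Lemma payoff_ge_favourable x : prob_vec x -> 0 < S -> 0 < (q%:R : R) -> 0 < (p%:R : R) ->
  b <= a -> (a - b) / (Num.sqrt p%:R * Num.sqrt q%:R) <= payoff g h x (response h).
Proof.
move=> px S0 q0 p0 ba; rewrite payoff_response// invfM mulrA mulrC.
have rp : 0 < Num.sqrt p%:R :> R by rewrite sqrtr_gt0.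
apply: ler_pM; rewrite ?invr_ge0 ?sqrtr_ge0//.
- by rewrite divr_ge0 ?sqrtr_ge0// subr_ge0.
- exact: a_over_S.
have := dot_ge_neg px; have := norm2_ge px => h1 h2.
have h3 : (a - b) / Num.sqrt p%:R <= (a - b) * norm2 x.
  by rewrite ler_wpM2l ?subr_ge0// -div1r ler_pdivrMr// mulrC.
lra.
Qed.

(** When [a < b], long strategies [x] are ruled out by the excess bound and short
    ones by the plain bound; the worst case is at their crossing. *)
Lemma payoff_ge_unfavourable x : prob_vec x -> 0 < S -> b1 <= a -> a < b ->
  - (a / S * ((b - a) / (b - b1))) <= payoff g h x (response h).
Proof.
move=> px S0 b1a ab; rewrite payoff_response// -mulrN ler_wpM2l//.
  by rewrite divr_ge0 ?sqrtr_ge0// ltW.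
have d0 : 0 < b - b1 by lra.
rewrite -mulNr ler_pdivrMr//.
have h1 := dot_ge_neg px; have h2 := dot_ge_excess px.
have nx := norm2_ge0 x.
set w := \sum_i _ in h1 h2 *; set r := norm2 x in h1 h2 nx *.
have k1 : 0 <= (a - b1) * (w + r * b) by rewrite mulr_ge0//; lra.
have k2 : 0 <= (b - a) * (w + 1 + r * b1) by rewrite mulr_ge0//; lra.
lra.
Qed.

End AuxiliaryGame.

Section GapArithmetic.
Variable R : realFieldType.
Implicit Types a b c r s : R.

(** Where a difference of squares is [(r' - r) (r' + r)] up to [s r], dividing by
    [a + b], which is comparable to both [r' + r] and [r], gives the difference. *)
Lemma gap_ge r r' a b s : 0 < r -> r <= r' -> 0 <= s ->
  63 / 100 * r' <= a -> a <= 39 / 50 * r' -> 63 / 100 * r <= b -> b <= 39 / 50 * r ->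
  r' ^+ 2 / 2 - s * r <= a ^+ 2 -> b ^+ 2 <= r ^+ 2 / 2 + s * r ->
  3 / 5 * (r' - r) - 8 / 5 * s <= a - b.
Proof.
move=> r0 rr s0 a1 a2 b1 b2 ca cb; rewrite leNgt; apply/negP => H.
have [ab ab' ab0] : [/\ a + b <= 39 / 50 * (r' + r), 63 / 50 * r <= a + b & 0 < a + b].
  by split; lra.
have k1 : (a - b) * (a + b) < (3 / 5 * (r' - r) - 8 / 5 * s) * (a + b) by rewrite ltr_pM2r.
have k2 : (r' - r) * (a + b) <= (r' - r) * (39 / 50 * (r' + r)) by rewrite ler_wpM2l ?subr_ge0.
have k3 : s * (63 / 50 * r) <= s * (a + b) by rewrite ler_wpM2l.
have k4 : 0 <= s * r by rewrite mulr_ge0// ltW.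
have k5 : 0 <= r' ^+ 2 - r ^+ 2 by rewrite subr_ge0 lerXn2r ?nnegrE//; lra.
move: k1 k2 k3 k4 k5 ca cb; clear; lra.
Qed.

Lemma gap_le r r' a b s : 0 < r -> r <= r' -> 0 <= s ->
  63 / 100 * r <= a -> 63 / 100 * r' <= b ->
  r ^+ 2 / 2 - s * r <= a ^+ 2 -> b ^+ 2 <= r' ^+ 2 / 2 + s * r ->
  b - a <= 4 / 5 * (r' - r) + 8 / 5 * s.
Proof.
move=> r0 rr s0 a1 b1 ca cb; rewrite leNgt; apply/negP => H.
have [ab ab' ab0] : [/\ 63 / 100 * (r' + r) <= a + b, 63 / 50 * r <= a + b & 0 < a + b].
  by split; lra.
have k1 : (4 / 5 * (r' - r) + 8 / 5 * s) * (a + b) < (b - a) * (a + b) by rewrite ltr_pM2r.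
have k2 : (r' - r) * (63 / 100 * (r' + r)) <= (r' - r) * (a + b) by rewrite ler_wpM2l ?subr_ge0.
have k3 : s * (63 / 50 * r) <= s * (a + b) by rewrite ler_wpM2l.
have k4 : 0 <= s * r by rewrite mulr_ge0// ltW.
have k5 : 0 <= r' ^+ 2 - r ^+ 2 by rewrite subr_ge0 lerXn2r ?nnegrE//; lra.
move: k1 k2 k3 k4 k5 ca cb; clear; lra.
Qed.

Lemma crossing_le r a b b1 c : 0 < r -> a < b -> r <= 25 / 6 * (b - b1) ->
  0 <= c -> c * r <= 156 / 25 ->
  c * ((b - a) / (b - b1)) * r ^+ 2 <= 26 * (b - a).
Proof.
move=> r0 ab rb c0 cr; have d0 : 0 < b - b1 by lra.
have -> : c * ((b - a) / (b - b1)) * r ^+ 2 = (c * r) * ((b - a) / (b - b1) * r) by ring.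
have -> : 26 * (b - a) = 156 / 25 * (25 / 6 * (b - a)) by field.
apply: ler_pM => //; first by rewrite mulr_ge0// ltW.
  by rewrite mulr_ge0 ?(ltW r0)// divr_ge0 ?(ltW d0)// subr_ge0 ltW.
rewrite mulrAC ler_pdivrMr// [leRHS]mulrAC [leRHS]mulrC.
by rewrite ler_wpM2l// subr_ge0 ltW.
Qed.

Lemma favourable_ge r r' a b s : 0 < r -> r <= r' -> r' <= 71 / 50 * r -> 0 <= s ->
  3 / 5 * (r' - r) - 8 / 5 * s <= a - b ->
  (4^-1 * (r' - r) - 42 * s) * (r * r') <= (a - b) * r ^+ 2.
Proof.
move=> r0 rr r7 s0 gap.
have k1 : (r' - r) * (r * r') <= (r' - r) * (71 / 50 * r ^+ 2).
  by rewrite ler_wpM2l ?subr_ge0// expr2 mulrCA ler_wpM2l// ltW.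
have k2 : s * r ^+ 2 <= s * (r * r') by rewrite ler_wpM2l// expr2 ler_wpM2l// ltW.
have k3 : (3 / 5 * (r' - r) - 8 / 5 * s) * r ^+ 2 <= (a - b) * r ^+ 2.
  by rewrite ler_wpM2r ?sqr_ge0.
have k4 : 0 <= (r' - r) * r ^+ 2 by rewrite mulr_ge0 ?sqr_ge0 ?subr_ge0.
have k5 : 0 <= s * r ^+ 2 by rewrite mulr_ge0 ?sqr_ge0.
move: k1 k2 k3 k4 k5; clear; lra.
Qed.

End GapArithmetic.

Section GoodEvent.
Variables (R : realType) (n m : nat).
Hypotheses (n2 : (2 <= n)%N) (nm : (n <= m)%N) (mn : (m <= 2 * n)%N).

Let rn : R := Num.sqrt n%:R.
Let rm : R := Num.sqrt m%:R.
Let n0 : 0 < (n%:R : R). Proof. by rewrite ltr0n (leq_trans _ n2). Qed.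
Let m0 : 0 < (m%:R : R). Proof. by rewrite ltr0n (leq_trans _ (leq_trans n2 nm)). Qed.
Let rn0 : 0 < rn. Proof. by rewrite sqrtr_gt0. Qed.
Let rm0 : 0 < rm. Proof. by rewrite sqrtr_gt0. Qed.
Let rn2 : rn ^+ 2 = n%:R. Proof. by rewrite sqr_sqrtr// ltW. Qed.
Let rm2 : rm ^+ 2 = m%:R. Proof. by rewrite sqr_sqrtr// ltW. Qed.
Let nmR : n%:R <= m%:R :> R. Proof. by rewrite ler_nat. Qed.
Let mnR : m%:R <= 2 * n%:R :> R. Proof. by rewrite -natrM ler_nat. Qed.
Let rnm : rn <= rm. Proof. by rewrite ler_sqrt. Qed.

Lemma sqrt_between (x c r : R) : 0 <= c -> 0 <= r ->
  ((c * r) ^+ 2 <= x -> c * r <= Num.sqrt x) /\ (x <= (c * r) ^+ 2 -> Num.sqrt x <= c * r).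
Proof.
move=> c0 r0; have cr : 0 <= c * r by rewrite mulr_ge0.
by split=> h; rewrite -[c * r]ger0_norm// -sqrtr_sqr ler_wsqrtr.
Qed.

(* 71 / 50 exceeds sqrt 2. *)
Let rm_le : rm <= 71 / 50 * rn.
Proof.
have c0 : 0 <= 71 / 50 :> R by lra.
have [_] := @sqrt_between m%:R (71 / 50) rn c0 (ltW rn0); apply.
rewrite exprMn rn2; have := n0; have := mnR; lra.
Qed.

(** The first two bounds, with precision [s * sqrt n], decide the value of the
    game; the other ones, with precision [n / 20], only enter through constants.
    For standard Gaussian coordinates the means are 1/2 for [pos _ ^+ 2] and at
    most 3/32 for [pos (_ - 1) ^+ 2]. *)
Definition concentrated (p q : nat) (g : 'I_p -> R) (h : 'I_q -> R) (s : R) :=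
  [/\ \sum_i pos (- g i) ^+ 2 <= p%:R / 2 + s * rn,
      q%:R / 2 - s * rn <= \sum_j pos (h j) ^+ 2,
      p%:R / 2 - n%:R / 20 <= \sum_i pos (- g i) ^+ 2 &
      \sum_j pos (h j) ^+ 2 <= q%:R / 2 + n%:R / 20] /\
  [/\ \sum_i pos (- g i - 1) ^+ 2 <= 3 / 32 * p%:R + n%:R / 20,
      \sum_j pos (h j - 1) ^+ 2 <= 3 / 32 * q%:R + n%:R / 20,
      \sum_i pos (g i) ^+ 2 <= p%:R / 2 + n%:R / 20 &
      \sum_j pos (- h j) ^+ 2 <= q%:R / 2 + n%:R / 20].

Section Bounds.
Variables (p q : nat) (g : 'I_p -> R) (h : 'I_q -> R) (s : R).
Hypotheses (s0 : 0 <= s) (s1 : s <= rn / 20).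
Hypotheses (np : n%:R <= p%:R :> R) (nq : n%:R <= q%:R :> R).
Hypothesis conc : concentrated g h s.

Let a := Num.sqrt (\sum_j pos (h j) ^+ 2).
Let b := Num.sqrt (\sum_i pos (- g i) ^+ 2).
Let b1 := Num.sqrt (\sum_i pos (- g i - 1) ^+ 2).
Let S := \sum_j pos (h j).
Let rp : R := Num.sqrt p%:R.
Let rq : R := Num.sqrt q%:R.

Lemma concentrated_bounds :
  [/\ 63 / 100 * rq <= a, a <= 39 / 50 * rq, 63 / 100 * rp <= b & b <= 39 / 50 * rp] /\
  [/\ b1 <= 39 / 100 * rp, 0 < S, a / S * rq <= 156 / 25 &
    (forall i, `|g i| <= p%:R) /\ (forall j, `|h j| <= q%:R)].
Proof.
have low (z t c : R) : 0 <= t -> z <= t -> t / 2 - z / 20 <= c -> (63 / 100) ^+ 2 * t <= c.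
  by move=> ? ? ?; lra.
have upp (z t c : R) : 0 <= t -> z <= t -> c <= t / 2 + z / 20 -> c <= (39 / 50) ^+ 2 * t.
  by move=> ? ? ?; lra.
have exc (z t c : R) : 0 <= t -> z <= t -> c <= 3 / 32 * t + z / 20 -> c <= (39 / 100) ^+ 2 * t.
  by move=> ? ? ?; lra.
have sm (z t u c S' : R) : 0 <= t -> z <= t -> u <= z / 20 -> t / 2 - u <= c ->
    c - (3 / 32 * t + z / 20) <= 2 * S' -> t / 8 <= S'.
  by move=> ? ? ? ? ?; lra.
have sn : s * rn <= n%:R / 20.
  by have := ler_wpM2r (ltW rn0) s1; rewrite -rn2 mulrAC -expr2.
have fin (x y y' t z : R) : 0 <= t -> x <= y + y' -> z <= t -> 2 * t <= t ^+ 2 ->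
    y <= t / 2 + z / 20 -> y' <= t / 2 + z / 20 -> x <= t ^+ 2.
  by move=> ? ? ? ? ? ?; lra.
have p0 : 0 <= p%:R :> R by []. have q0' : 0 <= q%:R :> R by [].
have q0 : 0 < q%:R :> R by exact: lt_le_trans n0 nq.
have rp0 : 0 <= rp by exact: sqrtr_ge0. have rq0 : 0 < rq by rewrite sqrtr_gt0.
have rp2 : rp ^+ 2 = p%:R by rewrite sqr_sqrtr.
have rq2 : rq ^+ 2 = q%:R by rewrite sqr_sqrtr.
case: conc => -[c1 c2 c3 c4] [c5 c6 c7 c8].
have c1' : \sum_i pos (- g i) ^+ 2 <= p%:R / 2 + n%:R / 20 by apply: le_trans c1 _; rewrite lerD2l.
have c2' : q%:R / 2 - n%:R / 20 <= \sum_j pos (h j) ^+ 2.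
  by apply: le_trans c2; rewrite lerD2l lerN2.
have k63 : 0 <= 63 / 100 :> R by rewrite divr_ge0.
have k39 : 0 <= 39 / 50 :> R by rewrite divr_ge0.
have k39' : 0 <= 39 / 100 :> R by rewrite divr_ge0.
have ha : 63 / 100 * rq <= a.
  apply: (proj1 (sqrt_between _ k63 (ltW rq0))); rewrite exprMn rq2.
  exact: low q0' nq c2'.
have ha' : a <= 39 / 50 * rq.
  apply: (proj2 (sqrt_between _ k39 (ltW rq0))); rewrite exprMn rq2.
  exact: upp q0' nq c4.
have S0 : q%:R / 8 <= S.
  apply: (sm _ _ _ _ _ q0' nq sn c2); apply: le_trans (positive_mass_ge h).
  by rewrite lerD2l lerN2.
have S1 : 0 < S by apply: lt_le_trans S0; rewrite divr_gt0.
split; split=> //.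
- apply: (proj1 (sqrt_between _ k63 rp0)); rewrite exprMn rp2.
  exact: low p0 np c3.
- apply: (proj2 (sqrt_between _ k39 rp0)); rewrite exprMn rp2.
  exact: upp p0 np c1'.
- apply: (proj2 (sqrt_between _ k39' rp0)); rewrite exprMn rp2.
  exact: exc p0 np c5.
- rewrite mulrAC ler_pdivrMr//; apply: (@le_trans _ _ (39 / 50 * rq * rq)).
    by rewrite ler_wpM2r// ltW.
  rewrite -mulrA -expr2 rq2; apply: (@le_trans _ _ (156 / 25 * (q%:R / 8))).
    by rewrite [leRHS](_ : _ = 39 / 50 * q%:R)//; field.
  by rewrite ler_wpM2l// divr_ge0.
have q2 : 2 <= q%:R :> R by apply: le_trans nq; rewrite ler_nat.
have p2 : 2 <= p%:R :> R by apply: le_trans np; rewrite ler_nat.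
split=> i.
- rewrite -(@ler_pXn2r _ 2)// ?nnegrE// real_normK ?num_real//.
  have : g i ^+ 2 <= \sum_i pos (g i) ^+ 2 + \sum_i pos (- g i) ^+ 2.
    rewrite -big_split /= (bigD1 i)//= pos_sqrD lerDl sumr_ge0// => k _.
    by rewrite pos_sqrD sqr_ge0.
  have h2 : 2 * p%:R <= p%:R ^+ 2 :> R by rewrite expr2 ler_wpM2r.
  by move=> h1; exact: (fin _ _ _ _ _ p0 h1 np h2 c7 c1').
- rewrite -(@ler_pXn2r _ 2)// ?nnegrE// real_normK ?num_real//.
  have : h i ^+ 2 <= \sum_i pos (h i) ^+ 2 + \sum_i pos (- h i) ^+ 2.
    rewrite -big_split /= (bigD1 i)//= pos_sqrD lerDl sumr_ge0// => k _.
    by rewrite pos_sqrD sqr_ge0.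
  have h2 : 2 * q%:R <= q%:R ^+ 2 :> R by rewrite expr2 ler_wpM2r.
  by move=> h1; exact: (fin _ _ _ _ _ q0' h1 nq h2 c4 c8).
Qed.

End Bounds.

(** Here [h] has the larger dimension [m], so [a] exceeds [b] by about
    [(sqrt m - sqrt n) / sqrt 2]; when the deviations [s] reverse this order, the
    loss is of the order of [s] only. *)
Lemma payoff_ge_lower (g : 'I_n -> R) (h : 'I_m -> R) s x : 0 <= s -> s <= rn / 20 ->
  concentrated g h s -> prob_vec x ->
  4^-1 * ((rm - rn) / n%:R) - 42 * s / n%:R <= payoff g h x (response h).
Proof.
have rb (r r' a b b1 : R) : 0 < r -> r <= r' -> 63 / 100 * r' <= a -> 63 / 100 * r <= b ->
    b1 <= 39 / 100 * r -> b1 <= a /\ r <= 25 / 6 * (b - b1).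
  by move=> ? ? ? ? ?; split; lra.
have fin (t u w : R) : 0 <= t -> 0 <= u -> 3 / 5 * t - 8 / 5 * u <= w ->
    4^-1 * t - 42 * u <= 26 * w.
  by move=> ? ? ?; lra.
move=> s0 s1 C px.
have [[a1 a2 b2 b3] [b4 S0 aS _]] := concentrated_bounds s1 (lexx _) nmR C.
case: C => -[c1 c2 _ _] _.
have hf := @payoff_ge_favourable _ _ _ g h x px S0 m0 n0.
have hu := @payoff_ge_unfavourable _ _ _ g h x px S0.
move: a1 a2 b2 b3 b4 aS hf hu; rewrite -/rn -/rm.
set a := Num.sqrt (\sum_j pos (h j) ^+ 2); set b := Num.sqrt (\sum_i pos (- g i) ^+ 2).
set b1 := Num.sqrt _; set S := \sum_j pos (h j) in S0 *.
move=> a1 a2 b2 b3 b4 aS hf hu.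
have aa : a ^+ 2 = \sum_j pos (h j) ^+ 2 by rewrite sqr_sqrtr// sumsq_ge0.
have bb : b ^+ 2 = \sum_i pos (- g i) ^+ 2 by rewrite sqr_sqrtr// sumsq_ge0.
have gap : 3 / 5 * (rm - rn) - 8 / 5 * s <= a - b.
  by apply: gap_ge => //; rewrite ?aa ?bb ?rn2 ?rm2.
have D0 : 0 <= rm - rn by rewrite subr_ge0.
have -> : 4^-1 * ((rm - rn) / n%:R) - 42 * s / n%:R = (4^-1 * (rm - rn) - 42 * s) / n%:R by ring.
have [ba|ab] := leP b a.
  apply: le_trans (hf ba); rewrite ler_pdivrMr// mulrAC ler_pdivlMr ?mulr_gt0// -rn2.
  by apply: favourable_ge => //; exact: rm_le.
have [b1a rb1] := rb _ _ _ _ _ rn0 rnm a1 b2 b4.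
apply: le_trans (hu b1a ab); rewrite ler_pdivrMr// mulNr lerNr -rn2.
apply: (@le_trans _ _ (26 * (b - a))).
  apply: crossing_le => //; first by rewrite divr_ge0 ?sqrtr_ge0// ltW.
  by apply: le_trans aS; rewrite ler_wpM2l// divr_ge0 ?sqrtr_ge0// ltW.
by rewrite lerNr -[leRHS]mulrN opprB; exact: fin.
Qed.

(** Here [h] has the smaller dimension [n], so [b] may exceed [a] by about
    [(sqrt m - sqrt n) / sqrt 2], and the unfavourable bound is the typical one. *)
Lemma payoff_ge_upper (g : 'I_m -> R) (h : 'I_n -> R) s x : 0 <= s -> s <= rn / 20 ->
  concentrated g h s -> prob_vec x ->
  - (40 * Num.sqrt 2 * ((rm - rn) / n%:R) + 42 * s / n%:R) <= payoff g h x (response h).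
Proof.
have rb (r r' a b b1 : R) : 0 < r -> r <= r' -> r' <= 71 / 50 * r -> 63 / 100 * r <= a ->
    63 / 100 * r' <= b -> b1 <= 39 / 100 * r' -> b1 <= a /\ r <= 25 / 6 * (b - b1).
  by move=> ? ? ? ? ? ?; split; lra.
have fin (t t' u w : R) : 0 <= t -> t <= t' -> 0 <= u -> w <= 4 / 5 * t + 8 / 5 * u ->
    26 * w <= 40 * t' + 42 * u.
  by move=> ? ? ? ?; lra.
move=> s0 s1 C px.
have [[a1 a2 b2 b3] [b4 S0 aS _]] := concentrated_bounds s1 nmR (lexx _) C.
case: C => -[c1 c2 _ _] _.
have hf := @payoff_ge_favourable _ _ _ g h x px S0 n0 m0.
have hu := @payoff_ge_unfavourable _ _ _ g h x px S0.
move: a1 a2 b2 b3 b4 aS hf hu; rewrite -/rn -/rm.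
set a := Num.sqrt (\sum_j pos (h j) ^+ 2); set b := Num.sqrt (\sum_i pos (- g i) ^+ 2).
set b1 := Num.sqrt _; set S := \sum_j pos (h j) in S0 *.
move=> a1 a2 b2 b3 b4 aS hf hu.
have aa : a ^+ 2 = \sum_j pos (h j) ^+ 2 by rewrite sqr_sqrtr// sumsq_ge0.
have bb : b ^+ 2 = \sum_i pos (- g i) ^+ 2 by rewrite sqr_sqrtr// sumsq_ge0.
have D0 : 0 <= rm - rn by rewrite subr_ge0.
have D1 : rm - rn <= Num.sqrt 2 * (rm - rn).
  by rewrite ler_peMl// -[leLHS]sqrtr1 ler_wsqrtr// ler1n.
have -> : - (40 * Num.sqrt 2 * ((rm - rn) / n%:R) + 42 * s / n%:R) =
  - (40 * (Num.sqrt 2 * (rm - rn)) + 42 * s) / n%:R by ring.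
have [ba|ab] := leP b a.
  apply: le_trans (hf ba); apply: (@le_trans _ _ 0).
    rewrite pmulr_lle0 ?invr_gt0// oppr_le0 addr_ge0 ?mulr_ge0//.
  by rewrite divr_ge0 ?mulr_ge0 ?subr_ge0// ltW.
have gap : b - a <= 4 / 5 * (rm - rn) + 8 / 5 * s.
  by apply: gap_le => //; rewrite ?aa ?bb ?rn2 ?rm2.
have [b1a rb1] := rb _ _ _ _ _ rn0 rnm rm_le a1 b2 b4.
apply: le_trans (hu b1a ab); rewrite ler_pdivrMr// mulNr lerN2 -rn2.
apply: le_trans (fin _ _ _ _ D0 D1 s0 gap).
by apply: crossing_le => //; rewrite divr_ge0 ?sqrtr_ge0// ltW.
Qed.

End GoodEvent.

(** * The value of a matrix game *)

Section GameValue.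
Variables (R : realType) (n m : nat).
Hypotheses (n0 : (0 < n)%N) (m0 : (0 < m)%N).
Implicit Types (M : 'M[R]_(n, m)).

Definition pay M (x : 'I_n -> R) (y : 'I_m -> R) : R := \sum_i \sum_j M i j * (x i * y j).

Lemma payE M (x : 'cV[R]_n) (y : 'cV[R]_m) :
  (x^T *m M *m y) 0 0 = pay M (fun i => x i 0) (fun j => y j 0).
Proof.
rewrite mxE /pay exchange_big; apply: eq_bigr => j _ /=.
rewrite mxE mulr_suml; apply: eq_bigr => i _; rewrite mxE; ring.
Qed.

Lemma col_prob_vec d (x : 'I_d -> R) : prob_vec x -> simplex R d (\col_i x i).
Proof.
move=> [x0 x1]; split=> [i|]; first by rewrite mxE.
by under eq_bigr do rewrite mxE.
Qed.

Lemma dirac_prob_vec (I : finType) (k : I) : prob_vec (fun i => (i == k)%:R : R).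
Proof.
split=> [i|]; first by [].
by rewrite (bigD1 k)//= eqxx big1 ?addr0// => i /negPf ->.
Qed.

Lemma sum_prob (x : 'I_n -> R) (y : 'I_m -> R) : prob_vec x -> prob_vec y ->
  \sum_i \sum_j x i * y j = 1.
Proof.
move=> [_ x1] [_ y1]; rewrite -[RHS]x1; apply: eq_bigr => i _.
by rewrite -mulr_sumr y1 mulr1.
Qed.

Lemma pay_le M M' (e : R) x y : prob_vec x -> prob_vec y ->
  (forall i j, M' i j <= M i j + e) -> pay M' x y <= pay M x y + e.
Proof.
move=> px py H.
apply: (@le_trans _ _ (\sum_i \sum_j (M i j * (x i * y j) + e * (x i * y j)))).
  apply: ler_sum => i _; apply: ler_sum => j _; rewrite -mulrDl ler_wpM2r//.
  by rewrite mulr_ge0//; [case: px|case: py].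
under eq_bigr do rewrite big_split /= -mulr_sumr.
by rewrite big_split /= -mulr_sumr (sum_prob px py) mulr1.
Qed.

Definition payset M (x : 'cV[R]_n) : set R := [set (x^T *m M *m y) 0 0 | y in simplex R m].

Lemma payset_neq0 M x : payset M x !=set0.
Proof.
exists ((x^T *m M *m \col_j ((j == Ordinal m0)%:R)) 0 0); exists (\col_j ((j == Ordinal m0)%:R)) => //.
exact/col_prob_vec/dirac_prob_vec.
Qed.

Lemma pay_abs M x y : prob_vec x -> prob_vec y -> `|pay M x y| <= \sum_i \sum_j `|M i j|.
Proof.
move=> px py; rewrite (le_trans (ler_norm_sum _ _ _))//; apply: ler_sum => i _.
rewrite (le_trans (ler_norm_sum _ _ _))//; apply: ler_sum => j _.
have [x0 y0] : 0 <= x i /\ 0 <= y j by split; [case: px|case: py].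
rewrite normrM ler_piMr// ger0_norm ?mulr_ge0//.
by rewrite mulr_ile1// prob_vec_le1.
Qed.

Lemma payset_ub M x : simplex R n x -> has_ubound (payset M x).
Proof.
move=> px; exists (\sum_i \sum_j `|M i j|) => _ [y py <-].
by rewrite payE (le_trans (ler_norm _))//; exact: pay_abs.
Qed.

Lemma rowset_neq0 M : [set sup (payset M x) | x in simplex R n] !=set0.
Proof.
exists (sup (payset M (\col_i ((i == Ordinal n0)%:R)))); exists (\col_i ((i == Ordinal n0)%:R)) => //.
exact/col_prob_vec/dirac_prob_vec.
Qed.

Lemma rowset_lb M : has_lbound [set sup (payset M x) | x in simplex R n].
Proof.
exists (- \sum_i \sum_j `|M i j|) => _ [x px <-].
have [r [y py yr]] := payset_neq0 M x.
apply: (@le_trans _ _ r).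
  rewrite -yr payE; have := pay_abs M px py; rewrite ler_norml; case/andP => + _.
  by apply: le_trans.
by apply: ub_le_sup; [exact: payset_ub|exists y].
Qed.

Lemma game_value_lt M l : game_value M < l ->
  exists2 x, prob_vec x & forall y, prob_vec y -> pay M x y < l.
Proof.
move=> /(inf_lt (rowset_neq0 M))[_ [x px <-] xl].
exists (fun i => x i 0) => // y py; apply: le_lt_trans xl.
apply: ub_le_sup; first exact: payset_ub.
exists (\col_j y j); first exact: col_prob_vec.
by rewrite payE; apply: eq_bigr => i _; apply: eq_bigr => j _; rewrite mxE.
Qed.

Lemma game_value_gt M u : u < game_value M ->
  forall x, prob_vec x -> exists2 y, prob_vec y & u < pay M x y.
Proof.
move=> uv x px; have : u < sup (payset M (\col_i x i)).
  apply: (lt_le_trans uv); apply: ge_inf; first exact: rowset_lb.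
  by exists (\col_i x i) => //; exact: col_prob_vec.
move=> /(sup_gt (payset_neq0 M _))[_ [y py <-] uy].
exists (fun j => y j 0) => //; move: uy; rewrite payE.
congr (_ < _); apply: eq_bigr => i _; apply: eq_bigr => j _; by rewrite mxE.
Qed.

Lemma game_value_lip M M' (e : R) : (forall i j, M' i j <= M i j + e) ->
  game_value M' <= game_value M + e.
Proof.
move=> H; rewrite -lerBlDr; apply: lb_le_inf; first exact: rowset_neq0.
move=> _ [x px <-]; rewrite lerBlDr; apply: (@le_trans _ _ (sup (payset M' x))).
  by apply: ge_inf; [exact: rowset_lb|exists x].
apply: ge_sup; first exact: payset_neq0.
move=> _ [y py <-]; rewrite payE (le_trans (pay_le (M := M) px py H))// lerD2r.
by rewrite -payE; apply: ub_le_sup; [exact: payset_ub|exists y].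
Qed.

Lemma pos_add_sqr (c e : R) : pos (c + e) ^+ 2 <= (pos c + e) ^+ 2.
Proof.
rewrite !posE; case: (leP 0 (c + e)) => h1; last by rewrite expr0n /= sqr_ge0.
case: (leP 0 c) => h2 //; rewrite add0r.
have ce : c + e <= e by lra.
by rewrite !expr2; exact: ler_pM.
Qed.

(** Minimax.  A near-minimiser [x] of the squared excess
    [sum_j (col_j x - u)_+ ^ 2] is nearly stationary, so the vector of excesses,
    normalised, is a strategy of the column player worth almost [u]. *)
Lemma minimax M u1 u2 : u2 < u1 ->
  (forall x, prob_vec x -> exists2 y, prob_vec y & u1 < pay M x y) ->
  exists2 y, prob_vec y & forall x, prob_vec x -> u2 <= pay M x y.
Proof.
move=> u21 H; pose u : R := (u1 + u2) / 2; pose kap : R := u1 - u.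
have kap0 : 0 < kap by rewrite /kap /u; lra.
pose col (x : 'I_n -> R) (j : 'I_m) : R := \sum_i M i j * x i.
have payc x y : pay M x y = \sum_j col x j * y j.
  rewrite /pay exchange_big; apply: eq_bigr => j _; rewrite mulr_suml.
  by apply: eq_bigr => i _; rewrite mulrA.
pose ex x j : R := pos (col x j - u); pose F x : R := \sum_j ex x j ^+ 2.
have ex0 x j : 0 <= ex x j by exact: pos_ge0.
have F0 x : 0 <= F x by exact: sumsq_ge0.
have T x : prob_vec x -> kap <= \sum_j ex x j.
  move=> px; have [y py uy] := H x px.
  have : \sum_j (u + ex x j) * y j <= u + \sum_j ex x j.
    under eq_bigr do rewrite mulrDl; rewrite big_split /= -mulr_sumr (proj2 py) mulr1 lerD2l.
    by apply: ler_sum => j _; rewrite ler_piMr// prob_vec_le1.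
  have : pay M x y <= \sum_j (u + ex x j) * y j.
    rewrite payc; apply: ler_sum => j _; rewrite ler_wpM2r//; first by case: py.
    by rewrite -lerBlDl; exact: pos_ge.
  by rewrite /kap; lra.
pose SF := [set F x | x in [set x : 'I_n -> R | prob_vec x]].
have SF0 : SF !=set0.
  exists (F (fun i => (i == Ordinal n0)%:R)); exists (fun i => (i == Ordinal n0)%:R) => //.
  exact: dirac_prob_vec.
have SFl : has_lbound SF by exists 0 => _ [x _ <-].
pose B : R := \sum_i \sum_j `|M i j|; have B0 : 0 <= B by apply: sumr_ge0 => i _; apply: sumr_ge0.
have colB x j : prob_vec x -> `|col x j| <= B.
  move=> px; have := pay_abs M px (dirac_prob_vec j).
  rewrite payc (bigD1 j)//= eqxx mulr1 big1 ?addr0// => k /negPf ->; exact: mulr0.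
pose D : R := m%:R * (2 * B) ^+ 2; have D0 : 0 <= D by rewrite mulr_ge0// sqr_ge0.
pose s : R := Num.min 1 (kap * (u - u2) / (1 + D)).
have u2u : 0 < u - u2 by rewrite /u; lra.
have s0 : 0 < s by rewrite lt_min ltr01 divr_gt0 ?mulr_gt0//; lra.
have s1 : s <= 1 by rewrite ge_min lexx.
have sD : s * (1 + D) <= kap * (u - u2).
  by rewrite -ler_pdivlMr ?ge_min ?lexx ?orbT//; lra.
have [_ [x px <-] xF] : exists2 r, SF r & r < inf SF + s ^+ 2.
  by apply: inf_adherent; [rewrite exprn_gt0|].
set t := \sum_j ex x j; have t0 : 0 < t by exact: lt_le_trans (T x px).
exists (fun j => ex x j / t).
  by split=> [j|]; [rewrite divr_ge0// ltW|rewrite -mulr_suml divff ?gt_eqF].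
have key i : u2 * t <= \sum_j M i j * ex x j.
  pose d (j : 'I_m) : R := M i j - col x j.
  pose x' (k : 'I_n) : R := (1 - s) * x k + s * (k == i)%:R.
  have px' : prob_vec x'.
    have [x0 x1] := px; split=> [k|].
      by rewrite /x' addr_ge0// mulr_ge0// ?(ltW s0)// subr_ge0.
    rewrite /x' big_split /= -!mulr_sumr x1.
    by rewrite (proj2 (dirac_prob_vec i)); ring.
  have col' j : col x' j = col x j + s * d j.
    rewrite /d /col /x'; under eq_bigr do rewrite mulrDr !(mulrCA (M _ j)).
    rewrite big_split /= -!mulr_sumr.
    have -> : \sum_k M k j * (k == i)%:R = M i j.
      by rewrite (bigD1 i)//= eqxx mulr1 big1 ?addr0// => k /negPf ->; exact: mulr0.
    by ring.
  have up : F x' <= F x + 2 * s * \sum_j ex x j * d j + s ^+ 2 * D.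
    have dB j : d j ^+ 2 <= (2 * B) ^+ 2.
      have c1 := colB x j px; have c2 := colB _ j (dirac_prob_vec i).
      have E : col (fun k => (k == i)%:R) j = M i j.
        by rewrite /col (bigD1 i)//= eqxx mulr1 big1 ?addr0// => k /negPf ->; exact: mulr0.
      rewrite E in c2; rewrite -[d j ^+ 2]real_normK ?num_real//.
      rewrite lerXn2r ?nnegrE ?mulr_ge0//.
      rewrite /d (le_trans (ler_normB _ _))//; lra.
    have -> : D = \sum_(j < m) (2 * B) ^+ 2 by rewrite sumr_const cardT size_enum_ord -[RHS]mulr_natl.
    set b2 := (2 * B) ^+ 2 in dB *; rewrite /F !mulr_sumr -!big_split /=; apply: ler_sum => j _.
    have dj := dB j.
    have p1 : ex x' j ^+ 2 <= (ex x j + s * d j) ^+ 2 + (1 - 1).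
      by rewrite subrr addr0 /ex col' (addrAC _ (s * d j)); exact: pos_add_sqr.
    have s2 : s ^+ 2 * d j ^+ 2 <= s ^+ 2 * b2 by rewrite ler_wpM2l// sqr_ge0.
    have E : (ex x j + s * d j) ^+ 2 = ex x j ^+ 2 + 2 * s * (ex x j * d j) + s ^+ 2 * d j ^+ 2 by ring.
    by rewrite E in p1; lra.
  have lo : inf SF <= F x' by apply: ge_inf => //; exists x'.
  have k1 : - (s ^+ 2 * (1 + D)) <= 2 * s * \sum_j ex x j * d j by lra.
  have k2 : - (s * (1 + D)) <= 2 * \sum_j ex x j * d j.
    by rewrite -(ler_pM2l s0) mulrN; lra.
  have E : \sum_j M i j * ex x j = \sum_j ex x j * d j + \sum_j col x j * ex x j.
    by rewrite -big_split; apply: eq_bigr => j _ /=; rewrite /d; ring.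
  have k3 : u * t <= \sum_j col x j * ex x j.
    rewrite /t mulr_sumr; apply: ler_sum => j _; rewrite /ex posE.
    by case: (leP 0 (col x j - u)) => h; [rewrite ler_wpM2r//; lra|rewrite !mulr0].
  have k4 : kap * (u - u2) <= t * (u - u2) by rewrite ler_wpM2r ?T// ltW.
  have k5 : 0 <= t * (u - u2) by rewrite mulr_ge0// ltW.
  rewrite E; move: k2 k3 k4 k5 sD; clear; lra.
move=> x' [x'0 x'1]; rewrite /pay.
apply: (@le_trans _ _ (\sum_i u2 * x' i)); first by rewrite -mulr_sumr x'1 mulr1.
apply: ler_sum => i _.
have -> : \sum_j M i j * (x' i * (ex x j / t)) = ((\sum_j M i j * ex x j) / t) * x' i.
  by rewrite !mulr_suml; apply: eq_bigr => j _; ring.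
by rewrite ler_wpM2r// ler_pdivlMr.
Qed.

End GameValue.

(** Sup-norm Lipschitz functions of finitely many random variables are
    measurable: their strict superlevel sets are countable unions of rational
    boxes. *)
Lemma measurable_lipschitz (R : realType) (d : measure_display) (T : measurableType d)
    (P : probability T R) (I : finType) (X : I -> {RV P >-> R}) (F : {ffun I -> R} -> R) :
  (forall (z z' : {ffun I -> R}) (e : R), (forall i, `|z i - z' i| <= e) -> F z <= F z' + e) ->
  measurable_fun setT (fun w => F [ffun i => X i w]).
Proof.
move=> L; apply: (measurability _ (RGenOInfty.measurableE R)) => //.
move=> /= _ [_ [x ->] <-]; rewrite setTI.
pose ek (k : nat) : R := k.+1%:R^-1.
pose rq (Q : {ffun I -> rat}) : {ffun I -> R} := [ffun i => ratr (Q i)].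
pose box (Qk : {ffun I -> rat} * nat) : set T :=
  if x < F (rq Qk.1) - ek Qk.2
  then [set w | forall i, [set` `[rq Qk.1 i - ek Qk.2, rq Qk.1 i + ek Qk.2] ] (X i w)] else set0.
have -> : (fun w => F [ffun i => X i w]) @^-1` [set` `]x, +oo[ ] = \bigcup_Qk box Qk.
  apply/seteqP; split => w /=; rewrite ?in_itv/= ?andbT.
    move=> xF.
    have [k kk] : exists k : nat, 2 * ek k < F [ffun i => X i w] - x.
      pose g := F [ffun i => X i w] - x; have g0 : 0 < g by rewrite subr_gt0.
      exists (Num.truncn (2 / g)); rewrite -/g /ek ltr_pdivrMr// -ltr_pdivrMl// mulrC.
      exact: truncnS_gt.
    have ek0 : 0 < ek k by rewrite invr_gt0.
    have Q i : exists q : rat, X i w - ek k < ratr q < X i w + ek k.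
      have [|q] := @rat_in_itvoo R (X i w - ek k) (X i w + ek k); first by lra.
      by rewrite in_itv /= => qi; exists q.
    pose Q0 : {ffun I -> rat} := [ffun i => xchoose (Q i)].
    have HQ i : `|[ffun i => X i w] i - rq Q0 i| <= ek k.
      by rewrite !ffunE; have := xchooseP (Q i); rewrite ler_norml; lra.
    exists (Q0, k) => //; rewrite /box /= ifT.
      by move=> i /=; have := HQ i; rewrite !ffunE in_itv /= ler_norml; lra.
    by have := L _ _ _ HQ; lra.
  move=> [[Q k] _]; rewrite /box /=; case: ifP => // xF H.
  have := L (rq Q) [ffun i => X i w] (ek k); suff HQ i : `|rq Q i - [ffun i => X i w] i| <= ek k.
    by move=> /(_ HQ); lra.
  by have := H i; rewrite !ffunE /= in_itv /= ler_norml; lra.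
apply: countable_bigcupT_measurable => // Qk; rewrite /box; case: ifP => // _.
apply: (@measurable_box _ _ _ P I X
  (fun i => [set` `[rq Qk.1 i - ek Qk.2, rq Qk.1 i + ek Qk.2] ])) => i.
exact: measurable_itv.
Qed.

(** * From the random game to the auxiliary game *)

Section Nets.
Variable R : realType.

(** Indices with total mass at most 1 are completed at coordinate 0 and the other
    ones are sent to a vertex, so that every index is a point of the simplex. *)
Definition net_point (d N : nat) (u : {ffun 'I_d.+1 -> 'I_N.+2}) (i : 'I_d.+1) : R :=
  if (\sum_k (u k : nat) <= N.+1)%N
  then (u i)%:R / N.+1%:R + (i == ord0)%:R * (1 - (\sum_k (u k : nat))%N%:R / N.+1%:R)
  else (i == ord0)%:R.

Lemma net_point_prob_vec d N (u : {ffun 'I_d.+1 -> 'I_N.+2}) : prob_vec (net_point u).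
Proof.
have N0 : 0 < N.+1%:R :> R by [].
have [h|/negPf h] := boolP (\sum_k (u k : nat) <= N.+1)%N; last first.
  have -> : net_point u = (fun i => (i == ord0)%:R).
    by apply/funext => i; rewrite /net_point h.
  exact: dirac_prob_vec.
have E i : net_point u i = (u i)%:R / N.+1%:R +
    (i == ord0)%:R * (1 - (\sum_k (u k : nat))%N%:R / N.+1%:R) by rewrite /net_point h.
split=> [i|].
  by rewrite E addr_ge0 ?divr_ge0// mulr_ge0// subr_ge0 ler_pdivrMr// mul1r ler_nat.
under eq_bigr do rewrite E.
rewrite big_split /= -!mulr_suml (proj2 (dirac_prob_vec R (ord0 : 'I_d.+1))) mul1r.
by rewrite -natr_sum addrC subrK.
Qed.

(** Every coordinate is rounded down to a multiple of the mesh; the mass lost in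
    this way goes to coordinate 0. *)
Lemma simplex_net (d : nat) (e : R) : 0 < e ->
  exists N : nat, forall x : 'I_d.+1 -> R, prob_vec x ->
  exists u : {ffun 'I_d.+1 -> 'I_N.+2}, \sum_i `|x i - net_point u i| <= e.
Proof.
move=> e0; exists (Num.truncn (2 * d.+1%:R / e)) => x px; set N := Num.truncn _.
have [x0 x1] := px; have N0 : 0 < N.+1%:R :> R by [].
have Ne : 2 * d.+1%:R / N.+1%:R <= e.
  have := ltW (truncnS_gt (2 * d.+1%:R / e)); rewrite -/N !ler_pdivrMr//.
  by rewrite (mulrC e).
pose k i := Num.truncn (N.+1%:R * x i).
have k1 i : (k i)%:R <= N.+1%:R * x i by rewrite truncn_le mulr_ge0.
have k2 i : N.+1%:R * x i < (k i)%:R + 1 by rewrite natr1; exact: truncnS_gt.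
have kN i : (k i < N.+2)%N.
  rewrite ltnS -(ler_nat R) (le_trans (k1 i))// ler_piMr//; exact: prob_vec_le1.
exists [ffun i => Ordinal (kN i)].
have sk : \sum_i ([ffun i => Ordinal (kN i)] i : nat) = \sum_i k i.
  by apply: eq_bigr => i _; rewrite ffunE.
have NE : N.+1%:R = \sum_i N.+1%:R * x i :> R by rewrite -mulr_sumr x1 mulr1.
have skN : (\sum_i k i)%N%:R <= N.+1%:R :> R.
  by rewrite natr_sum [leRHS]NE; apply: ler_sum => i _; exact: k1.
have skN' : N.+1%:R - (\sum_i k i)%N%:R <= d.+1%:R :> R.
  rewrite natr_sum [X in X - _]NE -sumrB.
  apply: (@le_trans _ _ (\sum_(i < d.+1) 1)); last by rewrite sumr_const cardT size_enum_ord.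
  by apply: ler_sum => i _; have := k2 i; lra.
apply: le_trans Ne; pose r : R := 1 - (\sum_i k i)%N%:R / N.+1%:R.
have Ei i : net_point [ffun i => Ordinal (kN i)] i = (k i)%:R / N.+1%:R + (i == ord0)%:R * r.
  by rewrite /net_point sk -(ler_nat R) skN ffunE.
under eq_bigr do rewrite Ei.
have r0 : 0 <= r by rewrite subr_ge0 ler_pdivrMr// mul1r.
have rd : r <= d.+1%:R / N.+1%:R.
  have -> : r = (N.+1%:R - (\sum_i k i)%N%:R) / N.+1%:R by rewrite mulrBl divff ?gt_eqF.
  by rewrite ler_wpM2r// invr_ge0 ltW.
apply: (@le_trans _ _ (\sum_(i < d.+1) (N.+1%:R^-1 + (i == ord0)%:R * r))).
  apply: ler_sum => i _; rewrite opprD addrA.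
  apply: le_trans (ler_normB _ _) _; apply: lerD; last by rewrite ger0_norm// mulr_ge0.
  have -> : x i - (k i)%:R / N.+1%:R = (N.+1%:R * x i - (k i)%:R) / N.+1%:R.
    by rewrite mulrBl mulrAC divff ?gt_eqF// mul1r.
  rewrite normrM (ger0_norm (x := _^-1)) ?invr_ge0// ger0_norm ?subr_ge0//.
  by rewrite ler_piMl ?invr_ge0//; have := k2 i; lra.
rewrite big_split /= sumr_const cardT size_enum_ord -mulr_suml.
rewrite (proj2 (dirac_prob_vec R (ord0 : 'I_d.+1))) mul1r.
rewrite -[N.+1%:R^-1 *+ _]mulr_natl -[2 * _ / _]mulrA [2 * _]mulr_natl mulr2n.
exact: lerD.
Qed.

End Nets.

(** By symmetry, a walk along [v] ends at a nonpositive multiple of [v] with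
    probability at least 1/2. *)
Lemma walk_half (R : realType) (V : lmodType R) (f : V -> R) (v z : V) (s : R) N :
  (forall y, 0 <= f y) -> (forall r : R, r <= 0 -> 1 <= f (z + r *: v)) ->
  2^-1 <= avg (cpow (coin R (s *: v)) N) f z.
Proof.
move=> f0 f1; have -> : cpow (coin R (s *: v)) N = push (ray v : {additive _ -> _}) (cpow (coin R s) N).
  by rewrite push_cpow push_coin.
rewrite avg_push; set phi := fun r : R => f (z + r *: v).
have sym : avg (cpow (coin R s) N) (fun r => phi (- r)) 0 = avg (cpow (coin R s) N) phi 0.
  by rewrite walk_opp oppr0.
have : 1 <= avg (cpow (coin R s) N) (fun r => phi r + phi (- r)) 0.
  rewrite -[leLHS](wexp_cst s N); apply: avg_le => [|r]; first exact: subprob_walk.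
  have [r0|r0] := leP r 0; first by rewrite -[leLHS]addr0 lerD ?f1 ?f0.
  by rewrite addrC -[leLHS]addr0 lerD ?f1 ?f0// oppr_le0 ltW.
by rewrite avgD sym /phi /ray; lra.
Qed.

Section GordonGame.
Variables (R : realType) (d : measure_display) (T : measurableType d)
  (P : probability T R) (I : finType) (X : I -> {RV P >-> R}).
Hypothesis Xind : mutually_independent X.
Hypothesis Xstd : forall i, standard_normal (X i).
Variables (p q : nat) (al : I -> 'I_p.+1) (be : I -> 'I_q.+1) (sg : R).
Hypothesis sg2 : sg * sg = 1.
Hypothesis index_sum : forall F : 'I_p.+1 -> 'I_q.+1 -> R,
  \sum_e F (al e) (be e) = \sum_i \sum_j F i j.
Local Notation J := ('I_p.+1 + 'I_q.+1)%type.

Lemma payoff_dist (g x : 'I_p.+1 -> R) (h y y' : 'I_q.+1 -> R) (G : R) :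
  (forall i, `|g i| <= G) -> (forall j, `|h j| <= G) ->
  prob_vec x -> prob_vec y -> prob_vec y' ->
  payoff g h x y - payoff g h x y' <=
    (G + Num.sqrt q.+1%:R * G) * \sum_j `|y j - y' j|.
Proof.
move=> gG hG px py py'; set D := \sum_j _.
have D0 : 0 <= D by apply: sumr_ge0.
have G0 : 0 <= G by exact: le_trans (normr_ge0 _) (gG ord0).
have gx : `|\sum_i g i * x i| <= G.
  rewrite (le_trans (ler_norm_sum _ _ _))// -[leRHS]mulr1 -(proj2 px) mulr_sumr.
  apply: ler_sum => i _; have x0 : 0 <= x i by case: px.
  by rewrite normrM (ger0_norm x0) ler_wpM2r.
have -> : payoff g h x y - payoff g h x y' =
  norm2 x * (\sum_j h j * (y j - y' j)) + (norm2 y - norm2 y') * (\sum_i g i * x i).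
  have -> : \sum_j h j * (y j - y' j) = \sum_j h j * y j - \sum_j h j * y' j.
    by rewrite -sumrB; apply: eq_bigr => j _; rewrite mulrBr.
  by rewrite /payoff; ring.
rewrite [leRHS]mulrDl; apply: lerD.
  apply: le_trans (ler_norm _) _; rewrite normrM (ger0_norm (norm2_ge0 x)).
  rewrite (@le_trans _ _ (`|\sum_j h j * (y j - y' j)|))// ?ler_piMl ?norm2_le1//.
  rewrite (le_trans (ler_norm_sum _ _ _))// mulr_sumr; apply: ler_sum => j _.
  by rewrite normrM ler_wpM2r.
apply: le_trans (ler_norm _) _; rewrite normrM mulrAC; apply: ler_pM => //.
rewrite ler_norml (norm2_dist py py') andbT lerNl opprB.
rewrite (le_trans (norm2_dist py' py))// ler_wpM2l ?sqrtr_ge0//.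
by apply: ler_sum => j _; rewrite distrC.
Qed.

(** Gordon's comparison for the bilinear game: a strategy [x] that holds all
    payoffs below [l] is about as unlikely as for the auxiliary process; the
    factor 2 pays for the extra Gaussian multiple of [|x| |y|]. *)
Lemma gordon_game (E0 : set T) (l tau Kb G Bd : R) (Psi : {ffun J -> R} -> R) :
  measurable E0 -> 0 < tau -> 0 <= Kb -> 0 <= G ->
  (forall w, E0 w -> (forall e, `|X e w| <= Kb) /\
     exists2 x, prob_vec x & forall y, prob_vec y ->
       \sum_e sg * X e w * (x (al e) * y (be e)) <= l) ->
  (forall z, 0 <= Psi z) ->
  (forall z : {ffun J -> R}, Psi z < 1 ->
     [/\ forall i, `|z (inl i)| <= G, forall j, `|z (inr j)| <= G &
       forall x, prob_vec x -> exists2 y, prob_vec y &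
         l + tau <= payoff (fun i => z (inl i)) (fun j => z (inr j)) x y]) ->
  (forall s N, 0 <= s -> N%:R * s ^+ 2 = 1 -> avg (jwalk J s N) Psi 0 <= Bd) ->
  pr P E0 <= 2 * Bd.
Proof.
move=> mE tau0 Kb0 G0 HE Psi0 HPsi HBd; apply/ler_addgt0Pr => eps eps0.
have near (r r' t : R) : r <= r' < r + t -> - t <= r - r' <= t.
  by move=> /andP[? ?]; apply/andP; split; lra.
have cross (u u' r r' : R) : r <= u -> r' <= u' -> u' * r + u * r' <= u * u' + r * r'.
  move=> h1 h2; have : 0 <= (u - r) * (u' - r') by rewrite mulr_ge0// subr_ge0.
  lra.
have quarter (t t' u : R) : 4 * t <= u * t' -> 2 * t <= t' / 2 * u by move=> ?; lra.
have shift (t u r r' : R) : t + u <= r -> r - r' <= u / 2 -> u / 4 <= r' - (t + u / 4).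
  by move=> ? ?; lra.
have settle (t u r r' c : R) : t <= u -> u <= r / 8 -> r' <= c -> r' + (t + r / 8 * 1) <= c + r / 4.
  by move=> ? ? ?; lra.
have finish (t u b r c r' : R) : 1 - r <= b -> 2 * c <= u / 2 -> r <= r' + c ->
    t <= 2 * (1 - r') + u / 2 -> t <= 2 * b + u.
  by move=> ? ? ? ?; lra.
have r0 : 0 <= Num.sqrt q.+1%:R :> R by exact: sqrtr_ge0.
pose LY : R := G + Num.sqrt q.+1%:R * G; have LY0 : 0 <= LY by rewrite addr_ge0// mulr_ge0.
(* Moving [x] to a net of mesh [e1] costs [tau / 8] in the random game, where the
   entries are bounded by [Kb]; moving [y] to a net of mesh [e2] costs [tau / 2] in
   the auxiliary game. *)
pose e1 : R := tau / (8 * (Kb + 1)); have e10 : 0 < e1 by rewrite divr_gt0// mulr_gt0//; lra.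
have e1K : Kb * e1 <= tau / 8.
  have : (Kb + 1) * e1 = tau / 8 by rewrite /e1; field; lra.
  lra.
pose e2 : R := tau / (2 * (LY + 1)); have e20 : 0 < e2 by rewrite divr_gt0// mulr_gt0//; lra.
have e2L : LY * e2 <= tau / 2.
  have : (LY + 1) * e2 = tau / 2 by rewrite /e2; field; lra.
  lra.
have [NX HX] := simplex_net p e10; have [NY HY] := simplex_net q e20.
pose U := {ffun 'I_p.+1 -> 'I_NX.+2}; pose W := {ffun 'I_q.+1 -> 'I_NY.+2}.
pose xs (u : U) : 'I_p.+1 -> R := net_point R u; pose ys (w : W) : 'I_q.+1 -> R := net_point R w.
have pxs u : prob_vec (xs u) by exact: net_point_prob_vec.
have pys w : prob_vec (ys w) by exact: net_point_prob_vec.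
pose vec e : {ffun U * W -> R} := [ffun a => sg * (xs a.1 (al e) * ys a.2 (be e))].
pose v0 : {ffun U * W -> R} := [ffun a => norm2 (xs a.1) * norm2 (ys a.2)].
pose vecY (j : J) : {ffun U * W -> R} := [ffun a => match j with
  | inl i => norm2 (ys a.2) * xs a.1 i | inr j => norm2 (xs a.1) * ys a.2 j end].
(* The level [lam] leaves [tau / 8] for the net and [tau / 8] for rounding the
   Gaussians; the smooth step is complete [tau / 4] higher, as [kap * (tau / 4)] is
   3. *)
pose lam : R := l + tau / 4; pose kap : R := 12 / tau.
have kap0 : 0 <= kap by rewrite divr_ge0// ltW.
have kapE : kap * (tau / 4) = 3 by rewrite /kap; field; rewrite gt_eqF.
pose vs := v0 :: [seq vec e | e <- enum I]; pose ws := [seq vecY j | j <- enum {: J}].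
pose dx (a b : U * W) := \sum_i xs a.1 i * xs b.1 i.
pose dy (a b : U * W) := \sum_j ys a.2 j * ys b.2 j.
have vsE a b : \sum_(v <- vs) v a * v b =
  (norm2 (xs a.1) * norm2 (xs b.1)) * (norm2 (ys a.2) * norm2 (ys b.2)) + dx a b * dy a b.
  rewrite /vs big_cons big_map big_enum /= !ffunE; congr (_ + _); first by ring.
  rewrite -[RHS](_ : \sum_i \sum_j (xs a.1 i * xs b.1 i) * (ys a.2 j * ys b.2 j) = _); last first.
    by rewrite /dx mulr_suml; apply: eq_bigr => i _; rewrite mulr_sumr.
  rewrite -(index_sum (fun i j => (xs a.1 i * xs b.1 i) * (ys a.2 j * ys b.2 j))).
  apply: eq_bigr => e _; rewrite !ffunE.
  transitivity (sg * sg * (xs a.1 (al e) * xs b.1 (al e) * (ys a.2 (be e) * ys b.2 (be e)))).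
    by ring.
  by rewrite sg2 mul1r.
have wsE a b : \sum_(w <- ws) w a * w b =
  (norm2 (ys a.2) * norm2 (ys b.2)) * dx a b + (norm2 (xs a.1) * norm2 (xs b.1)) * dy a b.
  rewrite /ws big_map big_enum /= big_sumType /= /dx /dy !mulr_sumr.
  by congr (_ + _); apply: eq_bigr => i _; rewrite !ffunE; ring.
have cle a b : \sum_(w <- ws) w a * w b <= \sum_(v <- vs) v a * v b.
  by rewrite vsE wsE; apply: cross; exact: dot_le_norm2.
have ceq a b : a.1 = b.1 -> \sum_(w <- ws) w a * w b = \sum_(v <- vs) v a * v b.
  move=> e; rewrite vsE wsE.
  have -> : dx a b = norm2 (xs a.1) * norm2 (xs b.1).
    rewrite -e -expr2 norm2_sqr /dx -e.
    by apply: eq_bigr => i _; rewrite expr2.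
  by ring.
have [[K [D [H JK]]] [C C0 HC]] := @gordon_walk R U W vs ws lam kap kap0 cle ceq.
have JK1 := jet_onem JK.
have K10 : 0 <= 1 + K by case: JK1.
have sad z := @saddle_bounds R U W lam kap z.
pose f0 (z : {ffun U * W -> R}) := 1 - saddle lam kap z.
have f00 z : 0 <= f0 z by rewrite subr_ge0; case/andP: (sad z).
pose f k := avg (cpow (coin R (2 ^- k *: v0)) (4 ^ k)) f0.
have sub v N : subprob (cpow (coin R (v : {ffun U * W -> R})) N).
  by apply: subprob_cpow; exact: subprob_coin.
have fge0 k z : 0 <= f k z by apply: avg_ge0.
have v00 a : 0 <= v0 a by rewrite ffunE mulr_ge0 ?norm2_ge0.
(* The walk along [v0] is independent of the rest and nonpositive with probability at
   least 1/2, and then the saddle function vanishes on the event. *)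
have cond k w : E0 w -> forall z : {ffun I -> R},
    (forall i, z i <= X i w < z i + tau / 8) -> 1 <= 2 * f k (combine vec z).
  move=> Ew z Hz; have [XK [x px Hx]] := HE w Ew.
  have [u Hu] := HX x px.
  rewrite mulrC -ler_pdivrMr// div1r.
  apply: walk_half => // r r_le0; rewrite /f0 saddle_eq0 ?subr0//.
  exists u => w'.
  have -> : (combine vec z + r *: v0) (u, w') = \sum_i z i * vec i (u, w') + r * v0 (u, w').
    rewrite ffunE /combine sum_ffunE [X in _ + X]ffunE; congr (_ + _).
    by apply: eq_bigr => i _; rewrite ffunE.
  have rv : r * v0 (u, w') <= 0 by rewrite mulr_le0_ge0.
  rewrite -[leRHS]addr0 lerD// {rv}.
  have He := Hx (ys w') (pys w').
  have xs0 i : 0 <= xs u i by case: (pxs u).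
  have ys0 j : 0 <= ys w' j by case: (pys w').
  have S1 : \sum_e xs u (al e) * ys w' (be e) = 1.
    rewrite (index_sum (fun i j => xs u i * ys w' j)) -[RHS](proj2 (pxs u)).
    by apply: eq_bigr => i _; rewrite -mulr_sumr (proj2 (pys w')) mulr1.
  have S2 : \sum_e `|x (al e) - xs u (al e)| * ys w' (be e) <= e1.
    rewrite (index_sum (fun i j => `|x i - xs u i| * ys w' j)); apply: le_trans Hu.
    by apply: ler_sum => i _; rewrite -mulr_sumr (proj2 (pys w')) mulr1.
  have sgn : `|sg| = 1.
    have : `|sg| ^+ 2 = 1 by rewrite -normrX expr2 sg2 normr1.
    by move/eqP; rewrite sqrp_eq1// => /eqP.
  apply: (@le_trans _ _ (\sum_e (sg * X e w * (x (al e) * ys w' (be e)) +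
     (Kb * (`|x (al e) - xs u (al e)| * ys w' (be e)) + tau / 8 * (xs u (al e) * ys w' (be e)))))).
    apply: ler_sum => e _; rewrite ffunE /=.
    have -> : z e * (sg * (xs u (al e) * ys w' (be e))) =
      sg * X e w * (x (al e) * ys w' (be e)) + (sg * X e w * (xs u (al e) - x (al e)) * ys w' (be e)
       + sg * (z e - X e w) * (xs u (al e) * ys w' (be e))) by ring.
    rewrite lerD2l; apply: lerD.
      rewrite [leRHS]mulrA ler_wpM2r//; apply: le_trans (ler_norm _) _.
      by rewrite !normrM sgn mul1r distrC ler_wpM2r.
    rewrite ler_wpM2r ?mulr_ge0//; apply: le_trans (ler_norm _) _.
    by rewrite normrM sgn mul1r ler_norml; exact: near.
  rewrite !big_split /= -!mulr_sumr S1.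
  exact: (settle _ _ _ _ _ (ler_wpM2l Kb0 S2) e1K He).
have jets k : exists D' H', jet (1 + K) (f k) D' H'.
  by do 2 eexists; exact: (jet_avg (sub _ _) JK1).
have [k0 Hk0] := @gaussian_to_walk _ _ _ _ _ _ Xind Xstd _ (1 + K) 2 (tau / 8) (eps / 2) vec f E0
  mE K10 (ler0n _ 2) (divr_gt0 tau0 (ltr0n _ 8)) (divr_gt0 eps0 (ltr0n _ 2)) fge0 jets cond.
pose k := maxn k0 (Num.truncn (4 * C / eps)).+1.
have {Hk0} := Hk0 k (leq_maxl _ _).
have Ck : 2 * (C * 2 ^- k) <= eps / 2.
  have h : 4 * C / eps <= 2 ^+ k.
    apply: (le_trans (ltW (truncnS_gt _))).
    rewrite -natrX ler_nat; apply: leq_trans (leq_maxr k0 _) _; rewrite -/k.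
    by apply: ltnW; exact: ltn_expl.
  have p2 : 0 < 2 ^+ k :> R by rewrite exprn_gt0.
  rewrite ler_pdivrMr// in h.
  by rewrite mulrA ler_pdivrMr//; exact: quarter.
set N := (4 ^ k)%N; set s : R := 2 ^- k.
have s0 : 0 <= s by rewrite invr_ge0 exprn_ge0.
have Ns : N%:R * s ^+ 2 = 1.
  have -> : N%:R = 2 ^+ k ^+ 2 :> R.
    by rewrite /N (_ : 4 = 2 ^ 2)%N// -expnM mulnC expnM !natrX.
  by rewrite /s exprVn mulfV// !expf_neq0.
have NC : N%:R * (C * s ^+ 3) = C * s.
  have -> : N%:R * (C * s ^+ 3) = C * s * (N%:R * s ^+ 2) by ring.
  by rewrite Ns mulr1.
have -> : avg (cpow (coins R [seq s *: vec i | i <- enum I]) N) (f k) 0 =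
    avg (cpow (coins R [seq s *: v | v <- vs]) N) f0 0.
  rewrite /vs /coins /= avg_cpow_conv avgC -map_comp.
  by rewrite -!map_comp.
have one mu : avg mu (fun=> 1) 0 = 1 -> avg mu f0 0 = 1 - avg mu (saddle lam kap) 0.
  move=> m1; have -> : f0 = (fun y => 1 + (- 1) * saddle lam kap y).
    by apply/funext => y; rewrite /f0 mulN1r.
  by rewrite avgD avgZ m1 mulN1r.
have mass l' : avg (cpow (coins R (l' : seq {ffun U * W -> R})) N) (fun=> 1) 0 = 1.
  by apply: cpow_cst => y; exact: coins_cst.
rewrite (one _ (mass _)).
have := HC s N 0 s0; rewrite NC.
have YB : avg (cpow (coins R [seq s *: w | w <- ws]) N) f0 0 <= Bd.
  apply: le_trans (HBd s N s0 Ns); rewrite /jwalk.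
  have -> : cpow (coins R [seq s *: w | w <- ws]) N =
      push (combine vecY : {additive _ -> _}) (cpow (coins R [seq s *: unitv R j | j <- enum {: J}]) N).
    rewrite push_cpow push_coins /ws -!map_comp; congr (cpow (coins R _) N).
    by apply: eq_map => j /=; rewrite combine_unitv.
  rewrite avg_push; apply: avg_le => [|z]; first exact: subprob_jwalk.
  rewrite add0r; have [h|h] := leP 1 (Psi z); first by rewrite (le_trans _ h)// gerBl; case/andP: (sad (combine vecY z)).
  have [zG1 zG2 zY] := HPsi z h.
  rewrite /f0 saddle_eq1 ?subrr// => u.
  have [y py hy] := zY (xs u) (pxs u); have [w Hw] := HY y py; exists w.
  have -> : combine vecY z (u, w) = payoff (fun i => z (inl i)) (fun j => z (inr j)) (xs u) (ys w).
    rewrite /combine sum_ffunE big_sumType /= /payoff addrC !mulr_sumr.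
    by congr (_ + _); apply: eq_bigr => i _; rewrite !ffunE /GRing.scale /=; ring.
  have := payoff_dist zG1 zG2 (pxs u) py (pys w); rewrite -/LY => pd.
  have pd2 : LY * \sum_j `|y j - ys w j| <= tau / 2 by apply: le_trans e2L; rewrite ler_wpM2l.
  by rewrite -kapE ler_wpM2l//; exact: shift hy (le_trans pd pd2).
rewrite (one _ (mass _)) in YB.
move: YB Ck; rewrite -/s; exact: finish.
Qed.

End GordonGame.

(** * Concentration of the auxiliary vectors *)

Section Tests.
Variables (R : realType) (n p q : nat).
Hypotheses (n0 : (0 < n)%N) (pq : (p + q <= 3 * n)%N).
Local Notation J := ('I_p + 'I_q)%type.
Local Notation V := {ffun J -> R}.

Definition on_left (phi : R -> R) (j : J) (x : R) : R := if j is inl _ then phi x else 0.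
Definition on_right (phi : R -> R) (j : J) (x : R) : R := if j is inr _ then phi x else 0.

Lemma sum_on_left phi (z : V) : \sum_j on_left phi j (z j) = \sum_i phi (z (inl i)).
Proof. by rewrite big_sumType /= [X in _ + X]big1 ?addr0. Qed.

Lemma sum_on_right phi (z : V) : \sum_j on_right phi j (z j) = \sum_i phi (z (inr i)).
Proof. by rewrite big_sumType /= [X in X + _]big1 ?add0r. Qed.

(** Components: the summands of a statistic, a Chernoff parameter, a threshold. *)
Definition test := ((J -> R -> R) * R * R)%type.

Definition test_value (c : test) (z : V) : R := c.1.2 * (\sum_j c.1.1 j (z j) - c.2).

Let C0 : R := 128 * 128 * 2.
Let D0 : R := 6 * C0.
Let rn : R := Num.sqrt n%:R.
Let nR : 0 < (n%:R : R). Proof. by rewrite ltr0n. Qed.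
Let rn0 : 0 < rn. Proof. by rewrite sqrtr_gt0. Qed.
Let rn2 : rn ^+ 2 = n%:R. Proof. by rewrite sqr_sqrtr// ltW. Qed.

(** The parameters optimise the Chernoff bounds for deviations of [s * sqrt n]
    and of [n / 20]. *)
Definition tests (s : R) : seq test :=
  let ls := s / (rn * D0) in let ln := (20 * D0)^-1 in
  let neg (x : R) := pos (- x) ^+ 2 in let psq (x : R) := pos x ^+ 2 in
  [:: (on_left neg, ls, p%:R / 2 + s * rn);
      (on_right psq, - ls, q%:R / 2 - s * rn);
      (on_left neg, - ln, p%:R / 2 - n%:R / 20);
      (on_right psq, ln, q%:R / 2 + n%:R / 20);
      (on_left (fun x => pos (- x - 1) ^+ 2), ln, 3 / 32 * p%:R + n%:R / 20);
      (on_right (fun x => pos (x - 1) ^+ 2), ln, 3 / 32 * q%:R + n%:R / 20);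
      (on_left psq, ln, p%:R / 2 + n%:R / 20);
      (on_right neg, ln, q%:R / 2 + n%:R / 20)].

Definition tests_exp (s : R) (z : V) : R := \sum_(c <- tests s) expR (test_value c z).

Lemma tests_exp_ge0 s z : 0 <= tests_exp s z.
Proof. by apply: sumr_ge0 => c _; exact: expR_ge0. Qed.

(** A sum of exponentials below 1 forces every exponent to be negative. *)
Lemma tests_concentrated s z : 0 < s -> tests_exp s z < 1 ->
  concentrated n (fun i => z (inl i)) (fun j => z (inr j)) s.
Proof.
move=> s0 h.
have D00 : 0 < D0 by rewrite !mulr_gt0.
have ls0 : 0 < s / (rn * D0) by rewrite divr_gt0// mulr_gt0.
have ln0 : 0 < (20 * D0)^-1 by rewrite invr_gt0 mulr_gt0.
have all c : c \in [seq test_value c z | c <- tests s] -> c < 0.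
  move=> /mapP[t tt ->]; rewrite ltNge; apply/negP => v0.
  have : 1 <= expR (test_value t z) by rewrite -[leLHS]expR0 ler_expR.
  have : expR (test_value t z) <= tests_exp s z.
    rewrite /tests_exp (perm_big _ (perm_to_rem tt)) big_cons lerDl.
    by apply: sumr_ge0 => c' _; exact: expR_ge0.
  lra.
have lt0 (l a b : R) : 0 < l -> l * (a - b) < 0 -> a <= b.
  by move=> l0; rewrite pmulr_rlt0// subr_lt0 => /ltW.
have gt0 (l a b : R) : 0 < l -> - l * (a - b) < 0 -> b <= a.
  by move=> l0; rewrite mulNr oppr_lt0 pmulr_rgt0// subr_gt0 => /ltW.
have nth_lt0 i : (i < 8)%N -> nth 0 [seq test_value c z | c <- tests s] i < 0.
  by move=> i8; apply/all/mem_nth; rewrite size_map.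
move: nth_lt0; rewrite /tests; set ls := s / _ in ls0 *; set ln := _^-1 in ln0 *.
move=> nth_lt0; split; split.
- by have := nth_lt0 0%N isT; rewrite /test_value /= sum_on_left; exact: lt0 ls0.
- by have := nth_lt0 1%N isT; rewrite /test_value /= sum_on_right; exact: gt0 ls0.
- by have := nth_lt0 2%N isT; rewrite /test_value /= sum_on_left; exact: gt0 ln0.
- by have := nth_lt0 3%N isT; rewrite /test_value /= sum_on_right; exact: lt0 ln0.
- by have := nth_lt0 4%N isT; rewrite /test_value /= sum_on_left; exact: lt0 ln0.
- by have := nth_lt0 5%N isT; rewrite /test_value /= sum_on_right; exact: lt0 ln0.
- by have := nth_lt0 6%N isT; rewrite /test_value /= sum_on_left; exact: lt0 ln0.
- by have := nth_lt0 7%N isT; rewrite /test_value /= sum_on_right; exact: lt0 ln0.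
Qed.

Lemma pos_sqr_le (x y : R) : y <= `|x| -> pos y ^+ 2 <= x ^+ 2.
Proof.
move=> yx; rewrite -[x ^+ 2]real_normK ?num_real// lerXn2r ?nnegrE ?pos_ge0//.
by rewrite /pos ge_max yx normr_ge0.
Qed.

(** Each test contributes [exp (- lam d + 3 C0 n lam^2)], where [d] is its
    deviation; [lam = d / (6 C0 n)] is the optimal choice. *)
Lemma tests_bound (s u : R) N : 0 < s -> s <= rn / 20 -> N%:R * u ^+ 2 = 1 ->
  avg (jwalk J u N) (tests_exp s) 0 <=
    2 * expR (- (s ^+ 2 / (2 * D0))) + 6 * expR (- (n%:R / 400 / (2 * D0))).
Proof.
move=> s0 s1 uN.
have D00 : 0 < D0 by rewrite !mulr_gt0.
have C00 : 0 < C0 by rewrite !mulr_gt0.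
pose ls := s / (rn * D0); pose ln := (20 * D0)^-1.
have rnD : 0 < rn * D0 by rewrite mulr_gt0.
have ls0 : 0 < ls by rewrite divr_gt0.
have ln0 : 0 < ln by rewrite invr_gt0 mulr_gt0.
have ln64 : `|ln| <= 64^-1.
  by rewrite gtr0_norm// lef_pV2 ?posrE ?mulr_gt0// /D0 /C0; lra.
have ls64 : `|ls| <= 64^-1.
  rewrite gtr0_norm//; apply: le_trans (le_trans (ler_norm ln) ln64).
  rewrite /ls /ln ler_pdivrMr// invfM mulrACA mulVf ?gt_eqF// mulr1; lra.
have pqR : (#|{: J}|%:R : R) <= 3 * n%:R.
  by rewrite card_sum !card_ord -natrM ler_nat.
have sq (x : R) : 0 <= pos x ^+ 2 <= x ^+ 2 by rewrite sqr_ge0 pos_sqr_le// ler_norm.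
have sqN (x : R) : 0 <= pos (- x) ^+ 2 <= x ^+ 2.
  by rewrite sqr_ge0 pos_sqr_le// -normrN ler_norm.
have ex (x : R) : 0 <= pos (x - 1) ^+ 2 <= x ^+ 2.
  by rewrite sqr_ge0 pos_sqr_le//; have := ler_norm x; lra.
have exN (x : R) : 0 <= pos (- x - 1) ^+ 2 <= x ^+ 2.
  by rewrite sqr_ge0 pos_sqr_le//; have := ler_norm (- x); rewrite normrN; lra.
have onL phi (j : J) x : (forall x : R, 0 <= phi x <= x ^+ 2) -> 0 <= on_left phi j x <= x ^+ 2.
  by move=> H; case: j => _ /=; [exact: H|rewrite lexx sqr_ge0].
have onR phi (j : J) x : (forall x : R, 0 <= phi x <= x ^+ 2) -> 0 <= on_right phi j x <= x ^+ 2.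
  by move=> H; case: j => _ /=; [rewrite lexx sqr_ge0|exact: H].
have meanL phi : \sum_j wexp u N (on_left phi j) = p%:R * wexp u N phi.
  rewrite big_sumType /= [X in _ + X]big1 ?addr0; last by move=> j _; exact: wexp_cst.
  by rewrite (eq_bigr (fun=> wexp u N phi))// sumr_const card_ord -[LHS]mulr_natl.
have meanR phi : \sum_j wexp u N (on_right phi j) = q%:R * wexp u N phi.
  rewrite big_sumType /= [X in X + _]big1 ?add0r; last by move=> j _; exact: wexp_cst.
  by rewrite (eq_bigr (fun=> wexp u N phi))// sumr_const card_ord -[LHS]mulr_natl.
have step phi (lam a e : R) : (forall (j : J) x, 0 <= phi j x <= x ^+ 2) -> `|lam| <= 64^-1 ->
    lam * (\sum_j wexp u N (phi j) - a) + C0 * (3 * n%:R) * lam ^+ 2 <= e ->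
    avg (jwalk J u N) (fun z => expR (test_value (phi, lam, a) z)) 0 <= expR e.
  move=> hphi l64 he; apply: le_trans (jwalk_chernoff uN a l64 hphi) _.
  rewrite ler_expR; apply: le_trans he; rewrite lerD2l -/C0.
  by rewrite ler_wpM2r ?sqr_ge0// ler_wpM2l// ltW.
have Es : - (ls * (s * rn)) + C0 * (3 * n%:R) * ls ^+ 2 = - (s ^+ 2 / (2 * D0)).
  have rnn := gt_eqF rn0; have Cn := gt_eqF C00.
  by rewrite -rn2 /ls /D0; field; rewrite rnn Cn.
have En : - (ln * (n%:R / 20)) + C0 * (3 * n%:R) * ln ^+ 2 = - (n%:R / 400 / (2 * D0)).
  have Cn := gt_eqF C00.
  by rewrite /ln /D0; field; rewrite Cn.
have stepL phi lam a e : (forall x : R, 0 <= phi x <= x ^+ 2) -> `|lam| <= 64^-1 ->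
    lam * (p%:R * wexp u N phi - a) + C0 * (3 * n%:R) * lam ^+ 2 <= e ->
    avg (jwalk J u N) (fun z => expR (test_value (on_left phi, lam, a) z)) 0 <= expR e.
  by move=> hphi l64; rewrite -meanL; apply: step => // j x; exact: onL.
have stepR phi lam a e : (forall x : R, 0 <= phi x <= x ^+ 2) -> `|lam| <= 64^-1 ->
    lam * (q%:R * wexp u N phi - a) + C0 * (3 * n%:R) * lam ^+ 2 <= e ->
    avg (jwalk J u N) (fun z => expR (test_value (on_right phi, lam, a) z)) 0 <= expR e.
  by move=> hphi l64; rewrite -meanR; apply: step => // j x; exact: onR.
have ls64N : `|- ls| <= 64^-1 by rewrite normrN.
have ln64N : `|- ln| <= 64^-1 by rewrite normrN.
have m1 := wexp_pos_sqr uN; have m2 := wexp_neg_sqr uN.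
have m3 : p%:R * wexp u N (fun x => pos (- x - 1) ^+ 2) <= 3 / 32 * p%:R.
  by rewrite mulrC ler_wpM2r// wexp_neg_excess.
have m4 : q%:R * wexp u N (fun x => pos (x - 1) ^+ 2) <= 3 / 32 * q%:R.
  by rewrite mulrC ler_wpM2r// wexp_pos_excess.
rewrite /tests_exp avg_sum /tests -/ls -/ln !big_cons big_nil.
set e1 := - (s ^+ 2 / (2 * D0)); set e2 := - (n%:R / 400 / (2 * D0)).
rewrite -/e1 in Es; rewrite -/e2 in En.
rewrite (_ : 2 * expR e1 + 6 * expR e2 = expR e1 + (expR e1 + (expR e2 + (expR e2 +
  (expR e2 + (expR e2 + (expR e2 + (expR e2 + 0)))))))); last by ring.
apply: lerD; first by apply: stepL => //; rewrite m2 -Es; lra.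
apply: lerD; first by apply: stepR => //; rewrite m1 -Es sqrrN; lra.
apply: lerD; first by apply: stepL => //; rewrite m2 -En sqrrN; lra.
apply: lerD; first by apply: stepR => //; rewrite m1 -En; lra.
apply: lerD.
  apply: stepL => //; rewrite -En lerD2r -mulrN ler_wpM2l ?(ltW ln0)//; lra.
apply: lerD.
  apply: stepR => //; rewrite -En lerD2r -mulrN ler_wpM2l ?(ltW ln0)//; lra.
apply: lerD; first by apply: stepL => //; rewrite m1 -En; lra.
apply: lerD; first by apply: stepR => //; rewrite m2 -En; lra.
by [].
Qed.

End Tests.

(** * Tails of the game value *)

(** The constant is [2 * (6 * C)], where [C] is that of [wexp_mgf] and the factor 6
    comes from optimising a Chernoff bound over at most [3 n] coordinates. *)
Definition deviation_bound (R : realType) (n : nat) (s : R) : R :=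
  2 * expR (- (s ^+ 2 / (2 * (6 * (128 * 128 * 2))))) + 6 * expR (- (n%:R / 400 / (2 * (6 * (128 * 128 * 2))))).

Section GameTail.
Variables (R : realType) (d : measure_display) (T : measurableType d)
  (P : probability T R) (I : finType) (X : I -> {RV P >-> R}).
Hypothesis Xind : mutually_independent X.
Hypothesis Xstd : forall i, standard_normal (X i).
Variables (n p q : nat) (al : I -> 'I_p.+1) (be : I -> 'I_q.+1) (sg : R).
Hypotheses (n0 : (0 < n)%N) (pq : (p.+1 + q.+1 <= 3 * n)%N).
Hypothesis sg2 : sg * sg = 1.
Hypothesis index_sum : forall F : 'I_p.+1 -> 'I_q.+1 -> R,
  \sum_e F (al e) (be e) = \sum_i \sum_j F i j.

(** The bound on the entries required by [gordon_game] is removed by letting the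
    box grow. *)
Lemma game_tail (E : set T) (l tau s : R) : measurable E -> 0 < tau -> 0 < s ->
  s <= Num.sqrt n%:R / 20 ->
  (forall w, E w -> exists2 x, prob_vec x & forall y, prob_vec y ->
     \sum_e sg * X e w * (x (al e) * y (be e)) <= l) ->
  (forall (g : 'I_p.+1 -> R) (h : 'I_q.+1 -> R), concentrated n g h s ->
     [/\ forall i, `|g i| <= p.+1%:R, forall j, `|h j| <= q.+1%:R &
       forall x, prob_vec x -> exists2 y, prob_vec y & l + tau <= payoff g h x y]) ->
  pr P E <= 2 * deviation_bound n s.
Proof.
move=> mE tau0 s0 s1 HE Hc; apply/ler_addgt0Pr => eps eps0.
pose b : R := 1 + #|I|%:R / eps.
have I0 : 0 <= (#|I|%:R : R) / eps by rewrite divr_ge0// ltW.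
have b0 : 0 < b by rewrite /b; lra.
have small : #|I|%:R * b ^- 2 <= eps.
  rewrite ler_pdivrMr ?exprn_gt0// -ler_pdivrMl// mulrC.
  apply: (@le_trans _ _ b); first by rewrite lerDr.
  by rewrite expr2 ler_peMr ?(ltW b0)// lerDl.
apply: le_trans (pr_le_box Xind Xstd mE b0) _; apply: lerD => //.
set box := [set w | _].
have mbox : measurable box.
  by apply: (@measurable_box _ _ _ P I X (fun=> [set` `[- b, b[ ])) => _; exact: measurable_itv.
apply: (gordon_game Xind Xstd sg2 index_sum (l := l) (tau := tau) (Kb := b)
  (G := (p.+1 + q.+1)%:R) (Psi := @tests_exp R n p.+1 q.+1 s)) => //.
- exact: measurableI.
- exact: ltW.
- move=> w [Ew Bw]; split; last exact: HE.
  move=> e; have := Bw e; rewrite /= in_itv /= => /andP[h1 h2].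
  by rewrite ler_norml h1 ltW.
- exact: tests_exp_ge0.
- move=> z hz; have [h1 h2 h3] := Hc _ _ (tests_concentrated n0 s0 hz); split => //.
  + by move=> i; rewrite (le_trans (h1 i))// ler_nat leq_addr.
  + by move=> j; rewrite (le_trans (h2 j))// ler_nat leq_addl.
- by move=> u N _ uN; exact: tests_bound.
Qed.

End GameTail.

Section RandomGame.
Variables (R : realType) (n m : nat) (d : measure_display) (T : measurableType d)
  (P : probability T R) (M : 'I_n.+1 -> 'I_m.+1 -> {RV P >-> R}).

Lemma measurable_game_value : measurable_fun setT (fun w => game_value (sample_matrix M w)).
Proof.
pose F (z : {ffun 'I_n.+1 * 'I_m.+1 -> R}) := game_value (\matrix_(i, j) z (i, j)).
have := @measurable_lipschitz _ _ _ P _ (fun e : 'I_n.+1 * 'I_m.+1 => M e.1 e.2) F.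
have -> : (fun w => F [ffun e => M e.1 e.2 w]) = (fun w => game_value (sample_matrix M w)).
  by apply/funext => w; congr game_value; apply/matrixP => i j; rewrite !mxE ffunE.
apply => z z' e H; apply: game_value_lip => // i j; rewrite !mxE.
by have := H (i, j); rewrite ler_distl => /andP[_]; rewrite -lerBlDr; lra.
Qed.

Hypotheses (iid : iid_gaussian_entries M) (n2 : (2 <= n.+1)%N) (nm : (n.+1 <= m.+1)%N)
  (mn : (m.+1 <= 2 * n.+1)%N).
Variables (t s : R).
Hypotheses (t0 : 0 < t) (s0 : 0 < s) (st : s <= t / 100) (sn : s <= Num.sqrt n.+1%:R / 20).

Let D : R := (Num.sqrt m.+1%:R - Num.sqrt n.+1%:R) / n.+1%:R.
Let N0 : 0 < n.+1%:R :> R. Proof. by []. Qed.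
Let tau0 : 0 < t / (2 * n.+1%:R). Proof. by rewrite divr_gt0// mulr_gt0. Qed.
Let nn : n.+1%:R <= n.+1%:R :> R. Proof. by []. Qed.
Let nmR : n.+1%:R <= m.+1%:R :> R. Proof. by rewrite ler_nat. Qed.

(** The deviations [s <= t / 100] leave room in [t / n] for the margin of
    [gordon_game]. *)
Let budget : 42 * s / n.+1%:R + t / (2 * n.+1%:R) <= t / n.+1%:R.
Proof.
have -> : t / (2 * n.+1%:R) = t / 2 / n.+1%:R by rewrite invfM mulrA.
rewrite -mulrDl ler_wpM2r ?invr_ge0//; have := st; have := t0; lra.
Qed.

Let size3 : (n.+1 + m.+1 <= 3 * n.+1)%N.
Proof. by rewrite (mulSn 2) leq_add2l. Qed.

Lemma value_lower_tail :
  pr P [set w | game_value (sample_matrix M w) < 4^-1 * D - t / n.+1%:R] <=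
    2 * deviation_bound n.+1 s.
Proof.
have [ind std] := iid.
apply: (game_tail (X := fun e => M e.1 e.2) (al := fst) (be := snd) (sg := 1)
  (l := 4^-1 * D - t / n.+1%:R) ind (fun e => std e.1 e.2) _ size3 _ _ _ tau0 s0 sn) => //.
- by rewrite mulr1.
- by move=> F; rewrite pair_bigA.
- have := measurable_game_value measurableT (measurable_itv `]-oo, 4^-1 * D - t / n.+1%:R[).
  by rewrite setTI; congr measurable; apply/seteqP; split=> w /=; rewrite in_itv.
- move=> w /(game_value_lt (ltn0Sn n))[x px xl]; exists x => // y py.
  apply: le_trans (ltW (xl y py)); rewrite /pay pair_bigA /=.
  by apply: ler_sum => e _; rewrite mul1r mxE.
- move=> g h conc; have [_ [_ S0 _ [gb hb]]] := concentrated_bounds n2 sn nn nmR conc.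
  split=> // x px; exists (response h); first exact: response_prob_vec.
  apply: le_trans (payoff_ge_lower n2 nm mn (ltW s0) sn conc px); rewrite -/D.
  have := budget; move: D (t / _) (t / (2 * _)) (42 * s / _); move=> a b c e; lra.
Qed.

(** By [minimax], a high value gives the column player a strategy that is good
    against every row.  That player is the minimiser of the transposed game with
    the opposite entries, which are again independent standard Gaussians. *)
Lemma value_upper_tail :
  pr P [set w | 40 * Num.sqrt 2 * D + t / n.+1%:R < game_value (sample_matrix M w)] <=
    2 * deviation_bound n.+1 s.
Proof.
have [ind std] := iid; set u := _ + _.
apply: (game_tail (X := fun e => M e.1 e.2) (al := snd) (be := fst) (sg := -1)
  (l := - u) ind (fun e => std e.1 e.2) _ _ _ _ _ tau0 s0 sn) => //.
- by rewrite addnC.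
- by rewrite mulrNN mulr1.
- by move=> F; rewrite exchange_big pair_bigA.
- have := measurable_game_value measurableT (measurable_itv `]u, +oo[).
  by rewrite setTI; congr measurable; apply/seteqP; split=> w /=; rewrite in_itv /= andbT.
- move=> w /= uv; pose u1 := (u + game_value (sample_matrix M w)) / 2.
  have uu1 : u < u1 by rewrite /u1; move: uv; lra.
  have u1v : u1 < game_value (sample_matrix M w) by rewrite /u1; move: uv; lra.
  have [y py yu] := minimax (ltn0Sn n) uu1 (fun x px => game_value_gt (ltn0Sn m) u1v px).
  exists y => // x px; rewrite lerNr; apply: le_trans (yu x px) _.
  rewrite /pay pair_bigA /= -sumrN; apply: ler_sum => e _.
  by rewrite mxE (mulrC (y _)) mulN1r mulNr opprK.
- move=> g h conc; have [_ [_ S0 _ [gb hb]]] := concentrated_bounds n2 sn nmR nn conc.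
  split=> // x px; exists (response h); first exact: response_prob_vec.
  apply: le_trans (payoff_ge_upper n2 nm mn (ltW s0) sn conc px); rewrite -/D /u.
  have := budget; move: (_ * D) (t / _) (t / (2 * _)) (42 * s / _); move=> a b c e; lra.
Qed.

End RandomGame.

Theorem theorem3p1 (R : realType) :
  exists c1 c2 c3 c4 : R,
    [/\ 0 < c1, 0 < c2, 0 < c3 & 0 < c4] /\
    forall (n m : nat),
      (2 <= n)%N -> (2 <= m)%N -> (n <= m)%N -> (m <= 2 * n)%N ->
    forall (d : measure_display) (T : measurableType d) (P : probability T R)
      (M : 'I_n -> 'I_m -> {RV P >-> R}),
      iid_gaussian_entries M ->
    forall t : R, 0 < t ->
      ((1 - c1 * expR (- (c2 * t ^+ 2)) - c3 * expR (- (c4 * n%:R)))%:E <=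
       P [set w : T |
            (4^-1 * ((Num.sqrt m%:R - Num.sqrt n%:R) / n%:R) - t / n%:R
              <= game_value (sample_matrix M w)
              <= 40 * Num.sqrt 2 * ((Num.sqrt m%:R - Num.sqrt n%:R) / n%:R)
                 + t / n%:R)%R])%E.
Proof.
pose c : R := (2 * (6 * (128 * 128 * 2)))^-1.
have c0 : 0 < c by rewrite invr_gt0 !mulr_gt0.
exists 8, (c / (100 * 100)), 32, (c / 400); split.
  by split; rewrite ?divr_gt0 ?mulr_gt0 ?ltr0n.
move=> [|n] [|m] // n2 _ nm mn d T P M iid t t0.
set lo := _ - t / _; set hi := _ + t / _.
set v := fun w => game_value (sample_matrix M w).
have mv : measurable_fun setT v := @measurable_game_value R n m d T P M.
(* Beyond [sqrt n / 20] the concentration estimates do not improve, and the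
   probability is already exponentially small in [n]. *)
pose s : R := Num.min (t / 100) (Num.sqrt n.+1%:R / 20).
have s0 : 0 < s by rewrite lt_min !divr_gt0// sqrtr_gt0.
have st : s <= t / 100 by rewrite ge_min lexx.
have sn : s <= Num.sqrt n.+1%:R / 20 by rewrite ge_min lexx orbT.
have low := value_lower_tail iid n2 nm mn t0 s0 st sn.
have upp := value_upper_tail iid n2 nm mn t0 s0 st sn.
rewrite -/lo in low; rewrite -/hi in upp.
have mlow : measurable [set w | v w < lo].
  have := mv measurableT _ (measurable_itv `]-oo, lo[).
  by rewrite setTI; congr measurable; apply/seteqP; split=> w /=; rewrite in_itv.
have mupp : measurable [set w | hi < v w].
  have := mv measurableT _ (measurable_itv `]hi, +oo[).
  by rewrite setTI; congr measurable; apply/seteqP; split=> w /=; rewrite in_itv /= andbT.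
set good := [set w | _].
have goodE : good = ~` ([set w | v w < lo] `|` [set w | hi < v w]).
  apply/seteqP; split=> w /=; rewrite /good /= -/(v w).
    by move=> /andP[h1 h2] [|]; rewrite ltNge ?h1 ?h2.
  by move=> h; apply/andP; split; rewrite leNgt; apply/negP => h'; apply: h; [left|right].
have mbad := measurableU _ _ mlow mupp.
have mgood : measurable good by rewrite goodE; exact: measurableC.
rewrite -(EFin_pr P mgood) lee_fin.
have -> : pr P good = 1 - pr P ([set w | v w < lo] `|` [set w | hi < v w]).
  by apply: EFin_inj; rewrite EFinB !EFin_pr// goodE; exact: probability_setC.
have bad := @pr_setU _ _ _ P _ _ _ mbad mlow mupp (@subset_refl _ _).
have es : expR (- (s ^+ 2 / (2 * (6 * (128 * 128 * 2))))) <=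
    expR (- (c / (100 * 100) * t ^+ 2)) + expR (- (c / 400 * n.+1%:R)).
  have [e1 e2] := (expR_ge0 (- (c / (100 * 100) * t ^+ 2)), expR_ge0 (- (c / 400 * n.+1%:R))).
  rewrite -/c /s minEle; case: ifP => _.
    rewrite (_ : (t / 100) ^+ 2 * c = c / (100 * 100) * t ^+ 2); last by field.
    lra.
  rewrite exprMn sqr_sqrtr// (_ : n.+1%:R * 20^-1 ^+ 2 * c = c / 400 * n.+1%:R); last by field.
  lra.
have en : n.+1%:R / 400 / (2 * (6 * (128 * 128 * 2))) = c / 400 * n.+1%:R.
  by rewrite -/c; ring.
rewrite /deviation_bound en in low upp.
move: low upp bad es; rewrite /v; clear; lra.
Qed.
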